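(* Let $m\ge1$ and let $L(k)$ be the operator bunch described in the context. Then for each $\nu=m,\dots,2m-1$ the bunch $L(k)$ has only finitely many eigenvalues in the sector $S_\nu$, including its boundary.
   Context: Let $p_{\gamma s n}\in\mathbb{C}$ ($0\le\gamma\le2m-2$, $0\le s\le2m-\gamma-1$, $n\ge1$) satisfy $\sum_{\gamma,s,n}n^{\gamma+s}|p_{\gamma s n}|<\infty$, and put $p_\gamma(x,k)=\sum_{s=0}^{2m-\gamma-1}\sum_{n=1}^\infty p_{\gamma s n}k^se^{-nx}$. The operator bunch (pencil) $L(k)$ is generated in $L_2[0,\infty)$ by $$l(y)=(-1)^my^{(2m)}(x)+\sum_{\gamma=0}^{2m-2}p_\gamma(x,k)y^{(\gamma)}(x)-k^{2m}y(x)$$ with boundary conditions $y^{(j)}(0)=0$, $j=0,\dots,m-1$. A number $k\in\mathbb{C}$ is an eigenvalue of the bunch if there is a nonzero $y\in L_2[0,\infty)$ with $l(y)=0$ satisfying these boundary conditions. Sectors: $S_\nu=\{k\in\mathbb{C}\setminus\{0\}:\nu\pi/m<\arg k<(\nu+1)\pi/m\}$, $\nu=0,\dots,2m-1$. *)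

(* Defs.v *)
(* Everything is over Stdlib's R: Coquelicot provides C and the calculus of
   C-valued functions, MathComp-Analysis the Lebesgue measure (through the
   realType structure on R) and finite sets. *)
From mathcomp Require Import all_boot all_order all_algebra.
From mathcomp Require Import all_classical all_reals all_analysis.
From mathcomp Require Import Rstruct Rstruct_topology.
From Stdlib Require Import Reals.
From Coquelicot Require Import Coquelicot.
From mathcomp Require Import ssrnat. (* %N again denotes nat_scope *)

Set Implicit Arguments.
Unset Strict Implicit.
Unset Printing Implicit Defensive.

Open Scope R_scope.

(* Coefficient families are total functions p : nat -> nat -> nat -> C; only the
   values p g s n with g <= 2m-2, s <= 2m-g-1 and n >= 1 are ever used.
   Series are indexed from 0, hence the shift n.+1.
   Recall that sum_n a N = a 0 + ... + a N. *)

Definition summable_coef (m : nat) (p : nat -> nat -> nat -> C) : Prop :=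
  ex_series (fun n : nat =>
    sum_n (fun g : nat =>
      sum_n (fun s : nat => INR n.+1 ^ (g + s)%N * Cmod (p g s n.+1))
        (2 * m - g - 1)%N)
      (2 * m - 2)%N).

(* Coquelicot's Series is real-valued: sum real and imaginary parts. *)
Definition CSeries (a : nat -> C) : C :=
  (Series (fun n : nat => Re (a n)), Series (fun n : nat => Im (a n))).

Definition potential (m : nat) (p : nat -> nat -> nat -> C)
    (g : nat) (x : R) (k : C) : C :=
  sum_n (fun s : nat =>
    CSeries (fun n : nat =>
      (p g s n.+1 * k ^ s * RtoC (exp (- INR n.+1 * x)))%C))
    (2 * m - g - 1)%N.

(* Derivative on the half-line [0, +oo[, one-sided at x = 0: this is Coquelicot's
   is_derive with locally x restricted to [0, +oo[. *)
Definition is_derive_half (f : R -> C) (x : R) (l : C) : Prop :=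
  @filterdiff R_AbsRing R_NormedModule C_R_NormedModule f
    (within (fun t : R => 0 <= t) (locally x))
    (fun h : R => scal h (l : C_R_NormedModule)).

(* Y j is the j-th derivative on [0, +oo[ of y, for all j <= N; the values
   outside [0, +oo[ are irrelevant. *)
Definition derivatives (N : nat) (y : R -> C) (Y : nat -> R -> C) : Prop :=
  (forall x : R, 0 <= x -> Y 0%N x = y x) /\
  (forall (j : nat) (x : R), (j < N)%N -> 0 <= x ->
     is_derive_half (Y j) x (Y j.+1 x)).

(* l(y) at x, where Y j is the j-th derivative of y. *)
Definition pencil_expr (m : nat) (p : nat -> nat -> nat -> C) (k : C)
    (Y : nat -> R -> C) (x : R) : C :=
  (RtoC ((-1) ^ m) * Y (2 * m)%N x
   + sum_n (fun g : nat => potential m p g x k * Y g x) (2 * m - 2)%N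
   - k ^ (2 * m)%N * Y 0%N x)%C.

Definition half_line : set (measurableTypeR R) := [set x : R | 0 <= x]%classic.

(* For complex-valued functions, as the MathComp-Analysis spaces Lfun consist of
   real-valued functions. *)
Definition L2_half_line (y : R -> C) : Prop :=
  measurable_fun half_line (fun x => Re (y x) : measurableTypeR R) /\
  measurable_fun half_line (fun x => Im (y x) : measurableTypeR R) /\
  (@lebesgue_measure R).-integrable half_line
    (fun x => (Cmod (y x) ^ 2)%:E).

(* The coefficients are continuous in x, so the solutions of l(y) = 0 are
   classical (2m times differentiable on [0, +oo[); in particular y is nonzero
   in L_2 iff it is nonzero at some point of [0, +oo[. *)
Definition is_eigenvalue (m : nat) (p : nat -> nat -> nat -> C) (k : C) : Prop :=
  exists (y : R -> C) (Y : nat -> R -> C),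
    L2_half_line y /\
    (exists x : R, 0 <= x /\ y x <> RtoC 0) /\
    derivatives (2 * m)%N y Y /\
    (forall x : R, 0 <= x -> pencil_expr m p k Y x = RtoC 0) /\
    (forall j : nat, (j < m)%N -> Y j 0 = RtoC 0).

(* For nu <= 2m-1 the angle t lies in ]0, 2 PI[, so t is the argument of k
   in [0, 2 PI[. *)
Definition sector (m nu : nat) (k : C) : Prop :=
  exists r t : R, 0 < r /\
    INR nu * PI / INR m < t < INR nu.+1 * PI / INR m /\
    k = (r * cos t, r * sin t).

(* Topological closure of the sector, i.e. the sector with its boundary;
   it contains the vertex 0. *)
Definition closed_sector (m nu : nat) (k : C) : Prop :=
  forall eps : posreal, exists z : C, sector m nu z /\ Cmod (z - k)%C < eps.

(* Main.v *)
(** The substitution y = exp(theta k x) sum_n a_n exp(-n x), where theta runs over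
    the 2m roots of theta^(2m) = (-1)^m, turns l(y) = 0 into a recursion for the a_n
    whose solutions are rational functions of k. On a disc |k| <= r only finitely
    many denominators vanish; away from their zeros the 2m resulting Jost solutions
    span all solutions, and an eigenfunction, being small at infinity, combines only
    the m of them with Re (theta k) < 0 in the open sector. Hence each eigenvalue is
    a zero of the m x m determinant W of their initial values. After clearing
    denominators, W is a uniform limit of polynomials bounded in the norm
    sum_i |c_i| (4r)^i, and dividing out zeros shows that such a function vanishes
    identically or has finitely many zeros in the disc.

    Both the bound on the eigenvalues and W <> 0 come from an a priori estimate for
    large |k|. In the components z_j along the exponents theta_j k, the coefficients
    p_{gamma,s} with gamma + s = 2m - 1 contribute a coupling of order 1 and the other
    ones a coupling of order 1/|k|. Since the gaps between the exponents have order
    |k|, a near-identity change of unknowns makes the off-diagonal coupling of order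
    1/|k|, so that a decaying solution bounded by M and satisfying the boundary
    conditions is bounded by M/2, hence is zero. *)

Require Import Defs.
From HB Require Import structures.
From mathcomp Require Import all_boot all_order all_algebra.
From mathcomp Require Import perm.
From mathcomp Require Import all_classical all_reals all_analysis.
From mathcomp Require Import Rstruct Rstruct_topology.
From Stdlib Require Import Reals Lra.
From Coquelicot Require Import Coquelicot.
From mathcomp Require Import ssrnat.
Import GRing.Theory.

Set Implicit Arguments.
Unset Strict Implicit.
Unset Printing Implicit Defensive.

(** * Complex numbers as a field *)

Delimit Scope ring_scope with G.

(** No complex function theory is used. The Jost data are controlled on the disc with the zeros of
    the common denominator removed, a set on which no topology is imposed; the weighted coefficient
    norm takes the place of analyticity there and gives the substitute for the identity theorem.

    The two halves of the argument meet at a single point. The disc radius r is at least the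
    threshold of the a priori estimate, and the circle |k| = r carries a point of the open sector
    without resonances. There W is available, because the point lies in the disc, and the estimate
    applies, because |k| = r is large enough; hence W is not zero at that point.

    Two obstacles shape the estimate. A coupling of order 1 cannot be treated as small, so the gaps
    between the exponents must be exploited. On the boundary of the sector an exponent may be purely
    imaginary, so it contributes no exponential gain; only the weight exp(-x), whose integral is 1,
    is available.

    Square integrability by itself only says that y is small somewhere in each interval far out. An
    energy argument turns this into decay of y and its derivatives up to order 2m - 1. *)

HB.instance Definition _ := Choice.copy C (R * R)%type.

Lemma C_addA : associative Cplus.
Proof. exact: Cplus_assoc. Qed.

Lemma C_addNr : left_inverse (RtoC 0) Copp Cplus.
Proof. by move=> x; rewrite Cplus_comm; exact: Cplus_opp_r. Qed.

HB.instance Definition _ :=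
  GRing.isZmodule.Build C C_addA Cplus_comm Cplus_0_l C_addNr.

Lemma C_1_neq0 : RtoC 1 != RtoC 0.
Proof. by apply/eqP => -[]; lra. Qed.

HB.instance Definition _ :=
  GRing.Zmodule_isComNzRing.Build C
    Cmult_assoc Cmult_comm Cmult_1_l Cmult_plus_distr_r C_1_neq0.

Lemma C_mulVf (x : C) : x != RtoC 0 -> Cmult (Cinv x) x = RtoC 1.
Proof. by move/eqP; exact: Cinv_l. Qed.

Lemma C_inv0 : Cinv (RtoC 0) = RtoC 0.
Proof. by rewrite /Cinv /=; congr pair; rewrite /Rdiv; ring_simplify; lra. Qed.

HB.instance Definition _ := GRing.ComNzRing_isField.Build C C_mulVf C_inv0.

Lemma C_addE (x y : C) : (x + y)%G = Cplus x y. Proof. by []. Qed.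
Lemma C_mulE (x y : C) : (x * y)%G = Cmult x y. Proof. by []. Qed.
Lemma C_oppE (x : C) : (- x)%G = Copp x. Proof. by []. Qed.
Lemma C_invE (x : C) : (x^-1)%G = Cinv x. Proof. by []. Qed.
Lemma C_0E : (0%G : C) = RtoC 0. Proof. by []. Qed.
Lemma C_1E : (1%G : C) = RtoC 1. Proof. by []. Qed.
Definition C_ringE := (C_addE, C_mulE, C_oppE, C_invE, C_0E, C_1E).

(** The field operations on [C] are convertible to those of Coquelicot; after this translation the
    ring tactic declared for [C] applies. *)
Ltac cring :=
  rewrite ?C_ringE; lazymatch goal with |- @eq _ ?a ?b => change (@eq C a b) end; ring.

Lemma Cpow_exp (x : C) (n : nat) : Cpow x n = (x ^+ n)%G.
Proof. by elim: n => [|n IH] //=; rewrite exprS IH. Qed.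

Lemma Re_add (x y : C) : Re (x + y)%G = Re x + Re y. Proof. by []. Qed.
Lemma Im_add (x y : C) : Im (x + y)%G = Im x + Im y. Proof. by []. Qed.
Lemma Re_mul (x y : C) : Re (x * y)%G = Re x * Re y - Im x * Im y.
Proof. by []. Qed.
Lemma Im_mul (x y : C) : Im (x * y)%G = Re x * Im y + Im x * Re y.
Proof. by []. Qed.
Lemma Re_opp (x : C) : Re (- x)%G = - Re x. Proof. by []. Qed.
Lemma Im_opp (x : C) : Im (- x)%G = - Im x. Proof. by []. Qed.

Lemma C_ext (x y : C) : Re x = Re y -> Im x = Im y -> x = y.
Proof. by case: x => a b; case: y => c d /= -> ->. Qed.

Lemma Cmod_add (x y : C) : Cmod (x + y)%G <= Cmod x + Cmod y.
Proof. exact: Cmod_triangle. Qed.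
Lemma Cmod_mul (x y : C) : Cmod (x * y)%G = Cmod x * Cmod y.
Proof. exact: Cmod_mult. Qed.
Lemma Cmod_N (x : C) : Cmod (- x)%G = Cmod x.
Proof. exact: Cmod_opp. Qed.
Lemma Cmod_zero : Cmod 0%G = 0. Proof. exact: Cmod_0. Qed.
Lemma Cmod_one : Cmod 1%G = 1. Proof. exact: Cmod_1. Qed.
Lemma Cmod_sub (x y : C) : Cmod (x - y)%G <= Cmod x + Cmod y.
Proof. by rewrite -(Cmod_N y); exact: Cmod_add. Qed.
Lemma Cmod_add_le (x y : C) (a b : R) :
  Cmod x <= a -> Cmod y <= b -> Cmod (x + y)%G <= a + b.
Proof. by move=> hx hy; apply: Rle_trans (Cmod_add _ _) _; lra. Qed.
Lemma Cmod_sub_le (x y : C) (a b : R) :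
  Cmod x <= a -> Cmod y <= b -> Cmod (x - y)%G <= a + b.
Proof. by move=> hx hy; apply: Rle_trans (Cmod_sub _ _) _; lra. Qed.
Lemma Cmod_mul_le (x y : C) (a b : R) :
  Cmod x <= a -> Cmod y <= b -> Cmod (x * y)%G <= a * b.
Proof.
move=> hx hy; rewrite Cmod_mul; apply: Rmult_le_compat => //; exact: Cmod_ge_0.
Qed.
Lemma Cmod_subC (x y : C) : Cmod (x - y)%G = Cmod (y - x)%G.
Proof. by rewrite -Cmod_N opprB. Qed.
Lemma Cmod_exp (x : C) (n : nat) : Cmod (x ^+ n)%G = Cmod x ^ n.
Proof.
elim: n => [|n IH]; first by rewrite expr0 Cmod_one.
by rewrite exprS Cmod_mul IH.
Qed.
Lemma Cmod_eq0 (x : C) : Cmod x = 0 -> x = 0%G.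
Proof. exact: Cmod_eq_0. Qed.
Lemma Cmod_gt0 (x : C) : x <> 0%G -> 0 < Cmod x.
Proof. by move=> hx; apply/Cmod_gt_0. Qed.
Lemma Cmod_inv_ (x : C) : Cmod (x^-1)%G = / Cmod x.
Proof.
have [->|/eqP hx] := eqVneq x 0%G; first by rewrite invr0 Cmod_zero Rinv_0.
exact: Cmod_inv.
Qed.
Lemma Cmod_RtoC (r : R) : Cmod (RtoC r) = Rabs r. Proof. exact: Cmod_R. Qed.

Lemma Rabs_Re_le (x : C) : Rabs (Re x) <= Cmod x.
Proof. exact: Rle_trans (Rmax_l _ _) (Rmax_Cmod x). Qed.
Lemma Rabs_Im_le (x : C) : Rabs (Im x) <= Cmod x.
Proof. exact: Rle_trans (Rmax_r _ _) (Rmax_Cmod x). Qed.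
Lemma Cmod_le_ReIm (x : C) : Cmod x <= Rabs (Re x) + Rabs (Im x).
Proof.
have e : x = (RtoC (Re x) + RtoC (Im x) * Ci)%G.
  by apply: C_ext; rewrite ?Re_add ?Im_add ?Re_mul ?Im_mul /Re /Im /=; ring.
rewrite {1}e; apply: Rle_trans (Cmod_add _ _) _; rewrite Cmod_mul !Cmod_RtoC.
have -> : Cmod Ci = 1 by rewrite /Cmod /= -[RHS]sqrt_1; congr sqrt; ring.
by rewrite /=; lra.
Qed.
Lemma Cmod_sqr (x : C) : Cmod x ^ 2 = Re x ^ 2 + Im x ^ 2.
Proof. by rewrite /Cmod /Re /Im pow2_sqrt //; nra. Qed.

Lemma Cmod_sum (n : nat) (F : nat -> C) (M : R) :
  (forall i, (i < n)%N -> Cmod (F i) <= M) ->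
  Cmod (\sum_(i < n) F i)%G <= INR n * M.
Proof.
elim: n => [|n IH] hF; first by rewrite big_ord0 Cmod_zero /=; lra.
rewrite big_ord_recr S_INR Rmult_plus_distr_r Rmult_1_l.
apply: Rle_trans (Cmod_add _ _) _; apply: Rplus_le_compat; last exact: hF.
by apply: IH => i hi; apply: hF; apply: ltnW.
Qed.

Lemma sum_n_big (n : nat) (F : nat -> C) :
  @sum_n C_AbelianMonoid F n = (\sum_(i < n.+1) F i)%G.
Proof.
elim: n => [|n IH]; first by rewrite sum_O big_ord_recl big_ord0 addr0.
by rewrite sum_Sn big_ord_recr -IH.
Qed.

Lemma Re_sum (n : nat) (F : nat -> C) :
  Re (\sum_(i < n.+1) F i)%G = sum_n (fun i => Re (F i)) n.
Proof.
elim: n => [|n IH]; first by rewrite sum_O big_ord_recl big_ord0 addr0.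
by rewrite sum_Sn big_ord_recr Re_add IH.
Qed.
Lemma Im_sum (n : nat) (F : nat -> C) :
  Im (\sum_(i < n.+1) F i)%G = sum_n (fun i => Im (F i)) n.
Proof.
elim: n => [|n IH]; first by rewrite sum_O big_ord_recl big_ord0 addr0.
by rewrite sum_Sn big_ord_recr Im_add IH.
Qed.

(** * The unit circle *)

Definition cis (t : R) : C := (cos t, sin t).

Lemma cisD (s t : R) : cis (s + t) = (cis s * cis t)%G.
Proof.
by apply: C_ext; rewrite ?Re_mul ?Im_mul /= ?cos_plus ?sin_plus; ring.
Qed.
Lemma cis0 : cis 0 = 1%G. Proof. by rewrite /cis cos_0 sin_0. Qed.
Lemma cis_exp (t : R) (n : nat) : (cis t ^+ n)%G = cis (INR n * t).
Proof.
elim: n => [|n IH]; first by rewrite expr0 Rmult_0_l cis0.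
by rewrite exprS IH -cisD S_INR; congr cis; ring.
Qed.
Lemma Cmod_cis (t : R) : Cmod (cis t) = 1.
Proof.
rewrite /Cmod /= -[RHS]sqrt_1; congr sqrt.
by have := sin2_cos2 t; rewrite /Rsqr; lra.
Qed.
Lemma cis_neq0 (t : R) : cis t <> 0%G.
Proof. by move=> h; have := Cmod_cis t; rewrite h Cmod_zero; lra. Qed.
Lemma cisN (t : R) : cis (- t) = (cis t)^-1%G.
Proof.
apply: (mulfI (x := cis t)); first exact/eqP/cis_neq0.
rewrite -cisD Rplus_opp_r cis0 mulfV //; exact/eqP/cis_neq0.
Qed.
Lemma cis_2PI (n : nat) : cis (INR n * (2 * PI)) = 1%G.
Proof.
have e : cis (2 * PI) = 1%G by rewrite /cis cos_2PI sin_2PI.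
by rewrite -cis_exp e expr1n.
Qed.

Lemma cis_eq1 (t : R) : 0 < t < 2 * PI -> cis t <> 1%G.
Proof.
move=> ht [hc hs].
have h : cos t = 1 - 2 * sin (t / 2) * sin (t / 2).
  by rewrite -cos_2a_sin; congr cos; field.
have := @sin_gt_0 (t / 2); nra.
Qed.

(** * Discrete Fourier transform and Vandermonde systems *)

Lemma C_natr (n : nat) : (n%:R : C)%G = RtoC (INR n).
Proof.
elim: n => [|n IH] //; rewrite -natr1 IH S_INR C_addE C_1E.
by rewrite RtoC_plus.
Qed.

Lemma C_natr_neq0 (n : nat) : (0 < n)%N -> (n%:R : C)%G != 0%G.
Proof.
move=> hn; rewrite C_natr; apply/eqP => -[h].
have := lt_0_INR n (elimT ltP hn); lra.
Qed.

Lemma Cmod_natr (n : nat) : Cmod (n%:R)%G = INR n.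
Proof. by rewrite C_natr Cmod_RtoC Rabs_pos_eq //; exact: pos_INR. Qed.

Lemma RtoC_exp (x : R) (n : nat) : RtoC (x ^ n) = (RtoC x ^+ n)%G.
Proof. by elim: n => [|n IH] //; rewrite exprS -IH /= RtoC_mult. Qed.

Section DiscreteFourier.
Local Open Scope ring_scope.

(** For j different from l the ratio mu_l / mu_j is a D-th root of unity other than 1, so its
    geometric sum, multiplied by the ratio minus 1, gives 0. *)
Lemma sum_ratio_pow (D : nat) (c : C) (mu : nat -> C) (j l : nat) :
    c != 0 -> (forall i, (i < D)%N -> mu i ^+ D = c) ->
    (forall i i', (i < D)%N -> (i' < D)%N -> mu i = mu i' -> i = i') ->
    (j < D)%N -> (l < D)%N ->
  \sum_(i < D) (mu j ^- i * mu l ^+ i) = D%:R *+ (j == l).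
Proof.
move=> c0 hc inj hj hl.
have mu0 i : (i < D)%N -> mu i != 0.
  move=> hi; apply: contra_neq c0 => h; rewrite -(hc i hi) h expr0n.
  by case: D hi {hc inj hj hl}.
have -> : \sum_(i < D) (mu j ^- i * mu l ^+ i) = \sum_(i < D) (mu l / mu j) ^+ i.
  by apply: eq_bigr => i _; rewrite expr_div_n mulrC.
have [<-|jl] := eqVneq j l.
  rewrite divff ?mu0 // (eq_bigr (fun _ => 1)) ?big_const_ord ?iter_addr_0 //.
  by move=> i _; rewrite expr1n.
have r1 : mu l / mu j - 1 != 0.
  rewrite subr_eq0; apply: contra_neq jl => h; apply: inj => //.
  by rewrite -[LHS]mul1r -h divfK ?mu0.
apply: (mulfI r1); rewrite -subrX1 expr_div_n !hc // divff // subrr.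
by rewrite mulr0.
Qed.

(** Orthogonality makes one Fourier matrix a left inverse of the other; for square matrices it is
    then also a right inverse, which is the expansion. *)
Lemma modal_expansion (D : nat) (c : C) (mu : nat -> C) (Y : nat -> C) (i : nat) :
    c != 0 -> (forall l, (l < D)%N -> mu l ^+ D = c) ->
    (forall l l', (l < D)%N -> (l' < D)%N -> mu l = mu l' -> l = l') ->
    (i < D)%N ->
  Y i = \sum_(l < D) (mu l ^+ i *
          (D%:R^-1 * \sum_(i' < D) (mu l ^- i' * Y i'))).
Proof.
move=> c0 hc inj hi.
have D0 : (D%:R : C) != 0 by apply: C_natr_neq0; apply: leq_ltn_trans hi.
pose A : 'M[C]_D := \matrix_(j, i) (D%:R^-1 * mu j ^- i).
pose B : 'M[C]_D := \matrix_(i, l) (mu l ^+ i).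
have AB : A *m B = 1%:M.
  apply/matrixP => j l; rewrite !mxE.
  under eq_bigr do rewrite !mxE -mulrA.
  rewrite -mulr_sumr (sum_ratio_pow c0 hc inj) ?ltn_ord // -(val_eqE j l).
  by case: eqP => _; rewrite ?mulr0 // mulr1n mulVf.
have {AB} := mulmx1C AB.
move/(congr1 (fun M => (M *m (\col_i Y i)) (Ordinal hi) 0)).
rewrite mul1mx [RHS]mxE -mulmxA => <-.
rewrite mxE; apply: eq_bigr => l _; rewrite !mxE; congr (_ * _).
by rewrite mulr_sumr; apply: eq_bigr => i' _; rewrite !mxE mulrA.
Qed.

(** The boundary conditions at 0 involve only the first m powers of the first m among 2m roots. This
    block is no Fourier matrix, but distinct nodes make its Vandermonde determinant nonzero. *)
Lemma vandermonde_left_inverse (m : nat) (t : nat -> C) :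
    (forall l l', (l < m)%N -> (l' < m)%N -> t l = t l' -> l = l') ->
  exists W : nat -> nat -> C, forall j l, (j < m)%N -> (l < m)%N ->
    \sum_(i < m) (W j i * t l ^+ i) = (j == l)%:R.
Proof.
case: m => [|m] inj; first by exists (fun _ _ => 0).
pose V : 'M[C]_m.+1 := Vandermonde m.+1 (\row_l t l).
have Vu : V \in unitmx.
  rewrite unitmxE unitfE det_Vandermonde; apply/prodf_neq0 => i _.
  apply/prodf_neq0 => j ij; rewrite !mxE subr_eq0; apply: contraTneq ij.
  by move/(inj _ _ (ltn_ord _) (ltn_ord _)) ->; rewrite ltnn.
exists (fun j i => invmx V (inord j) (inord i)) => j l hj hl.
have := congr1 (fun M : 'M[C]_m.+1 => M (inord j) (inord l)) (mulVmx Vu).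
rewrite !mxE -val_eqE /= !inordK // => <-.
by apply: eq_bigr => i _; rewrite !mxE inord_val inordK.
Qed.

End DiscreteFourier.

Lemma bounded_below (F : nat -> R) (n : nat) :
  exists2 B, 0 <= B & forall i, (i < n)%N -> F i <= B.
Proof.
elim: n => [|n [B B0 hB]]; first by exists 0 => //; lra.
exists (Rmax B (F n)); first exact: Rle_trans B0 (Rmax_l _ _).
move=> i; rewrite ltnS leq_eqVlt => /orP[/eqP->|/hB h]; first exact: Rmax_r.
exact: Rle_trans h (Rmax_l _ _).
Qed.

Lemma bounded_below2 (F : nat -> nat -> R) (n p : nat) :
  exists2 B, 0 <= B & forall i j, (i < n)%N -> (j < p)%N -> F i j <= B.
Proof.
elim: n => [|n [B B0 hB]]; first by exists 0 => //; lra.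
have [B' B'0 hB'] := bounded_below (F n) p.
exists (Rmax B B'); first exact: Rle_trans B0 (Rmax_l _ _).
move=> i j; rewrite ltnS leq_eqVlt => /orP[/eqP->|hi] hj.
  exact: Rle_trans (hB' _ hj) (Rmax_r _ _).
exact: Rle_trans (hB _ _ hi hj) (Rmax_l _ _).
Qed.

(** The m equations are solved for the first m unknowns, the others being moved to the right-hand
    side. This later bounds the decaying components at 0 by the growing ones. *)
Lemma vandermonde_bound (m : nat) (t : nat -> C) :
    (forall l l', (l < m)%N -> (l' < m)%N -> t l = t l' -> l = l') ->
    (forall l, Cmod (t l) = 1) ->
  exists2 B, 0 <= B & forall (z : nat -> C) (M : R),
    (forall i, (i < m)%N -> (\sum_(l < 2 * m) (t l ^+ i * z l))%G = RtoC 0) ->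
    (forall l, (m <= l < 2 * m)%N -> Cmod (z l) <= M) ->
    forall l, (l < m)%N -> Cmod (z l) <= B * M.
Proof.
move=> inj t1; have [W hW] := vandermonde_left_inverse inj.
have [B B0 hB] := bounded_below2 (fun j i => Cmod (W j i)) m m.
exists (INR m * (B * INR m)).
  by do 2?[apply: Rmult_le_pos => //]; exact: pos_INR.
move=> z M hz hM l hl.
pose rhs i := (\sum_(l' < m) (t (m + l')%N ^+ i * z (m + l')%N))%G.
have hrhs i : (i < m)%N -> (\sum_(l' < m) (t l' ^+ i * z l') = - rhs i)%G.
  move=> hi; apply/eqP; rewrite -addr_eq0; apply/eqP.
  apply: etrans (hz i hi).
  by rewrite mul2n -addnn big_split_ord /=; congr (_ + _)%G; apply: eq_bigr.
have -> : z l = (\sum_(i < m) (W l i * (- rhs i)))%G.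
  rewrite (eq_bigr (fun i : 'I_m =>
      \sum_(l' < m) (W l i * t l' ^+ i * z l'))%G); last first.
    move=> i _; rewrite -hrhs // mulr_sumr.
    by apply: eq_bigr => l' _; rewrite mulrA.
  rewrite exchange_big /=.
  under eq_bigr => l' _ do rewrite -mulr_suml hW // ?ltn_ord //.
  rewrite (bigD1 (Ordinal hl)) //= eqxx mul1r big1 ?addr0 // => i.
  by rewrite -val_eqE eq_sym /= => /negbTE ->; rewrite mul0r.
rewrite Rmult_assoc.
apply: (@Cmod_sum _ (fun i => W l i * - rhs i)%G) => i hi.
rewrite Cmod_mul Cmod_N Rmult_assoc.
apply: Rmult_le_compat; try exact: Cmod_ge_0; first exact: hB.
apply: (@Cmod_sum _ (fun l' => t (m + l') ^+ i * z (m + l'))%G) => l' hl'.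
rewrite Cmod_mul Cmod_exp t1 pow1 Rmult_1_l; apply: hM.
by rewrite leq_addr mul2n -addnn ltn_add2l.
Qed.

(** The 2m roots of theta^(2m) = (-1)^m, numbered according to the sector: the rotation by -nu pi/m
    puts the argument of theta_l k at pi/2 + l pi/m + phi with 0 < phi < pi/m, so that the first m
    exponents are the decaying ones. *)
Definition theta (m nu l : nat) : C :=
  cis (INR l * (PI / INR m) + (PI / 2 - INR nu * (PI / INR m))).

Lemma Cmod_theta (m nu l : nat) : Cmod (theta m nu l) = 1.
Proof. exact: Cmod_cis. Qed.

Lemma theta_exp (m nu l : nat) : (0 < m)%N ->
  (theta m nu l ^+ (2 * m) = (- 1) ^+ m)%G.
Proof.
move=> hm; have m0 := lt_0_INR m (elimT ltP hm).
rewrite /theta cis_exp.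
have -> : INR (2 * m)%N * (INR l * (PI / INR m) + (PI / 2 - INR nu * (PI / INR m)))
        = INR l * (2 * PI) + (INR m * PI + - (INR nu * (2 * PI))).
  by rewrite -multE mult_INR /=; field; lra.
rewrite !cisD cisN !cis_2PI invr1 mulr1 mul1r -cis_exp; congr (_ ^+ _)%G.
by rewrite /cis cos_PI sin_PI; apply: C_ext; rewrite /Re /Im /=; ring.
Qed.

Lemma theta_inj (m nu l l' : nat) : (l < 2 * m)%N -> (l' < 2 * m)%N ->
  theta m nu l = theta m nu l' -> l = l'.
Proof.
wlog hll : l l' / (l <= l')%N.
  by move=> h hl hl' e; case: (leqP l l') => [|/ltnW] /h; [|move=> h'; symmetry];
     auto.
move=> hl hl' e; case: (ltngtP l l') hll => // hll _; exfalso.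
have hm : (0 < m)%N by case: m hl hl' {e}.
have m0 := lt_0_INR m (elimT ltP hm).
apply: (@cis_eq1 (INR l' * (PI / INR m) - INR l * (PI / INR m))); last first.
  rewrite /Rminus cisD cisN.
  move: e; rewrite /theta 2!(cisD (INR _ * _)) => e; rewrite -(mulIf (introN eqP (@cis_neq0 _)) e).
  by rewrite mulfV //; exact/eqP/cis_neq0.
have h1 := lt_INR _ _ (elimT ltP hll).
have h2 := lt_INR _ _ (elimT ltP hl').
rewrite -multE mult_INR /= in h2.
have h3 := pos_INR l; have h4 := PI_RGT_0.
have d0 : 0 < PI / INR m by apply: Rdiv_lt_0_compat.
have e2 : 2 * PI = 2 * INR m * (PI / INR m) by field; lra.
by rewrite e2; split; nra.
Qed.

(** * Uniform limits of polynomials of bounded norm, and their zeros *)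

Section PolynomialNorm.
Local Open Scope ring_scope.

(** The sum of |c_i| K^i in Horner form, matching the induction principle [poly_ind]. *)
Fixpoint seq_norm (K : R) (s : seq C) : R :=
  if s is c :: s' then (Cmod c + K * seq_norm K s')%R else 0%R.

Definition poly_norm (K : R) (p : {poly C}) : R := seq_norm K p.

Lemma poly_norm0 (K : R) : poly_norm K 0 = 0%R.
Proof. by rewrite /poly_norm polyseq0. Qed.

Lemma poly_norm_MXaddC (K : R) (p : {poly C}) (c : C) :
  poly_norm K (p * 'X + c%:P) = (Cmod c + K * poly_norm K p)%R.
Proof.
rewrite /poly_norm -cons_poly_def polyseq_cons.
case: ifP => // /negbT; rewrite negbK => /nilP ->.
rewrite polyseqC; have [->|] := eqVneq c 0 => /=; last by rewrite !Rmult_0_r.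
by rewrite Cmod_zero Rmult_0_r Rplus_0_r.
Qed.

Lemma poly_normC (K : R) (c : C) : poly_norm K c%:P = Cmod c.
Proof.
rewrite -[c%:P]add0r -(mul0r 'X) poly_norm_MXaddC poly_norm0.
by rewrite Rmult_0_r Rplus_0_r.
Qed.

Lemma poly_norm_MX (K : R) (p : {poly C}) :
  poly_norm K (p * 'X) = (K * poly_norm K p)%R.
Proof.
by rewrite -[p * 'X]addr0 -polyC0 poly_norm_MXaddC Cmod_zero Rplus_0_l.
Qed.

Lemma poly_normX (K : R) : poly_norm K 'X = K.
Proof. by rewrite -['X]mul1r poly_norm_MX -polyC1 poly_normC Cmod_one Rmult_1_r. Qed.

Lemma poly_norm_ge0 (K : R) (p : {poly C}) :
  (0 <= K)%R -> (0 <= poly_norm K p)%R.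
Proof.
move=> K0; elim/poly_ind: p => [|p c IH]; first by rewrite poly_norm0; lra.
rewrite poly_norm_MXaddC; have := Cmod_ge_0 c; have := Rmult_le_pos _ _ K0 IH; lra.
Qed.

Lemma poly_norm_add (K : R) (p q : {poly C}) : (0 <= K)%R ->
  (poly_norm K (p + q) <= poly_norm K p + poly_norm K q)%R.
Proof.
move=> K0; elim/poly_ind: p q => [|p c IH] q.
  by rewrite add0r poly_norm0 Rplus_0_l; exact: Rle_refl.
elim/poly_ind: q => [|q d _].
  by rewrite addr0 poly_norm0 Rplus_0_r; exact: Rle_refl.
rewrite addrACA -mulrDl -polyCD !poly_norm_MXaddC.
apply: Rle_trans (Rplus_le_compat _ _ _ _ (Cmod_add _ _)
  (Rmult_le_compat_l _ _ _ K0 (IH q))) _; lra.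
Qed.

Lemma poly_norm_scale (K : R) (c : C) (p : {poly C}) :
  poly_norm K (c *: p) = (Cmod c * poly_norm K p)%R.
Proof.
elim/poly_ind: p => [|p d IH]; first by rewrite scaler0 poly_norm0 Rmult_0_r.
have -> : c *: (p * 'X + d%:P) = (c *: p) * 'X + (c * d)%:P.
  by rewrite scalerDr scalerAl polyCM mul_polyC.
by rewrite !poly_norm_MXaddC IH Cmod_mul; ring.
Qed.

Lemma poly_norm_opp (K : R) (p : {poly C}) : poly_norm K (- p) = poly_norm K p.
Proof. by rewrite -scaleN1r poly_norm_scale Cmod_N Cmod_one Rmult_1_l. Qed.

Lemma poly_norm_mul (K : R) (p q : {poly C}) : (0 <= K)%R ->
  (poly_norm K (p * q) <= poly_norm K p * poly_norm K q)%R.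
Proof.
move=> K0; elim/poly_ind: p => [|p c IH].
  by rewrite mul0r poly_norm0 Rmult_0_l; exact: Rle_refl.
rewrite mulrDl mul_polyC -mulrA (mulrC 'X) mulrA poly_norm_MXaddC.
apply: Rle_trans (poly_norm_add _ _ K0) _.
rewrite poly_norm_MX poly_norm_scale.
have := Rmult_le_compat_l _ _ _ K0 IH; lra.
Qed.

Lemma Cmod_horner (K : R) (p : {poly C}) (x : C) : (Cmod x <= K)%R ->
  (Cmod p.[x] <= poly_norm K p)%R.
Proof.
move=> hx; elim/poly_ind: p => [|p c IH].
  by rewrite horner0 Cmod_zero poly_norm0; exact: Rle_refl.
rewrite hornerMXaddC poly_norm_MXaddC; apply: Rle_trans (Cmod_add _ _) _.
rewrite Cmod_mul Rplus_comm; apply: Rplus_le_compat_l; rewrite Rmult_comm.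
by apply: Rmult_le_compat => //; exact: Cmod_ge_0.
Qed.

(** Since q X = q (X - a) + a q and multiplication by X scales the norm exactly by K, the triangle
    inequality suffices. Thus division by X - a is controlled when |a| < K. *)
Lemma poly_norm_MXsubC (K : R) (a : C) (q : {poly C}) : (0 <= K)%R ->
  ((K - Cmod a) * poly_norm K q <= poly_norm K (q * ('X - a%:P)))%R.
Proof.
move=> K0.
have := @poly_norm_add K (q * ('X - a%:P)) (a *: q) K0.
rewrite mulrBr -mul_polyC (mulrC q a%:P) addrNK poly_norm_MX mul_polyC.
rewrite poly_norm_scale; lra.
Qed.

(* Each factor x - a multiplies values on the disc of radius r by at most 2 r,
   while it multiplies the norm of radius 4 r by at least 3 r. *)
Lemma poly_small_of_zeros (r : R) (s : seq C) (k : C) :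
    (0 < r)%R -> uniq s -> {in s, forall a, (Cmod a <= r)%R} -> (Cmod k <= r)%R ->
  forall M eps : R, (0 <= M)%R -> (0 < eps)%R ->
  exists2 delta, (0 < delta)%R & forall p : {poly C},
    (poly_norm (4 * r) p <= M)%R -> {in s, forall a, (Cmod p.[a] <= delta)%R} ->
    (Cmod p.[k] <= (2 / 3) ^ size s * M + eps)%R.
Proof.
move=> r0; elim: s => [|a s IH] /=.
  move=> _ _ hk M eps M0 e0; exists 1%R; first by lra.
  move=> p hp _; have := @Cmod_horner (4 * r) p k ltac:(lra); lra.
case/andP => has us hs hk M eps M0 e0.
(* The polynomial is only small at the points, not zero; after division by x - a the remaining
   values stay small because the other points keep a distance d from a. *)
have [d d0 hd] : exists2 d, (0 < d)%R & {in s, forall b, (d <= Cmod (b - a)%G)%R}.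
  elim: s has {IH us hs} => [|b s IH] /=; first by exists 1%R; first lra.
  rewrite inE negb_or => /andP[hab /IH [d d0 hd]].
  exists (Rmin d (Cmod (b - a)%G)).
    apply: Rmin_glb_lt => //; apply: Cmod_gt0; apply/eqP.
    by rewrite subr_eq0 eq_sym.
  move=> c; rewrite inE => /orP[/eqP->|/hd h]; first exact: Rmin_r.
  by apply: Rle_trans h; exact: Rmin_l.
have ha : (Cmod a <= r)%R by apply: hs; rewrite inE eqxx.
have hs' : {in s, forall b, (Cmod b <= r)%R}.
  by move=> b hb; apply: hs; rewrite inE hb orbT.
(* Norm bound for the quotient of p - p(a) by X - a: the numerator allows |p(a)| <= eps/4, and 3 r
   is a lower bound for 4 r - |a|. *)
pose M' := ((M + eps / 4) / (3 * r))%R.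
have M'0 : (0 <= M')%R by apply: Rmult_le_pos; [lra|apply/Rlt_le/Rinv_0_lt_compat; lra].
have e'0 : (0 < eps / (8 * r))%R by apply: Rdiv_lt_0_compat; lra.
have [d' d'0 hd'] := IH us hs' hk M' (eps / (8 * r))%R M'0 e'0.
(* The second entry makes |q(b)| d <= 2 delta <= d' d at the remaining points. The final error is at
   most eps/4 for p(a), eps/4 from the induction hypothesis and less than eps/4 from [M']. *)
pose delta := Rmin (eps / 4) (d' * d / 2).
have delta0 : (0 < delta)%R by apply: Rmin_glb_lt; nra.
have le1 : (delta <= eps / 4)%R by exact: Rmin_l.
have le2 : (delta <= d' * d / 2)%R by exact: Rmin_r.
exists delta => // p hp hsp.
have hpa : (Cmod p.[a] <= delta)%R by apply: hsp; rewrite inE eqxx.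
have [q hq] : exists q, p - p.[a]%:P = q * ('X - a%:P).
  by apply/factor_theorem; rewrite /root hornerD hornerN hornerC subrr.
have hpx x : p.[x] = p.[a] + q.[x] * (x - a).
  have := congr1 (fun f => f.[x]) hq.
  rewrite hornerM !hornerE => <-; by rewrite addrC subrK.
have nq : (poly_norm (4 * r) q <= M')%R.
  have h1 := @poly_norm_MXsubC (4 * r) a q ltac:(lra).
  have h2 := @poly_norm_add (4 * r) p (- p.[a]%:P) ltac:(lra).
  rewrite -hq in h1; rewrite poly_norm_opp poly_normC in h2.
  have h3 := @poly_norm_ge0 (4 * r) q ltac:(lra).
  apply: (Rmult_le_reg_l (3 * r)); first lra.
  rewrite /M'; have -> : (3 * r * ((M + eps / 4) / (3 * r)) = M + eps / 4)%R by field; lra.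
  nra.
have hqs : {in s, forall b, (Cmod q.[b] <= d')%R}.
  move=> b hb; have h := hd b hb.
  have hpb : (Cmod p.[b] <= delta)%R by apply: hsp; rewrite inE hb orbT.
  have : (Cmod (q.[b] * (b - a))%G <= 2 * delta)%R.
    have -> : q.[b] * (b - a) = p.[b] - p.[a] by rewrite (hpx b) [RHS]addrC addKr.
    by apply: Rle_trans (Cmod_sub_le hpb hpa) _; lra.
  rewrite Cmod_mul => h'.
  have := Cmod_ge_0 q.[b]; move=> h0.
  apply: (Rmult_le_reg_r d) => //.
  by apply: Rle_trans (Rmult_le_compat_l _ _ _ h0 h) _; apply: Rle_trans h' _; lra.
have hqk := hd' q nq hqs.
rewrite (hpx k); apply: Rle_trans (Cmod_add _ _) _; rewrite Cmod_mul.
have hka : (Cmod (k - a)%G <= 2 * r)%R by apply: Rle_trans (Cmod_sub_le hk ha) _; lra.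
have c0 := pow_le (2 / 3) (size s) ltac:(lra).
have c1 : ((2 / 3) ^ size s <= 1)%R.
  by rewrite -(pow1 (size s)); apply: pow_incr; lra.
have h0 := Cmod_ge_0 q.[k].
have h1 : (Cmod q.[k] * Cmod (k - a)%G <=
   ((2 / 3) ^ size s * M' + eps / (8 * r)) * (2 * r))%R.
  apply: Rmult_le_compat => //; exact: Cmod_ge_0.
have e1 : (((2 / 3) ^ size s * M' + eps / (8 * r)) * (2 * r) =
   2 / 3 * (2 / 3) ^ size s * M + 2 / 3 * (2 / 3) ^ size s * (eps / 4) + eps / 4)%R.
  rewrite /M'; field; lra.
rewrite e1 in h1; apply: Rle_trans (Rplus_le_compat _ _ _ _ hpa h1) _; nra.
Qed.

End PolynomialNorm.

(** Stands in for boundedness and analyticity on [Om]. Nothing is asked of [Om], and the constant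
    [M] is additive and multiplicative under the algebraic operations, so that series and recursions
    can be majorized. *)
Definition approximable (Om : C -> Prop) (K M : R) (f : C -> C) : Prop :=
  forall eps, 0 < eps -> exists p : {poly C}, poly_norm K p <= M /\
    forall x, Om x -> Cmod (f x - p.[x])%G <= eps.

Section Approximable.
Variables (Om : C -> Prop) (K : R).
Hypotheses (K0 : 0 <= K) (OmK : forall x, Om x -> Cmod x <= K).
Local Notation approx := (approximable Om K).

Lemma approx_ge0 (M : R) (f : C -> C) : approx M f -> 0 <= M.
Proof.
case/(_ 1 ltac:(lra)) => p [hp _]; apply: Rle_trans hp; exact: poly_norm_ge0.
Qed.

Lemma approx_bound (M : R) (f : C -> C) (x : C) : approx M f -> Om x ->
  Cmod (f x) <= M.
Proof.
move=> hf hx; apply: le_epsilon => eps e0; have [p [hp hfp]] := hf eps e0.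
have -> : f x = (p.[x] + (f x - p.[x]))%G by rewrite addrC subrK.
apply: Rle_trans (Cmod_add _ _) _.
have := hfp x hx; have := Cmod_horner p (OmK hx); lra.
Qed.

Lemma approx_limit (M : R) (f : C -> C) :
  (forall eps, 0 < eps -> exists2 g, approx M g &
     forall x, Om x -> Cmod (f x - g x)%G <= eps) -> approx M f.
Proof.
move=> h eps e0; have [g hg hfg] := h (eps / 2) ltac:(lra).
have [p [hp hgp]] := hg (eps / 2) ltac:(lra).
exists p; split=> // x hx.
have -> : (f x - p.[x] = (f x - g x) + (g x - p.[x]))%G by rewrite addrA subrK.
by apply: Rle_trans (Cmod_add_le (hfg x hx) (hgp x hx)) _; lra.
Qed.

Lemma approx_ext (M : R) (f g : C -> C) : (forall x, Om x -> f x = g x) ->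
  approx M f -> approx M g.
Proof.
move=> e hf; apply: approx_limit => eps e0; exists f => // x hx.
by rewrite e // subrr Cmod_zero; lra.
Qed.

Lemma approx_le (M M' : R) (f : C -> C) : M <= M' -> approx M f -> approx M' f.
Proof.
move=> le hf eps e0; have [p [hp h]] := hf eps e0.
by exists p; split=> //; exact: Rle_trans hp le.
Qed.

Lemma approx_poly (p : {poly C}) : approx (poly_norm K p) (fun x => p.[x]%G).
Proof.
move=> eps e0; exists p; split; first exact: Rle_refl.
by move=> x _; rewrite subrr Cmod_zero; lra.
Qed.

Lemma approx_const (c : C) : approx (Cmod c) (fun _ => c).
Proof.
have := approx_poly c%:P; rewrite poly_normC; apply: approx_ext => x _.
by rewrite hornerC.
Qed.

Lemma approx_id : approx K (fun x => x).
Proof.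
have := approx_poly 'X; rewrite poly_normX; apply: approx_ext => x _.
by rewrite hornerX.
Qed.

Lemma approx_add (M N : R) (f g : C -> C) : approx M f -> approx N g ->
  approx (M + N) (fun x => f x + g x)%G.
Proof.
move=> hf hg eps e0; have [p [hp hfp]] := hf (eps / 2) ltac:(lra).
have [q [hq hgq]] := hg (eps / 2) ltac:(lra).
exists (p + q)%G; split; first by apply: Rle_trans (poly_norm_add _ _ K0) _; lra.
move=> x hx; rewrite hornerD opprD addrACA.
by apply: Rle_trans (Cmod_add_le (hfp x hx) (hgq x hx)) _; lra.
Qed.

Lemma approx_mul (M N : R) (f g : C -> C) : approx M f -> approx N g ->
  approx (M * N) (fun x => f x * g x)%G.
Proof.
move=> hf hg; have M0 := approx_ge0 hf; have N0 := approx_ge0 hg.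
move=> eps e0; pose d := eps / (M + N + 1).
have d0 : 0 < d by apply: Rdiv_lt_0_compat; lra.
have [p [hp hfp]] := hf d d0; have [q [hq hgq]] := hg d d0.
exists (p * q)%G; split.
  apply: Rle_trans (poly_norm_mul _ _ K0) _.
  by apply: Rmult_le_compat => //; exact: poly_norm_ge0.
move=> x hx.
have -> : (f x * g x - (p * q).[x] = (f x - p.[x]) * g x + p.[x] * (g x - q.[x]))%G.
  by rewrite hornerM mulrBl mulrBr addrA subrK.
have h1 := approx_bound hg hx; have h2 := Rle_trans _ _ _ (Cmod_horner p (OmK hx)) hp.
have h5 := Cmod_mul_le (hfp x hx) h1; have h6 := Cmod_mul_le h2 (hgq x hx).
apply: Rle_trans (Cmod_add_le h5 h6) _.
have : d * (M + N + 1) = eps by rewrite /d; field; lra.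
by nra.
Qed.

Lemma approx_scale (c : C) (M : R) (f : C -> C) : approx M f ->
  approx (Cmod c * M) (fun x => c * f x)%G.
Proof. exact: approx_mul (approx_const c). Qed.

Lemma approx_opp (M : R) (f : C -> C) : approx M f -> approx M (fun x => - f x)%G.
Proof.
move=> /(approx_scale (- 1)%G); rewrite Cmod_N Cmod_one Rmult_1_l.
by apply: approx_ext => x _; rewrite mulN1r.
Qed.

Lemma approx_exp (M : R) (f : C -> C) (n : nat) : approx M f ->
  approx (M ^ n) (fun x => f x ^+ n)%G.
Proof.
move=> hf; elim: n => [|n IH].
  rewrite /= -Cmod_one; apply: approx_ext (approx_const 1%G) => x _.
  by rewrite expr0.
by apply: approx_ext (approx_mul hf IH) => x _; rewrite exprS.
Qed.

Lemma approx_sum (n : nat) (M : nat -> R) (f : nat -> C -> C) :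
  (forall i, (i < n)%N -> approx (M i) (f i)) ->
  approx (\sum_(i < n) M i)%G (fun x => \sum_(i < n) f i x)%G.
Proof.
elim: n => [|n IH] h.
  rewrite big_ord0 -[0%G]Cmod_zero; apply: approx_ext (approx_const 0%G) => x _.
  by rewrite big_ord0.
rewrite big_ord_recr.
have h1 := IH (fun i hi => h i (ltnW hi)).
apply: approx_ext (approx_add h1 (h n (ltnSn n))) => x _.
by rewrite big_ord_recr.
Qed.

Lemma approx_prod (n : nat) (f : nat -> C -> C) :
  (forall i, (i < n)%N -> exists M, approx M (f i)) ->
  exists M, approx M (fun x => \prod_(i < n) f i x)%G.
Proof.
elim: n => [|n IH] h.
  exists (Cmod 1%G); apply: approx_ext (approx_const 1%G) => x _.
  by rewrite big_ord0.
have [M1 h1] := IH (fun i hi => h i (ltnW hi)).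
have [M2 h2] := h n (ltnSn n).
exists (M1 * M2); apply: approx_ext (approx_mul h1 h2) => x _.
by rewrite big_ord_recr.
Qed.

(** Here f = 1 / (1 - g) is the limit of the sums of g^i, with f minus the sum over i < d equal to f
    g^d and |f| <= 2. *)
Lemma approx_geometric (f g : C -> C) : approx (1 / 2) g ->
  (forall x, Om x -> (f x * (1 - g x) = 1)%G) -> approx 2 f.
Proof.
move=> hg hfg.
(* The partial sums of the norm bounds stay below 2 for all d, so the limit keeps the bound 2. *)
have hs d : approx (2 - 2 * (1 / 2) ^ d) (fun x => \sum_(i < d) g x ^+ i)%G.
  elim: d => [|d IH].
    rewrite /= Rmult_1_r Rminus_diag.
    have := approx_const 0%G; rewrite Cmod_zero.
    by apply: approx_ext => x _; rewrite big_ord0.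
  have := approx_add IH (approx_exp d hg).
  move/(@approx_ext _ _ (fun x => \sum_(i < d.+1) g x ^+ i)%G) => h.
  have -> : 2 - 2 * (1 / 2) ^ d.+1 = 2 - 2 * (1 / 2) ^ d + (1 / 2) ^ d by rewrite /=; field.
  by apply: h => x _; rewrite big_ord_recr.
apply: approx_limit => eps e0.
have [d hd] : exists d, 2 * (1 / 2) ^ d < eps.
  have [d h] := pow_lt_1_zero (1 / 2) ltac:(rewrite Rabs_pos_eq; lra) (eps / 2) ltac:(lra).
  exists d; have := h d (le_n d).
  by rewrite Rabs_pos_eq; [lra|apply: pow_le; lra].
exists (fun x => \sum_(i < d) g x ^+ i)%G.
  by apply: approx_le (hs d); have := pow_le (1 / 2) d ltac:(lra); lra.
move=> x hx.
have -> : (f x - \sum_(i < d) g x ^+ i = f x * g x ^+ d)%G.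
  have e1 := subrX1 (g x) d; have e2 := hfg x hx.
  have : (f x * (1 - g x) * \sum_(i < d) g x ^+ i = f x * (1 - g x ^+ d))%G.
    rewrite -mulrA -[(1 - g x ^+ d)%G]opprB e1 -mulNr.
    by rewrite opprB.
  by rewrite e2 mul1r => ->; rewrite mulrBr mulr1 opprB addrC subrK.
have g2 := approx_bound hg hx.
have f2 : Cmod (f x) <= 2.
  have h : Cmod (f x) * Cmod (1 - g x)%G = 1 by rewrite -Cmod_mul hfg // Cmod_one.
  have h1 : 1 / 2 <= Cmod (1 - g x)%G.
    have := Cmod_add (1 - g x)%G (g x); rewrite subrK Cmod_one; lra.
  have := Cmod_ge_0 (f x); nra.
rewrite Cmod_mul Cmod_exp; apply: Rle_trans (Rlt_le _ _ hd).
apply: Rmult_le_compat => //; try exact: Cmod_ge_0.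
  apply: pow_le; exact: Cmod_ge_0.
by apply: pow_incr; split=> //; exact: Cmod_ge_0.
Qed.

End Approximable.

(** With N zeros, a polynomial close to f is small at all of them and hence at most (2/3)^N M up to
    an error at k0. For N large this contradicts its closeness to f(k0), each of the three
    contributions being at most |f(k0)| / 4. *)
Lemma approximable_finite_zeros (Om : C -> Prop) (r M : R) (f : C -> C) (k0 : C) :
    0 < r -> (forall x, Om x -> Cmod x <= r) -> approximable Om (4 * r) M f ->
    Om k0 -> f k0 <> RtoC 0 ->
  finite_set [set k : C | Om k /\ f k = RtoC 0]%classic.
Proof.
move=> r0 hOm hf hk0 fk0; apply: contrapT => inf.
have M0 : 0 <= M by apply: approx_ge0 hf; lra.
have c0 : 0 < Cmod (f k0) by apply: Cmod_gt0.
have [N hN] : exists N, forall n, (N <= n)%N -> (2 / 3) ^ n * M < Cmod (f k0) / 4.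
  pose e := Cmod (f k0) / 4 / (M + 1).
  have e0 : 0 < e by apply: Rdiv_lt_0_compat; lra.
  have [N h] := pow_lt_1_zero (2 / 3) ltac:(rewrite Rabs_pos_eq; lra) e e0.
  exists N => n /leP /h; rewrite Rabs_pos_eq; last by apply: pow_le; lra.
  move=> h'; have := pow_le (2 / 3) n ltac:(lra) => h''.
  have : e * (M + 1) = Cmod (f k0) / 4 by rewrite /e; field; lra.
  nra.
have [B hB sB] := infinite_set_fset N inf.
have hz a : a \in finmap.enum_fset B -> Om a /\ f a = RtoC 0 by move/hB.
have hs : {in finmap.enum_fset B, forall a, Cmod a <= r}.
  by move=> a /hz[] /hOm.
have uB : uniq (finmap.enum_fset B) by exact: finmap.fset_uniq.
have [d d0 hd] := poly_small_of_zeros r0 uB hs (hOm _ hk0) M0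
  (ltac:(lra) : 0 < Cmod (f k0) / 4).
have [p [hp hfp]] := hf (Rmin d (Cmod (f k0) / 4)) ltac:(apply: Rmin_glb_lt; lra).
have h1 : Cmod p.[k0]%G <= (2 / 3) ^ size (finmap.enum_fset B) * M + Cmod (f k0) / 4.
  apply: hd => // a /hz [ha fa].
  have := hfp a ha; rewrite fa -C_0E sub0r Cmod_N => h.
  exact: Rle_trans h (Rmin_l _ _).
have h2 := hN _ sB.
have h3 := Rle_trans _ _ _ (hfp k0 hk0) (Rmin_r _ _).
have := Cmod_add (f k0 - p.[k0])%G p.[k0]%G; rewrite subrK; lra.
Qed.

(** * Complex-valued functions of a real variable *)

Definition derivableC (f : R -> C) (x : R) (l : C) : Prop :=
  is_derive (fun t => Re (f t)) x (Re l) /\ is_derive (fun t => Im (f t)) x (Im l).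

Definition continuousC (f : R -> C) (x : R) : Prop :=
  continuity_pt (fun t => Re (f t)) x /\ continuity_pt (fun t => Im (f t)) x.

Lemma is_derive_continuity_pt (f : R -> R) (x l : R) :
  is_derive f x l -> continuity_pt f x.
Proof.
move=> h; apply: derivable_continuous_pt; exists l.
by apply/is_derive_Reals.
Qed.

Lemma derivableC_continuous (f : R -> C) (x : R) (l : C) :
  derivableC f x l -> continuousC f x.
Proof. by case=> h1 h2; split; apply: is_derive_continuity_pt; eassumption. Qed.

Lemma derivableC_const (c : C) (x : R) : derivableC (fun _ => c) x 0%G.
Proof. by split; exact: is_derive_const. Qed.

Lemma derivableC_add (f g : R -> C) (x : R) (df dg : C) :
  derivableC f x df -> derivableC g x dg ->
  derivableC (fun t => f t + g t)%G x (df + dg)%G.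
Proof.
by move=> [f1 f2] [g1 g2]; split; rewrite /Re /Im /=;
   [exact: is_derive_plus f1 g1 | exact: is_derive_plus f2 g2].
Qed.

Lemma is_derive_multR (f g : R -> R) (x df dg : R) :
  is_derive f x df -> is_derive g x dg ->
  is_derive (fun t => f t * g t) x (df * g x + f x * dg).
Proof. by move=> hf hg; apply: is_derive_mult => // a b; exact: Rmult_comm. Qed.

Lemma derivableC_mul (f g : R -> C) (x : R) (df dg : C) :
  derivableC f x df -> derivableC g x dg ->
  derivableC (fun t => f t * g t)%G x (df * g x + f x * dg)%G.
Proof.
move=> [f1 f2] [g1 g2]; split.
- have := is_derive_minus _ _ _ _ _ (is_derive_multR f1 g1) (is_derive_multR f2 g2).
  congr is_derive.
  by rewrite Re_add !Re_mul /minus /plus /opp /=; ring.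
- have := is_derive_plus _ _ _ _ _ (is_derive_multR f1 g2) (is_derive_multR f2 g1).
  congr is_derive.
  by rewrite Im_add !Im_mul /plus /=; ring.
Qed.

Lemma derivableC_scale (c : C) (g : R -> C) (x : R) (dg : C) :
  derivableC g x dg -> derivableC (fun t => c * g t)%G x (c * dg)%G.
Proof.
by move/(derivableC_mul (derivableC_const c x)); rewrite mul0r add0r.
Qed.

Lemma derivableC_sum (n : nat) (F dF : nat -> R -> C) (x : R) :
  (forall i, (i < n)%N -> derivableC (F i) x (dF i x)) ->
  derivableC (fun t => \sum_(i < n) F i t)%G x (\sum_(i < n) dF i x)%G.
Proof.
elim: n => [|n IH] h.
  rewrite big_ord0; have := derivableC_const 0%G x; congr derivableC.
  by apply: funext => t; rewrite big_ord0.
rewrite big_ord_recr.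
have := derivableC_add (IH (fun i hi => h i (ltnW hi))) (h n (ltnSn n)).
by congr derivableC; apply: funext => t; rewrite big_ord_recr.
Qed.

Lemma continuousC_const (c : C) (x : R) : continuousC (fun _ => c) x.
Proof. exact: derivableC_continuous (derivableC_const c x). Qed.

Lemma continuousC_add (f g : R -> C) (x : R) :
  continuousC f x -> continuousC g x -> continuousC (fun t => f t + g t)%G x.
Proof.
by move=> [f1 f2] [g1 g2]; split;
   [exact: continuity_pt_plus f1 g1 | exact: continuity_pt_plus f2 g2].
Qed.

Lemma continuousC_mul (f g : R -> C) (x : R) :
  continuousC f x -> continuousC g x -> continuousC (fun t => f t * g t)%G x.
Proof.
move=> [f1 f2] [g1 g2]; split.
- exact: continuity_pt_minus (continuity_pt_mult _ _ _ f1 g1)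
                             (continuity_pt_mult _ _ _ f2 g2).
- exact: continuity_pt_plus (continuity_pt_mult _ _ _ f1 g2)
                            (continuity_pt_mult _ _ _ f2 g1).
Qed.

Lemma continuousC_sum (n : nat) (F : nat -> R -> C) (x : R) :
  (forall i, (i < n)%N -> continuousC (F i) x) ->
  continuousC (fun t => \sum_(i < n) F i t)%G x.
Proof.
elim: n => [|n IH] h.
  have := continuousC_const 0%G x; congr continuousC.
  by apply: funext => t; rewrite big_ord0.
have := continuousC_add (IH (fun i hi => h i (ltnW hi))) (h n (ltnSn n)).
by congr continuousC; apply: funext => t; rewrite big_ord_recr.
Qed.

Lemma derivableC_ext_right (f g : R -> C) (x : R) (l : C) : 0 < x ->
  (forall t, 0 <= t -> f t = g t) -> derivableC f x l -> derivableC g x l.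
Proof.
move=> x0 e [h1 h2].
have nb : locally x (fun t => f t = g t).
  exists (mkposreal _ x0) => t ht; apply: e.
  have : Rabs (t - x) < x by exact: ht.
  by move/Rabs_def2; lra.
by split; [apply: is_derive_ext_loc h1 | apply: is_derive_ext_loc h2];
   apply: filter_imp nb => t ->.
Qed.

Definition Cexp (z : C) : C := (RtoC (exp (Re z)) * cis (Im z))%G.

Lemma Cmod_Cexp (z : C) : Cmod (Cexp z) = exp (Re z).
Proof.
by rewrite /Cexp Cmod_mul Cmod_cis Cmod_RtoC Rmult_1_r Rabs_pos_eq //;
   apply/Rlt_le/exp_pos.
Qed.

Lemma Cexp_neq0 (z : C) : Cexp z <> 0%G.
Proof.
move=> h; have := Cmod_Cexp z; rewrite h Cmod_zero; have := exp_pos (Re z); lra.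
Qed.

Lemma derivableC_Cexp (mu : C) (x : R) :
  derivableC (fun t => Cexp (mu * RtoC t)%G) x (mu * Cexp (mu * RtoC x))%G.
Proof.
have e1 : (fun t => Re (Cexp (mu * RtoC t)%G)) = (fun t => exp (Re mu * t) * cos (Im mu * t)).
  apply: funext => t; rewrite /Cexp !(Re_mul, Im_mul) /Re /Im /= !Rmult_0_r.
  by rewrite !Rmult_0_l !Rminus_0_r Rplus_0_l; congr (exp _ * cos _); ring.
have e2 : (fun t => Im (Cexp (mu * RtoC t)%G)) = (fun t => exp (Re mu * t) * sin (Im mu * t)).
  apply: funext => t; rewrite /Cexp !(Re_mul, Im_mul) /Re /Im /= !Rmult_0_r.
  by rewrite !Rmult_0_l !Rminus_0_r Rplus_0_r Rplus_0_l.
rewrite /derivableC Re_mul Im_mul.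
have -> : Re (Cexp (mu * RtoC x)%G) = exp (Re mu * x) * cos (Im mu * x).
  by rewrite -[LHS]/((fun t => Re (Cexp (mu * RtoC t)%G)) x) e1.
have -> : Im (Cexp (mu * RtoC x)%G) = exp (Re mu * x) * sin (Im mu * x).
  by rewrite -[LHS]/((fun t => Im (Cexp (mu * RtoC t)%G)) x) e2.
by rewrite e1 e2; split; auto_derive => //; ring.
Qed.

Lemma mean_value (f df : R -> R) (x y : R) : 0 <= x -> x < y ->
  (forall t, 0 <= t -> continuity_pt f t) ->
  (forall t, 0 < t -> is_derive f t (df t)) ->
  exists2 c, x < c < y & f y - f x = df c * (y - x).
Proof.
move=> x0 xy hc hd.
have pr1 c : x < c < y -> derivable_pt f c.
  by move=> h; exists (df c); apply/is_derive_Reals/hd; lra.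
have pr2 c : x < c < y -> derivable_pt id c by move=> _; exact: derivable_pt_id.
have [c [P h]] := MVT f id x y pr1 pr2 xy (fun c h => hc c ltac:(lra))
  (fun c h => derivable_continuous_pt _ _ (derivable_pt_id c)).
exists c => //; move: h; rewrite /id.
have -> : derive_pt (fun x => x) c (pr2 c P) = 1.
  by rewrite -(derive_pt_id c); apply: pr_nu.
have -> : derive_pt f c (pr1 c P) = df c.
  by apply: derive_pt_eq_0; apply/is_derive_Reals/hd; lra.
lra.
Qed.

Lemma nonincreasing_of_derive (f df : R -> R) :
  (forall x, 0 <= x -> continuity_pt f x) ->
  (forall x, 0 < x -> is_derive f x (df x)) ->
  (forall x, 0 < x -> df x <= 0) ->
  forall x y, 0 <= x <= y -> f y <= f x.
Proof.
move=> hc hd hs x y [x0 xy].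
case: (Req_dec x y) => [->|ne]; first exact: Rle_refl.
have xy' : x < y by lra.
have [c hcxy e] := mean_value x0 xy' hc hd.
have := hs c ltac:(lra); nra.
Qed.

(** * Gronwall estimates *)

Lemma eventually_forall (n : nat) (P : nat -> R -> Prop) :
  (forall j, (j < n)%N -> exists X, forall x, X <= x -> P j x) ->
  exists2 X, 0 <= X & forall j x, (j < n)%N -> X <= x -> P j x.
Proof.
elim: n => [|n IH] h; first by exists 0 => //; lra.
have [X X0 hX] := IH (fun j hj => h j (ltnW hj)); have [X' hX'] := h n (ltnSn n).
exists (Rmax X X'); first exact: Rle_trans X0 (Rmax_l _ _).
move=> j x; rewrite ltnS leq_eqVlt => /orP[/eqP->|hj] hx.
  by apply: hX'; exact: Rle_trans (Rmax_r _ _) hx.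
by apply: hX => //; exact: Rle_trans (Rmax_l _ _) hx.
Qed.

Definition energy (n : nat) (Y : nat -> R -> C) (x : R) : R :=
  sum_f_R0 (fun j => Cmod (Y j x) ^ 2) n.

Lemma energy_ge0 (n : nat) (Y : nat -> R -> C) (x : R) : 0 <= energy n Y x.
Proof. by apply: cond_pos_sum => j; apply: pow2_ge_0. Qed.

Lemma energy_ge (n j : nat) (Y : nat -> R -> C) (x : R) : (j <= n)%N ->
  Cmod (Y j x) ^ 2 <= energy n Y x.
Proof.
elim: n => [|n IH].
  by rewrite leqn0 => /eqP ->; exact: Rle_refl.
have h := energy_ge0 n Y x; have h' := pow2_ge_0 (Cmod (Y n.+1 x)).
rewrite leq_eqVlt => /orP[/eqP->|/IH hj]; rewrite /energy tech5 -/(energy _ _ _); lra.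
Qed.

Lemma energy_le (n : nat) (Y : nat -> R -> C) (x M : R) :
  (forall j, (j <= n)%N -> Cmod (Y j x) ^ 2 <= M) -> energy n Y x <= INR n.+1 * M.
Proof.
elim: n => [|n IH] h; first by rewrite /energy /=; have := h 0%N (leqnn _); lra.
rewrite /energy tech5 -/(energy _ _ _) S_INR.
have := IH (fun j hj => h j (leqW hj)); have := h n.+1 (leqnn _); lra.
Qed.

Lemma sum_f_R0_is_derive (n : nat) (F dF : nat -> R -> R) (x : R) :
  (forall j, (j <= n)%N -> is_derive (F j) x (dF j x)) ->
  is_derive (fun t => sum_f_R0 (fun j => F j t) n) x (sum_f_R0 (fun j => dF j x) n).
Proof.
elim: n => [|n IH] h; first exact: h.
by apply: is_derive_plus; [apply: IH => j /leqW; apply: h | apply: h].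
Qed.

Lemma sum_f_R0_continuity (n : nat) (F : nat -> R -> R) (x : R) :
  (forall j, (j <= n)%N -> continuity_pt (F j) x) ->
  continuity_pt (fun t => sum_f_R0 (fun j => F j t) n) x.
Proof.
elim: n => [|n IH] h; first exact: h.
by apply: continuity_pt_plus; [apply: IH => j /leqW; apply: h | apply: h].
Qed.

Lemma sum_f_R0_le (n : nat) (F : nat -> R) (M : R) :
  (forall j, (j <= n)%N -> Rabs (F j) <= M) -> Rabs (sum_f_R0 F n) <= INR n.+1 * M.
Proof.
elim: n => [|n IH] h; first by rewrite /=; have := h 0%N (leqnn _); lra.
rewrite tech5 S_INR; apply: Rle_trans (Rabs_triang _ _) _.
have := IH (fun j hj => h j (leqW hj)); have := h n.+1 (leqnn _); lra.
Qed.

(** A chain of derivatives without an equation: the equation enters later only through a bound on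
    [Y n.+1]. Continuity at 0 is two-sided, which is arranged by extending functions by constants to
    the left of 0. *)
Definition half_line_system (n : nat) (Y : nat -> R -> C) : Prop :=
  (forall j x, (j <= n)%N -> 0 <= x -> continuousC (Y j) x) /\
  (forall j x, (j <= n)%N -> 0 < x -> derivableC (Y j) x (Y j.+1 x)).

Section Gronwall.
Variables (n : nat) (Y : nat -> R -> C) (B : R).
Hypotheses (sysY : half_line_system n Y)
  (hB : forall x M, 0 < x -> (forall j, (j <= n)%N -> Cmod (Y j x) <= M) ->
        Cmod (Y n.+1 x) <= B * M).

Lemma top_derivative_energy (j : nat) (x : R) : 0 < x -> (j <= n.+1)%N ->
  Cmod (Y j x) ^ 2 <= (1 + B ^ 2) * energy n Y x.
Proof.
have h0 := energy_ge0 n Y x; move=> x0.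
have B2 := pow2_ge_0 B.
rewrite leq_eqVlt => /orP[/eqP->|/(@energy_ge n j Y x) h]; last by nra.
have h : Cmod (Y n.+1 x) <= B * sqrt (energy n Y x).
  apply: hB => // i /(@energy_ge n i Y x) /sqrt_le_1_alt.
  by rewrite sqrt_pow2 //; exact: Cmod_ge_0.
have h' : Cmod (Y n.+1 x) ^ 2 <= (B * sqrt (energy n Y x)) ^ 2.
  by apply: pow_incr; split=> //; exact: Cmod_ge_0.
rewrite Rpow_mult_distr pow2_sqrt // in h'; nra.
Qed.

Let dE (x : R) : R := sum_f_R0 (fun j => 2 * (Re (Y j x) * Re (Y j.+1 x) +
  Im (Y j x) * Im (Y j.+1 x))) n.

Let energy_is_derive (x : R) : 0 < x -> is_derive (energy n Y) x (dE x).
Proof.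
move=> x0; apply: (@sum_f_R0_is_derive n (fun j t => Cmod (Y j t) ^ 2)
  (fun j t => 2 * (Re (Y j t) * Re (Y j.+1 t) + Im (Y j t) * Im (Y j.+1 t)))) => j hj.
have [h1 h2] := proj2 sysY j x hj x0.
have := is_derive_plus _ _ _ _ _ (is_derive_multR h1 h1) (is_derive_multR h2 h2).
congr is_derive; last by rewrite /plus /=; ring.
by apply: funext => t; rewrite Cmod_sqr /plus /=; ring.
Qed.

Let energy_continuity (x : R) : 0 <= x -> continuity_pt (energy n Y) x.
Proof.
move=> x0; apply: (@sum_f_R0_continuity n (fun j t => Cmod (Y j t) ^ 2)) => j hj.
have [h1 h2] := proj1 sysY j x hj x0.
have := continuity_pt_plus _ _ _ (continuity_pt_mult _ _ _ h1 h1)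
  (continuity_pt_mult _ _ _ h2 h2).
congr continuity_pt.
by apply: funext => t; rewrite Cmod_sqr /plus_fct /mult_fct /=; ring.
Qed.

(** Each of the n + 1 terms of the derivative of the energy is at most |Y_j|^2 + |Y_(j+1)|^2, and
    each of these squares is at most (1 + B^2) times the energy. *)
Definition gronwall_rate : R := INR n.+1 * (2 * (1 + B ^ 2)).

Let dE_le (x : R) : 0 < x -> Rabs (dE x) <= gronwall_rate * energy n Y x.
Proof.
move=> x0; rewrite /gronwall_rate Rmult_assoc; apply: sum_f_R0_le => j hj.
have h1 := top_derivative_energy x0 (leqW hj).
have h2 := top_derivative_energy x0 (hj : (j.+1 <= n.+1)%N).
rewrite !Cmod_sqr in h1 h2; apply: Rabs_le.
have := pow2_ge_0 (Re (Y j x) - Re (Y j.+1 x)).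
have := pow2_ge_0 (Re (Y j x) + Re (Y j.+1 x)).
have := pow2_ge_0 (Im (Y j x) - Im (Y j.+1 x)).
have := pow2_ge_0 (Im (Y j x) + Im (Y j.+1 x)).
lra.
Qed.

Let expc_is_derive (c x : R) : is_derive (fun t => exp (c * t)) x (c * exp (c * x)).
Proof. by auto_derive => //; ring. Qed.

Lemma gronwall_forward (x y : R) : 0 <= x <= y ->
  energy n Y y <= energy n Y x * exp (gronwall_rate * (y - x)).
Proof.
move=> hxy; set c := gronwall_rate.
have := @nonincreasing_of_derive (fun t => energy n Y t * exp (- c * t))
  (fun t => dE t * exp (- c * t) + energy n Y t * (- c * exp (- c * t))) _ _ _ x y hxy.
move=> h.
have {h} h : energy n Y y * exp (- c * y) <= energy n Y x * exp (- c * x).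
  apply: h => t t0.
  - apply: continuity_pt_mult; first exact: energy_continuity.
    exact: is_derive_continuity_pt (expc_is_derive _ _).
  - exact: is_derive_multR (energy_is_derive t0) (expc_is_derive _ _).
  - have := dE_le t0; have := Rle_abs (dE t); have := exp_pos (- c * t).
    rewrite -/c; nra.
have -> : c * (y - x) = - c * x - (- c * y) by ring.
apply: (Rmult_le_reg_r (exp (- c * y))); first exact: exp_pos.
apply: Rle_trans h _; rewrite Rmult_assoc -exp_plus.
have -> : - c * x - - c * y + - c * y = - c * x by ring.
exact: Rle_refl.
Qed.

Lemma gronwall_backward (x y : R) : 0 <= x <= y ->
  energy n Y x <= energy n Y y * exp (gronwall_rate * (y - x)).
Proof.
move=> hxy; set c := gronwall_rate.
have := @nonincreasing_of_derive (fun t => - (energy n Y t * exp (c * t)))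
  (fun t => - (dE t * exp (c * t) + energy n Y t * (c * exp (c * t)))) _ _ _ x y hxy.
move=> h.
have {h} h : - (energy n Y y * exp (c * y)) <= - (energy n Y x * exp (c * x)).
  apply: h => t t0.
  - apply: continuity_pt_opp; apply: continuity_pt_mult; first exact: energy_continuity.
    exact: is_derive_continuity_pt (expc_is_derive _ _).
  - apply: is_derive_opp.
    exact: is_derive_multR (energy_is_derive t0) (expc_is_derive _ _).
  - have := dE_le t0; have := Rle_abs (- dE t); have := exp_pos (c * t).
    rewrite Rabs_Ropp -/c; nra.
apply: (Rmult_le_reg_r (exp (c * x))); first exact: exp_pos.
rewrite Rmult_assoc -exp_plus.
have -> : c * (y - x) + c * x = c * y by ring.
lra.
Qed.

(** Weaker than convergence to 0, but it follows from square integrability and passes to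
    derivatives, which convergence alone does not. *)
Definition often_small (u : R -> R) : Prop :=
  forall eps h, 0 < eps -> 0 < h -> exists X, forall x, X <= x ->
    exists2 s, x <= s <= x + h & Rabs (u s) <= eps.

(** Small values are picked in the first and in the last third of [x, x + h]; the mean value theorem
    gives a slope of at most (eps h / 3) / (h / 3) in between. *)
Lemma often_small_derive (u du : R -> R) :
  (forall x, 0 <= x -> continuity_pt u x) ->
  (forall x, 0 < x -> is_derive u x (du x)) ->
  often_small u -> often_small du.
Proof.
move=> hc hd hu eps h e0 h0.
have [X hX] := hu (eps * h / 6) (h / 3) ltac:(nra) ltac:(lra).
exists (Rmax X 0) => x hx.
have xX := Rle_trans _ _ _ (Rmax_l _ _) hx.
have x0 := Rle_trans _ _ _ (Rmax_r _ _) hx.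
have [s hs us] := hX x xX.
have [t ht ut] := hX (x + 2 * h / 3) ltac:(lra).
have [c hc' e] := @mean_value u du s t ltac:(lra) ltac:(lra) hc hd.
exists c; first by lra.
have h1 : Rabs (u t - u s) <= eps * h / 3.
  by apply: Rle_trans (Rabs_triang _ _) _; rewrite Rabs_Ropp; lra.
rewrite e Rabs_mult (Rabs_pos_eq (t - s)) in h1; last lra.
have := Rabs_pos (du c); nra.
Qed.

Lemma often_small_component (j : nat) : (j <= n)%N ->
  often_small (fun x => Cmod (Y 0%N x)) ->
  often_small (fun x => Re (Y j x)) /\ often_small (fun x => Im (Y j x)).
Proof.
elim: j => [|j IH] hj h.
  split=> eps d e0 d0; have [X hX] := h eps d e0 d0; exists X => x /hX[s hs hYs];
    exists s => //; rewrite Rabs_pos_eq in hYs; try exact: Cmod_ge_0.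
    exact: Rle_trans (Rabs_Re_le _) hYs.
  exact: Rle_trans (Rabs_Im_le _) hYs.
have hj' := ltnW hj; have [h1 h2] := IH hj' h.
split.
- apply: often_small_derive h1 => x hx; first by case: (proj1 sysY j x hj' hx).
  by case: (proj2 sysY j x hj' hx).
- apply: often_small_derive h2 => x hx; first by case: (proj1 sysY j x hj' hx).
  by case: (proj2 sysY j x hj' hx).
Qed.

(* Between x and a nearby point where the j-th component is small, that
   component moves by at most a small multiple of the square root of the energy. *)
Lemma energy_tends_to_0 : often_small (fun x => Cmod (Y 0%N x)) ->
  forall eps, 0 < eps -> exists2 X, 0 <= X & forall x, X <= x -> energy n Y x <= eps.
Proof.
move=> hY eps e0.
(* On [x, x + 1] every |Y_(j+1)|^2 is at most K times the energy at x: the equation gives 1 + B^2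
   and Gronwall's inequality over unit length the exponential. *)
pose K := (1 + B ^ 2) * exp gronwall_rate.
have K0 : 0 < K.
  by apply: Rmult_lt_0_compat; [have := pow2_ge_0 B; lra | exact: exp_pos].
have N0 : 0 < INR n.+1 by apply: lt_0_INR; apply/ltP.
pose L := INR n.+1 * K.
have L0 : 0 < L by apply: Rmult_lt_0_compat.
pose h := Rmin 1 (/ (16 * (1 + L))).
have h0 : 0 < h by apply: Rmin_glb_lt; [lra|apply: Rinv_0_lt_compat; lra].
have h1 : h <= 1 by exact: Rmin_l.
have h2 : L * h ^ 2 <= / 16.
  have e : (1 + L) * / (16 * (1 + L)) = / 16 by field; lra.
  have : h <= / (16 * (1 + L)) by exact: Rmin_r.
  nra.
pose d := Rmin 1 (eps / (16 * INR n.+1)).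
have d0 : 0 < d by apply: Rmin_glb_lt; [lra|apply: Rdiv_lt_0_compat; lra].
have d2 : d ^ 2 <= eps / (16 * INR n.+1).
  have : d <= 1 by exact: Rmin_l.
  have : d <= eps / (16 * INR n.+1) by exact: Rmin_r.
  nra.
have [|X X0 hX] := @eventually_forall n.+1 (fun j x =>
    (exists2 s, x <= s <= x + h & Rabs (Re (Y j s)) <= d) /\ (exists2 s, x <= s <= x + h & Rabs (Im (Y j s)) <= d)).
  move=> j hj; have [f1 f2] := often_small_component (hj : (j <= n)%N) hY.
  have [X1 hX1] := f1 d h d0 h0; have [X2 hX2] := f2 d h d0 h0.
  exists (Rmax X1 X2) => x hx; split.
    by apply: hX1; exact: Rle_trans (Rmax_l _ _) hx.
  by apply: hX2; exact: Rle_trans (Rmax_r _ _) hx.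
exists X => // x hx.
have E0 := energy_ge0 n Y x.
have near (u du : R -> R) : (forall t, 0 <= t -> continuity_pt u t) ->
    (forall t, 0 < t -> is_derive u t (du t)) ->
    (forall t, x < t <= x + 1 -> du t ^ 2 <= K * energy n Y x) ->
    (exists2 s, x <= s <= x + h & Rabs (u s) <= d) ->
    u x ^ 2 <= 2 * d ^ 2 + 2 * h ^ 2 * (K * energy n Y x).
  move=> uc ud ub [s hs us].
  have us2 : u s ^ 2 <= d ^ 2 by rewrite -pow2_abs; apply: pow_incr; split=> //; exact: Rabs_pos.
  have P0 : 0 <= h ^ 2 * (K * energy n Y x).
    by apply: Rmult_le_pos; [exact: pow2_ge_0 | apply: Rmult_le_pos; lra].
  case: (Req_dec x s) => [e|ne]; first by rewrite {1}e; have := pow2_ge_0 d; lra.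
  have [c hcs e] := @mean_value u du x s ltac:(lra) ltac:(lra) uc ud.
  have hdc := ub c ltac:(lra).
  have e' : u x = u s - du c * (s - x) by lra.
  have hs2 : (s - x) ^ 2 <= h ^ 2 by apply: pow_incr; lra.
  have h3 : (du c * (s - x)) ^ 2 <= h ^ 2 * (K * energy n Y x).
    rewrite Rpow_mult_distr Rmult_comm.
    by apply: Rmult_le_compat => //; exact: pow2_ge_0.
  have := pow2_ge_0 (u s + du c * (s - x)); rewrite e'; nra.
have hdu j t : (j <= n)%N -> x < t <= x + 1 -> Cmod (Y j.+1 t) ^ 2 <= K * energy n Y x.
  move=> hj ht.
  have g1 := @top_derivative_energy j.+1 t ltac:(lra) hj.
  have g2 := @gronwall_forward x t ltac:(lra).
  have g3 : exp (gronwall_rate * (t - x)) <= exp gronwall_rate.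
    have r0 : 0 <= gronwall_rate.
      by apply: Rmult_le_pos; [exact: pos_INR|have := pow2_ge_0 B; lra].
    case: (Req_dec (gronwall_rate * (t - x)) gronwall_rate) => [->|ne]; first exact: Rle_refl.
    by apply/Rlt_le/exp_increasing; nra.
  apply: Rle_trans g1 _; rewrite /K Rmult_assoc; apply: Rmult_le_compat_l.
    by have := pow2_ge_0 B; lra.
  by apply: Rle_trans g2 _; rewrite Rmult_comm; apply: Rmult_le_compat_r.
(* By the choice of h and d the right-hand side is at most eps/4 plus a quarter of the energy, which
   is absorbed on the left. *)
have : energy n Y x <= INR n.+1 * (4 * d ^ 2 + 4 * h ^ 2 * (K * energy n Y x)).
  apply: energy_le => j hj; have [f1 f2] := hX j x hj hx.
  have g1 : Re (Y j x) ^ 2 <= 2 * d ^ 2 + 2 * h ^ 2 * (K * energy n Y x).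
    apply: (near (fun t => Re (Y j t)) (fun t => Re (Y j.+1 t))) => // t ht.
    - by case: (proj1 sysY j t hj ht).
    - by case: (proj2 sysY j t hj ht).
    - apply: Rle_trans (hdu j t hj ht); rewrite Cmod_sqr.
      by have := pow2_ge_0 (Im (Y j.+1 t)); lra.
  have g2 : Im (Y j x) ^ 2 <= 2 * d ^ 2 + 2 * h ^ 2 * (K * energy n Y x).
    apply: (near (fun t => Im (Y j t)) (fun t => Im (Y j.+1 t))) => // t ht.
    - by case: (proj1 sysY j t hj ht).
    - by case: (proj2 sysY j t hj ht).
    - apply: Rle_trans (hdu j t hj ht); rewrite Cmod_sqr.
      by have := pow2_ge_0 (Re (Y j.+1 t)); lra.
  rewrite Cmod_sqr; lra.
have -> : INR n.+1 * (4 * d ^ 2 + 4 * h ^ 2 * (K * energy n Y x)) =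
  4 * (INR n.+1 * d ^ 2) + 4 * (L * h ^ 2) * energy n Y x by rewrite /L; ring.
have : INR n.+1 * d ^ 2 <= eps / 16.
  have -> : eps / 16 = INR n.+1 * (eps / (16 * INR n.+1)) by field; lra.
  by apply: Rmult_le_compat_l; lra.
nra.
Qed.

Lemma system_unique (x0 : R) : 0 <= x0 -> (forall j, (j <= n)%N -> Y j x0 = 0%G) ->
  forall j x, (j <= n)%N -> 0 <= x -> Y j x = 0%G.
Proof.
move=> hx0 h0 j x hj hx.
have E0 : energy n Y x0 = 0.
  apply: Rle_antisym; last exact: energy_ge0.
  rewrite -(Rmult_0_r (INR n.+1)); apply: energy_le => i hi.
  by rewrite h0 // Cmod_zero /= Rmult_0_l; exact: Rle_refl.
have Ex : energy n Y x <= 0.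
  case: (Rle_lt_dec x0 x) => hxx.
    by have := @gronwall_forward x0 x ltac:(lra); rewrite E0 Rmult_0_l.
  by have := @gronwall_backward x x0 ltac:(lra); rewrite E0 Rmult_0_l.
apply: Cmod_eq0; have := @energy_ge n j Y x hj; have := Cmod_ge_0 (Y j x); nra.
Qed.

End Gronwall.

(** * Square-integrable functions are often small *)

Section IntegrableOftenSmall.
Import Order.TTheory Num.Theory.
Local Open Scope ring_scope.
Local Open Scope classical_set_scope.

(** Otherwise g exceeds e on whole intervals of length h arbitrarily far out; N disjoint ones force
    an integral of at least N e h, for every N. *)
Lemma integrable_often_small (R : realType) (g : R -> R) :
    (@lebesgue_measure R).-integrable `[0, +oo[ (fun x => (g x)%:E) ->
    (forall x, 0 <= g x) ->
  forall e h : R, 0 < e -> 0 < h -> exists X, forall x, X <= x ->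
    exists2 s, x <= s <= x + h & g s <= e.
Proof.
move=> ig g0 e h e0 h0; apply: contrapT => nex.
have big X : exists2 x, X <= x & forall s, x <= s <= x + h -> e < g s.
  apply: contrapT => nx; apply: nex; exists X => x Xx.
  apply: contrapT => ns; apply: nx; exists x => // s hs.
  by rewrite ltNge; apply/negP => gs; apply: ns; exists s.
have mg (D : set R) (sD : D `<=` `[0, +oo[) :=
  measurable_funS (measurable_itv _) sD (measurable_int _ ig).
pose I (X : R) : set R := `[0, X]; pose J (x : R) : set R := `[x, x + h].
pose half : set R := `[0, +oo[.
have ge N : exists2 X : R, 0 <= X &
    ((N%:R * (e * h))%:E <= \int[lebesgue_measure]_(x in I X) (g x)%:E)%E.
  elim: N => [|N [X X0 IH]].
    by exists 0 => //; rewrite mul0r; apply: integral_ge0 => x _; rewrite lee_fin.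
  (* Starting one unit beyond X keeps the new interval disjoint from [0, X]. *)
  have [x Xx hx] := big (X + 1).
  have x0 : 0 <= x by apply: le_trans Xx; rewrite addr_ge0.
  have Xx' : X < x by apply: lt_le_trans Xx; rewrite ltrDl.
  exists (x + h); first by rewrite addr_ge0 // ltW.
  have s1 : I X `<=` half.
    by move=> t /=; rewrite /I /J /half /= !in_itv /= andbT => /andP[].
  have s2 : J x `<=` half.
    by move=> t /=; rewrite /I /J /half /= !in_itv /= andbT => /andP[xt _]; exact: le_trans xt.
  have s3 : I (x + h) `<=` half.
    by move=> t /=; rewrite /I /J /half /= !in_itv /= andbT => /andP[].
  apply: (@le_trans _ _ (\int[lebesgue_measure]_(t in (I X `|` J x)) (g t)%:E)%E).
    rewrite ge0_integral_setU //=; first last.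
    - apply/disj_setPS => t /= []; rewrite /I /J /half /= !in_itv /= => /andP[_ tX] /andP[xt _].
      by have := le_lt_trans (le_trans xt tX) Xx'; rewrite ltxx.
    - by move=> t _; rewrite lee_fin.
    - by apply: mg => t [/s1|/s2].
    - exact: measurable_itv.
    - exact: measurable_itv.
    rewrite -natr1 mulrDl mul1r EFinD; apply: leeD => //.
    apply: (@le_trans _ _ (\int[lebesgue_measure]_(t in J x) (cst e%:E t))%E).
      rewrite integral_cst; last exact: measurable_itv.
      have e1 : lebesgue_measure (J x) = h%:E.
        by rewrite lebesgue_measure_itv /= lte_fin ltrDl h0 -EFinB addrAC subrr add0r.
      rewrite EFinM -e1; exact: lexx.
    apply: ge0_le_integral => //.
    - exact: measurable_itv.
    - by move=> t _; rewrite /cst lee_fin ltW.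
    - exact: mg.
    - by move=> t /=; rewrite /J /= in_itv /= /cst lee_fin => /hx /ltW.
  apply: ge0_subset_integral => //.
  - by apply: measurableU; exact: measurable_itv.
  - exact: measurable_itv.
  - exact: mg.
  - by move=> t _; rewrite lee_fin.
  - move=> t /= []; rewrite /I /J /half /= !in_itv /= => /andP[t0 tX]; apply/andP; split => //.
    + by apply: le_trans tX _; apply: ltW; apply: lt_trans Xx' _; rewrite ltrDl.
    + exact: le_trans t0.
have fin : (\int[lebesgue_measure]_(x in half) (g x)%:E)%E \is a fin_num.
  by apply: integrable_fin_num ig; exact: measurable_itv.
set G := (\int[lebesgue_measure]_(x in half) (g x)%:E)%E in fin.
have [N hN] : exists N : nat, fine G < N%:R * (e * h).
  exists (Num.Def.truncn (fine G / (e * h))).+1.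
  by rewrite -ltr_pdivrMr ?mulr_gt0 // truncnS_gt.
have [X X0 hX] := ge N.
have : ((N%:R * (e * h))%:E <= G)%E.
  apply: le_trans hX _; apply: ge0_subset_integral => //.
  - exact: measurable_itv.
  - exact: measurable_itv.
  - exact: mg.
  - by move=> t _; rewrite lee_fin.
  - by move=> t /=; rewrite /I /J /half /= !in_itv /= andbT => /andP[].
by rewrite -(fineK fin) lee_fin leNgt hN.
Qed.

End IntegrableOftenSmall.

Lemma L2_often_small (y : R -> C) : L2_half_line y ->
  often_small (fun x => Cmod (y x)).
Proof.
case=> _ [_ hy] eps h e0 h0.
have [||||X hX] := @integrable_often_small _ (fun x => Cmod (y x) ^+ 2)%G _ _ (pow eps 2) h.
- move: hy; congr (_.-integrable _ _).
  apply/seteqP; split => x; rewrite /half_line /= in_itv /= andbT.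
    by move=> /RleP.
  by move=> /RleP.
- by move=> x; apply/RleP; rewrite -RpowE; exact: pow2_ge_0.
- by apply/RltP; apply: pow_lt.
- exact/RltP.
exists X => x /RleP /hX [s /andP[/RleP h1 /RleP h2] /RleP h3]; exists s => //.
rewrite -RpowE in h3.
rewrite Rabs_pos_eq; last exact: Cmod_ge_0.
apply: Rsqr_incr_0_var; last lra.
by rewrite !Rsqr_pow2.
Qed.

(** * A priori estimate for systems with large gaps *)

Section Comparison.
Variables (w d r : R -> C) (a rho : R).
Hypotheses (a0 : 0 <= a) (rho0 : 0 <= rho)
  (wc : forall x, 0 <= x -> continuousC w x)
  (wd : forall x, 0 < x -> derivableC w x (d x * w x + r x)%G)
  (hr : forall x, 0 < x -> Cmod (r x) <= rho * exp (- x)).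

Let h (x : R) : R := Cmod (w x) ^ 2.
Let dh (x : R) : R := 2 * Re (d x) * h x +
  2 * (Re (w x) * Re (r x) + Im (w x) * Im (r x)).

Let h_continuity (x : R) : 0 <= x -> continuity_pt h x.
Proof.
move=> x0; have [h1 h2] := wc x0.
have := continuity_pt_plus _ _ _ (continuity_pt_mult _ _ _ h1 h1)
  (continuity_pt_mult _ _ _ h2 h2).
congr continuity_pt.
by apply: funext => t; rewrite /h Cmod_sqr /plus_fct /mult_fct /=; ring.
Qed.

Let h_is_derive (x : R) : 0 < x -> is_derive h x (dh x).
Proof.
move=> x0; have [h1 h2] := wd x0.
have := is_derive_plus _ _ _ _ _ (is_derive_multR h1 h1) (is_derive_multR h2 h2).
congr is_derive; last first.
  by rewrite /plus /dh /h Cmod_sqr !(Re_add, Im_add, Re_mul, Im_mul) /=; ring.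
by apply: funext => t; rewrite /h Cmod_sqr /plus /=; ring.
Qed.

(** The arithmetic-geometric mean inequality with weight exp(-x): the bound rho exp(-x) on r allows
    one factor exp(-x) to be taken out of both squares. *)
Let cross_le (x : R) : 0 < x ->
  Rabs (2 * (Re (w x) * Re (r x) + Im (w x) * Im (r x))) <= exp (- x) * (h x + rho ^ 2).
Proof.
move=> x0; set u := exp (- x); have u0 : 0 < u by exact: exp_pos.
have r2 : Re (r x) ^ 2 + Im (r x) ^ 2 <= u ^ 2 * rho ^ 2.
  rewrite -Cmod_sqr -Rpow_mult_distr Rmult_comm; apply: pow_incr; split; first exact: Cmod_ge_0.
  exact: hr.
rewrite /h Cmod_sqr; apply: Rabs_le.
set p := Re (w x) in r2 *; set q := Im (w x) in r2 *.
set s := Re (r x) in r2 *; set t := Im (r x) in r2 *.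
have e1 := pow2_ge_0 (u * p - s); have e2 := pow2_ge_0 (u * q - t).
have e3 := pow2_ge_0 (u * p + s); have e4 := pow2_ge_0 (u * q + t).
split; apply: (Rmult_le_reg_l u) => //; nra.
Qed.

(** The rate in |h'| type inequalities of size c exp(-x) (h + rho^2): 2 a comes from Re d and 1 from
    the cross term. As exp(-x) has integral 1, the total growth factor is exp c. *)
Let c : R := 2 * a + 1.

(** The quantity (h + rho^2) exp(c exp(-x)) does not increase, and its exponential factor lies
    between 1 and exp c. *)
Lemma comparison_forward :
  (forall x, 0 < x -> Re (d x) <= a * exp (- x)) ->
  forall x, 0 <= x -> Cmod (w x) ^ 2 <= exp c * (Cmod (w 0) ^ 2 + rho ^ 2).
Proof.
move=> hd x x0.
have := @nonincreasing_of_derive (fun t => (h t + rho ^ 2) * exp (c * exp (- t)))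
  (fun t => dh t * exp (c * exp (- t)) +
     (h t + rho ^ 2) * (- c * exp (- t) * exp (c * exp (- t)))) _ _ _ 0 x
     (conj (Rle_refl 0) x0).
have expd t : is_derive (fun t => exp (c * exp (- t))) t (- c * exp (- t) * exp (c * exp (- t))).
  by auto_derive => //; ring.
move=> hmon.
have {hmon} : (h x + rho ^ 2) * exp (c * exp (- x)) <= (h 0 + rho ^ 2) * exp (c * exp (- 0)).
  apply: hmon => t t0.
  - apply: continuity_pt_mult; last exact: is_derive_continuity_pt (expd t).
    apply: continuity_pt_plus; first exact: h_continuity.
    exact: continuity_pt_const.
  - apply: is_derive_multR (expd t).
    have := is_derive_plus _ _ _ _ _ (h_is_derive t0) (is_derive_const (rho ^ 2) t).
    by congr is_derive; rewrite /plus /zero /= Rplus_0_r.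
  - have := cross_le t0; have := Rle_abs (2 * (Re (w t) * Re (r t) + Im (w t) * Im (r t))).
    have := hd t t0; have := exp_pos (- t); have := exp_pos (c * exp (- t)).
    have ht : 0 <= h t by exact: pow2_ge_0.
    have hrho := pow2_ge_0 rho.
    set u := exp (- t); set v := exp (c * u) => v0 u0 h1 h2 h3.
    have h4 : dh t <= c * u * (h t + rho ^ 2).
      rewrite /dh /c; have := Rmult_le_compat_r _ _ _ ht h1.
      have : 0 <= a * u * rho ^ 2 by apply: Rmult_le_pos => //; nra.
      lra.
    nra.
have hx : 0 <= h x by exact: pow2_ge_0.
have hrho := pow2_ge_0 rho.
have e1 : 1 <= exp (c * exp (- x)).
  rewrite -exp_0; have : 0 < c * exp (- x).
    by apply: Rmult_lt_0_compat; [rewrite /c; lra|exact: exp_pos].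
  by move/exp_increasing; lra.
by rewrite Ropp_0 exp_0 Rmult_1_r -/(h 0) -/(h x); nra.
Qed.

(** Integration from infinity: (h + rho^2) exp(-c exp(-x)) does not decrease and is at most rho^2 in
    the limit, because w tends to 0. No value at 0 enters. *)
Lemma comparison_backward :
  (forall x, 0 < x -> - (a * exp (- x)) <= Re (d x)) ->
  (forall eps, 0 < eps -> exists2 X, 0 <= X & forall x, X <= x -> Cmod (w x) ^ 2 <= eps) ->
  forall x, 0 <= x -> Cmod (w x) ^ 2 <= exp c * rho ^ 2.
Proof.
move=> hd hw x x0.
have expd t : is_derive (fun t => exp (- c * exp (- t))) t (c * exp (- t) * exp (- c * exp (- t))).
  by auto_derive => //; ring.
have mon y : x <= y -> (h x + rho ^ 2) * exp (- c * exp (- x)) <= (h y + rho ^ 2) * exp (- c * exp (- y)).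
  move=> xy.
  have := @nonincreasing_of_derive (fun t => - ((h t + rho ^ 2) * exp (- c * exp (- t))))
    (fun t => - (dh t * exp (- c * exp (- t)) +
       (h t + rho ^ 2) * (c * exp (- t) * exp (- c * exp (- t))))) _ _ _ x y (conj x0 xy).
  move=> hmon.
  have {hmon} : - ((h y + rho ^ 2) * exp (- c * exp (- y))) <= - ((h x + rho ^ 2) * exp (- c * exp (- x))).
    apply: hmon => t t0.
    - apply: continuity_pt_opp; apply: continuity_pt_mult; last exact: is_derive_continuity_pt (expd t).
      apply: continuity_pt_plus; first exact: h_continuity.
      exact: continuity_pt_const.
    - apply: is_derive_opp; apply: is_derive_multR (expd t).
      have := is_derive_plus _ _ _ _ _ (h_is_derive t0) (is_derive_const (rho ^ 2) t).
      by congr is_derive; rewrite /plus /zero /= Rplus_0_r.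
    - have := cross_le t0; have := Rle_abs (- (2 * (Re (w t) * Re (r t) + Im (w t) * Im (r t)))).
      rewrite Rabs_Ropp.
      have := hd t t0; have := exp_pos (- t); have := exp_pos (- c * exp (- t)).
      have ht : 0 <= h t by exact: pow2_ge_0.
      have hrho := pow2_ge_0 rho.
      set u := exp (- t); set v := exp (- c * u) => v0 u0 h1 h2 h3.
      have h4 : - (c * u * (h t + rho ^ 2)) <= dh t.
        rewrite /dh /c; have := Rmult_le_compat_r _ _ _ ht h1.
        have : 0 <= a * u * rho ^ 2 by apply: Rmult_le_pos => //; nra.
        lra.
      nra.
  lra.
have c0 : 0 < c by rewrite /c; lra.
have hx : 0 <= h x by exact: pow2_ge_0.
have hrho := pow2_ge_0 rho.
have lim : (h x + rho ^ 2) * exp (- c) <= rho ^ 2.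
  apply: le_epsilon => eps e0; have [X X0 hX] := hw eps e0.
  have := mon (Rmax x X) (Rmax_l _ _); have := hX _ (Rmax_r x X); rewrite -/(h _).
  set y := Rmax x X => hy hm.
  have y1 : exp (- c * exp (- y)) <= 1.
    rewrite -exp_0; apply/Rlt_le/exp_increasing; have := exp_pos (- y); nra.
  have x1 : exp (- c) <= exp (- c * exp (- x)).
    have : exp (- x) <= 1.
      rewrite -exp_0; case: (Req_dec x 0) => [->|ne]; first by rewrite Ropp_0; lra.
      by apply/Rlt_le/exp_increasing; lra.
    move=> ex; case: (Req_dec (exp (- x)) 1) => [->|ne]; first by rewrite Rmult_1_r; lra.
    by apply/Rlt_le/exp_increasing; nra.
  have hy0 : 0 <= h y by exact: pow2_ge_0.
  have := exp_pos (- c); nra.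
have e1 : exp c * exp (- c) = 1 by rewrite -exp_plus Rplus_opp_r exp_0.
have e2 := exp_pos c; rewrite -/(h x).
have e3 : h x + rho ^ 2 <= exp c * rho ^ 2.
  have := Rmult_le_compat_l _ _ _ (Rlt_le _ _ e2) lim.
  by rewrite (Rmult_comm (h x + rho ^ 2)) -Rmult_assoc e1 Rmult_1_l.
lra.
Qed.

End Comparison.

Lemma sqr_le_bound (u v : R) : 0 <= v -> u ^ 2 <= v ^ 2 -> u <= v.
Proof. by move=> v0 h; apply: Rsqr_incr_0_var => //; rewrite !Rsqr_pow2. Qed.

Section ModalSystem.
Variables (D m : nat) (C0 c0 : R).
Hypotheses (C00 : 0 <= C0) (c00 : 0 < c0).

Let nD : R := INR D.
Let nD0 : 0 <= nD := pos_INR D.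
Let E : R := exp (2 * C0 + 1).
(** With N = M / kappa for a bound M of the z_j, the constants bound, in units of N: [C1] the error
    term of the transformed system (up to exp(-x)), [C2] the difference w - z, [C3] the components
    with Re mu >= 0, [C4] the other w_j at 0, and [C5] the other z_j. The threshold makes (C3 + C5)
    N at most M / 2. *)
Let C1 : R := C0 + nD * (C0 / c0) + nD * (C0 / c0 * (nD * C0 + C0)) + C0 * (nD * (C0 / c0)).
Let C2 : R := nD * (C0 / c0).
Let C3 : R := E * C1 + C2.
Let C4 : R := C0 * C3 + C2.
Let C5 : R := E * (C4 + C1) + C2.
Definition modal_threshold : R := 1 + 2 * (C3 + C5).

Variables (kappa : R) (mu : nat -> C) (z : nat -> R -> C)
  (beta dbeta : nat -> nat -> R -> C) (rest : nat -> R -> C).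
Hypotheses (hkappa : modal_threshold <= kappa)
  (zc : forall j x, (j < D)%N -> 0 <= x -> continuousC (z j) x)
  (zd : forall j x, (j < D)%N -> 0 < x -> derivableC (z j) x
     (mu j * z j x + (\sum_(l < D) (beta j l x * z l x) + rest j x))%G)
  (hrest : forall j x M, (j < D)%N -> 0 < x ->
     (forall l, (l < D)%N -> Cmod (z l x) <= M) ->
     Cmod (rest j x) <= C0 / kappa * M * exp (- x))
  (bc : forall j l x, (j < D)%N -> (l < D)%N -> 0 <= x -> continuousC (beta j l) x)
  (bd : forall j l x, (j < D)%N -> (l < D)%N -> 0 < x ->
     derivableC (beta j l) x (dbeta j l x))
  (hb : forall j l x, (j < D)%N -> (l < D)%N -> 0 <= x ->
     Cmod (beta j l x) <= C0 * exp (- x))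
  (hdb : forall j l x, (j < D)%N -> (l < D)%N -> 0 < x ->
     Cmod (dbeta j l x) <= C0 * exp (- x))
  (gap : forall j l, (j < D)%N -> (l < D)%N -> j <> l ->
     c0 * kappa <= Cmod (mu j - mu l)%G)
  (mu_minus : forall j, (j < m)%N -> Re (mu j) <= 0)
  (mu_plus : forall j, (m <= j < D)%N -> 0 <= Re (mu j))
  (zlim : forall eps, 0 < eps -> exists2 X, 0 <= X &
     forall j x, (j < D)%N -> X <= x -> Cmod (z j x) <= eps)
  (zbc : forall M, (forall l, (m <= l < D)%N -> Cmod (z l 0) <= M) ->
     forall j, (j < m)%N -> Cmod (z j 0) <= C0 * M).

Let E1 : 1 <= E.
Proof. by rewrite /E -{1}exp_0; apply/Rlt_le/exp_increasing; lra. Qed.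
Let q0 : 0 <= C0 / c0.
Proof. by apply: Rmult_le_pos => //; apply/Rlt_le/Rinv_0_lt_compat. Qed.
Let C10 : 0 <= C1.
Proof.
have := Rmult_le_pos _ _ nD0 q0; have := Rmult_le_pos _ _ nD0 C00.
move=> h1 h2; have : 0 <= nD * (C0 / c0 * (nD * C0 + C0)).
  by do 2!apply: Rmult_le_pos => //; lra.
by have := Rmult_le_pos _ _ C00 h2; rewrite /C1; lra.
Qed.
Let C20 : 0 <= C2. Proof. exact: Rmult_le_pos. Qed.
Let E0 : 0 <= E. Proof. exact/Rlt_le/exp_pos. Qed.
Let C30 : 0 <= C3.
Proof. by have := Rmult_le_pos _ _ E0 C10; have := C20; rewrite /C3; lra. Qed.
Let C40 : 0 <= C4.
Proof. by have := Rmult_le_pos _ _ C00 C30; have := C20; rewrite /C4; lra. Qed.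
Let C50 : 0 <= C5.
Proof.
have := Rmult_le_pos _ _ E0 C10; have := Rmult_le_pos _ _ E0 C40; have := C20.
by rewrite /C5; lra.
Qed.
Let kappa1 : 1 <= kappa.
Proof.
by apply: Rle_trans hkappa; have := C30; have := C50; rewrite /modal_threshold; lra.
Qed.

(* Conjugating by 1 + T removes the off-diagonal part of beta to first order. *)
Let T (j l : nat) (x : R) : C :=
  if j == l then 0%G else (beta j l x / (mu j - mu l))%G.
Let dT (j l : nat) (x : R) : C :=
  if j == l then 0%G else (dbeta j l x / (mu j - mu l))%G.
Let w (j : nat) (x : R) : C := (z j x + \sum_(l < D) T j l x * z l x)%G.
Let r (j : nat) (x : R) : C :=
  (rest j x + \sum_(l < D) (dT j l x * z l x)
   + \sum_(l < D) (T j l x * (\sum_(i < D) (beta l i x * z i x) + rest l x))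
   - beta j j x * \sum_(l < D) (T j l x * z l x))%G.

Let gap0 (j l : nat) : (j < D)%N -> (l < D)%N -> (j == l) = false ->
  (mu j - mu l)%G != 0%G.
Proof.
move=> hj hl /eqP jl; apply/eqP => e; have := gap hj hl jl.
rewrite e Cmod_zero; have := Rmult_lt_0_compat c0 kappa c00 ltac:(lra); lra.
Qed.

Let inv_gap (j l : nat) : (j < D)%N -> (l < D)%N -> (j == l) = false ->
  Cmod ((mu j - mu l)^-1)%G <= / (c0 * kappa).
Proof.
move=> hj hl /eqP jl; rewrite Cmod_inv_; apply: Rinv_le_contravar.
  by apply: Rmult_lt_0_compat; lra.
exact: gap.
Qed.

Let div_kappa (u : R) : u * / (c0 * kappa) = u / c0 / kappa.
Proof. by field; split; lra. Qed.

Let T_le (j l : nat) (x : R) : (j < D)%N -> (l < D)%N -> 0 <= x ->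
  Cmod (T j l x) <= C0 / c0 / kappa * exp (- x).
Proof.
move=> hj hl x0; rewrite /T; case: ifP => jl.
  rewrite Cmod_zero; apply: Rmult_le_pos; last exact/Rlt_le/exp_pos.
  by apply: Rmult_le_pos => //; apply/Rlt_le/Rinv_0_lt_compat; lra.
apply: Rle_trans (Cmod_mul_le (hb hj hl x0) (inv_gap hj hl jl)) _.
by rewrite -(div_kappa C0); lra.
Qed.

Let dT_le (j l : nat) (x : R) : (j < D)%N -> (l < D)%N -> 0 < x ->
  Cmod (dT j l x) <= C0 / c0 / kappa * exp (- x).
Proof.
move=> hj hl x0; rewrite /dT; case: ifP => jl.
  rewrite Cmod_zero; apply: Rmult_le_pos; last exact/Rlt_le/exp_pos.
  by apply: Rmult_le_pos => //; apply/Rlt_le/Rinv_0_lt_compat; lra.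
apply: Rle_trans (Cmod_mul_le (hdb hj hl x0) (inv_gap hj hl jl)) _.
by rewrite -(div_kappa C0); lra.
Qed.

Let w_continuous (j : nat) (x : R) : (j < D)%N -> 0 <= x -> continuousC (w j) x.
Proof.
move=> hj x0; apply: continuousC_add; first exact: zc.
apply: (@continuousC_sum D (fun l t => T j l t * z l t)%G) => l hl.
apply: continuousC_mul; last exact: zc.
rewrite /T; case: (j == l); first exact: continuousC_const.
by apply: continuousC_mul; [exact: bc | exact: continuousC_const].
Qed.

Let T_derivable (j l : nat) (x : R) : (j < D)%N -> (l < D)%N -> 0 < x ->
  derivableC (T j l) x (dT j l x).
Proof.
move=> hj hl x0; rewrite /T /dT; case: (j == l); first exact: derivableC_const.
have := derivableC_mul (bd hj hl x0) (derivableC_const (mu j - mu l)^-1%G x).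
by rewrite mulr0 addr0.
Qed.

(** Differentiating z + T z produces T_jl mu_l z_l, while mu_j w_j contains mu_j T_jl z_l; since
    T_jl (mu_j - mu_l) = beta_jl, the difference cancels the off-diagonal coupling. Every term left
    in r carries a factor 1 / kappa. *)
Let w_derivable (j : nat) (x : R) : (j < D)%N -> 0 < x ->
  derivableC (w j) x ((mu j + beta j j x) * w j x + r j x)%G.
Proof.
move=> hj x0.
pose dz l := (mu l * z l x + (\sum_(i < D) (beta l i x * z i x) + rest l x))%G.
have := derivableC_add (zd hj x0)
  (@derivableC_sum D (fun l t => T j l t * z l t)%G
     (fun l t => dT j l t * z l t + T j l t * dz l)%G x _).
move=> h; have {h} := h (fun l hl => derivableC_mul (T_derivable hj hl x0) (zd hl x0)).
congr derivableC; rewrite /w /r big_split /=.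
have e : (\sum_(l < D) (T j l x * dz l) = 
   \sum_(l < D) (T j l x * (\sum_(i < D) (beta l i x * z i x) + rest l x))
   + (beta j j x * z j x + mu j * \sum_(l < D) (T j l x * z l x)
      - \sum_(l < D) (beta j l x * z l x)))%G.
  have -> : (beta j j x * z j x = \sum_(l < D) (if j == l then beta j l x * z l x else 0))%G.
    rewrite (bigD1 (Ordinal hj)) //= eqxx big1 ?addr0 // => i.
    by rewrite -val_eqE /= eq_sym => /negbTE ->.
  rewrite mulr_sumr -sumrN -!big_split /=; apply: eq_bigr => l _.
  rewrite /dz /T; case: ifP => jl.
    by rewrite !mul0r mulr0 add0r addr0 subrr.
  have g0 := gap0 hj (ltn_ord l) jl.
  have -> : (beta j l x = beta j l x / (mu j - mu l) * (mu j - mu l))%G by rewrite divfK.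
  by rewrite mulfK //; cring.
rewrite e; set S1 := (\sum_(l < D) (T j l x * z l x))%G.
set S2 := (\sum_(l < D) (beta j l x * z l x))%G.
set S3 := (\sum_(l < D) (dT j l x * z l x))%G.
set S4 := (\sum_(l < D) (T j l x * _))%G.
by cring.
Qed.

(** The order matters: components with Re mu >= 0 are estimated from infinity without data at 0; the
    boundary conditions then bound the others at 0, and these are estimated forwards. *)
Let halving (M : R) : 0 <= M ->
  (forall l x, (l < D)%N -> 0 <= x -> Cmod (z l x) <= M) ->
  (forall l x, (l < D)%N -> 0 <= x -> Cmod (z l x) <= M / 2).
Proof.
move=> M0 hM.
have ik : 0 < / kappa by apply: Rinv_0_lt_compat; lra.
pose N := M / kappa; have N0 : 0 <= N by apply: Rmult_le_pos; lra.
have wz j x : (j < D)%N -> 0 <= x -> Cmod (w j x - z j x)%G <= C2 * N.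
  move=> hj x0; rewrite /w addrC addKr.
  have -> : C2 * N = INR D * (C0 / c0 / kappa * M).
    by rewrite /C2 /N /nD; field; split; lra.
  apply: (@Cmod_sum D (fun l => T j l x * z l x)%G) => l hl.
  apply: Cmod_mul_le; last exact: hM.
  apply: Rle_trans (T_le hj hl x0) _.
  have ex : exp (- x) <= 1.
    rewrite -exp_0; case: (Req_dec x 0) => [->|ne]; first by rewrite Ropp_0; lra.
    by apply/Rlt_le/exp_increasing; lra.
  have : 0 <= C0 / c0 / kappa by apply: Rmult_le_pos => //; lra.
  by have := exp_pos (- x); nra.
have rb j x : (j < D)%N -> 0 < x -> Cmod (r j x) <= C1 * N * exp (- x).
  move=> hj x0; have x0' := Rlt_le _ _ x0.
  set u := exp (- x); have u0 : 0 < u := exp_pos _.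
  have u1 : u <= 1 by rewrite /u -exp_0; apply/Rlt_le/exp_increasing; lra.
  have hz l : (l < D)%N -> Cmod (z l x) <= M by move=> hl; exact: hM.
  have b1 := hrest hj x0 hz.
  have b2 : Cmod (\sum_(l < D) (dT j l x * z l x))%G <= INR D * (C0 / c0 / kappa * u * M).
    apply: (@Cmod_sum D (fun l => dT j l x * z l x)%G) => l hl.
    by apply: Cmod_mul_le; [exact: dT_le | exact: hz].
  have b3' l : (l < D)%N ->
     Cmod (\sum_(i < D) (beta l i x * z i x) + rest l x)%G <= INR D * (C0 * M) + C0 * M.
    move=> hl; apply: Cmod_add_le.
      apply: (@Cmod_sum D (fun i => beta l i x * z i x)%G) => i hi.
      apply: Cmod_mul_le; last exact: hz.
      by apply: Rle_trans (hb hl hi x0') _; rewrite -/u; nra.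
    apply: Rle_trans (hrest hl x0 hz) _; rewrite -/u.
    have -> : C0 / kappa * M * u = C0 * M * (/ kappa * u) by rewrite /Rdiv; ring.
    have : / kappa <= 1 by rewrite -Rinv_1; apply: Rinv_le_contravar; lra.
    move=> k1; have ku : / kappa * u <= 1 by nra.
    by have := Rmult_le_compat_l _ _ _ (Rmult_le_pos _ _ C00 M0) ku; lra.
  have b3 : Cmod (\sum_(l < D) (T j l x * (\sum_(i < D) (beta l i x * z i x) + rest l x)))%G
      <= INR D * (C0 / c0 / kappa * u * (INR D * (C0 * M) + C0 * M)).
    apply: (@Cmod_sum D (fun l => T j l x * (\sum_(i < D) (beta l i x * z i x) + rest l x))%G) => l hl.
    by apply: Cmod_mul_le; [exact: T_le | exact: b3'].
  have b4' : Cmod (\sum_(l < D) (T j l x * z l x))%G <= INR D * (C0 / c0 / kappa * u * M).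
    apply: (@Cmod_sum D (fun l => T j l x * z l x)%G) => l hl.
    by apply: Cmod_mul_le; [exact: T_le | exact: hz].
  have b4 := Cmod_mul_le (Rle_trans _ _ _ (hb hj hj x0')
     (Rmult_le_compat_l _ _ _ C00 u1)) b4'.
  apply: Rle_trans (Cmod_sub_le (Cmod_add_le (Cmod_add_le b1 b2) b3) b4) _.
  rewrite -/u -/nD; apply: Req_le; rewrite /C1 /N; field; split; lra.
pose rho := C1 * N; have rho0 : 0 <= rho by exact: Rmult_le_pos.
have plus j x : (m <= j < D)%N -> 0 <= x -> Cmod (z j x) <= C3 * N.
  move=> /[dup] hmj /andP[_ hj] x0.
  have := @comparison_backward (w j) (fun x => mu j + beta j j x)%G (r j) C0 rho C00 
    (fun x => @w_continuous j x hj) (fun x => @w_derivable j x hj)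
    (fun x x0 => rb j x hj x0).
  move=> hcmp.
  have {hcmp} h : Cmod (w j x) ^ 2 <= E * rho ^ 2.
    apply: hcmp => //.
    - move=> t t0; rewrite Re_add; have := mu_plus hmj.
      have := Rle_trans _ _ _ (Rabs_Re_le (beta j j t)) (hb hj hj (Rlt_le _ _ t0)).
      by have := Rle_abs (- Re (beta j j t)); rewrite Rabs_Ropp; lra.
    (* Because d <= 1, d^2 <= d, so ((1 + C2) d)^2 is at most eps. *)
    - move=> eps e0; pose d := Rmin 1 (eps / (1 + C2) ^ 2).
      have d0 : 0 < d.
        apply: Rmin_glb_lt; first lra; apply: Rdiv_lt_0_compat => //; apply: pow_lt; lra.
      have [X X0 hX] := zlim d0; exists X => // t Xt.
      have t0 := Rle_trans _ _ _ X0 Xt.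
      have hw : Cmod (w j t) <= (1 + C2) * d.
        apply: Rle_trans (Cmod_add_le (hX j t hj Xt)
          (@Cmod_sum D (fun l => T j l t * z l t)%G (C0 / c0 * d) _)) _.
          move=> l hl; apply: Cmod_mul_le; last exact: hX.
          apply: Rle_trans (T_le hj hl t0) _.
          have ex : exp (- t) <= 1.
            rewrite -exp_0; case: (Req_dec t 0) => [->|ne]; first by rewrite Ropp_0; lra.
            by apply/Rlt_le/exp_increasing; lra.
          have : / kappa <= 1 by rewrite -Rinv_1; apply: Rinv_le_contravar; lra.
          rewrite /Rdiv -/(C0 / c0) => k1; have := exp_pos (- t) => e1.
          have : / kappa * exp (- t) <= 1 by nra.
          by rewrite Rmult_assoc; nra.
        by rewrite /C2 /nD; lra.
      have hw2 : Cmod (w j t) ^ 2 <= ((1 + C2) * d) ^ 2.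
        by apply: pow_incr; split=> //; exact: Cmod_ge_0.
      apply: Rle_trans hw2 _; rewrite Rpow_mult_distr.
      have d1 : d <= 1 by exact: Rmin_l.
      have d2 : d <= eps / (1 + C2) ^ 2 by exact: Rmin_r.
      have p0 : 0 < (1 + C2) ^ 2 by apply: pow_lt; lra.
      have -> : eps = (1 + C2) ^ 2 * (eps / (1 + C2) ^ 2) by field; lra.
      by apply: Rmult_le_compat_l; [lra | nra].
  have h' : Cmod (w j x) <= E * rho.
    apply: sqr_le_bound; first by apply: Rmult_le_pos; lra.
    by apply: Rle_trans h _; rewrite Rpow_mult_distr; have := pow2_ge_0 rho; nra.
  have -> : z j x = (w j x - (w j x - z j x))%G by rewrite opprB addrC subrK.
  apply: Rle_trans (Cmod_sub_le h' (wz j x hj x0)) _.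
  by rewrite /C3 /rho; lra.
have minus j x : (j < m)%N -> (j < D)%N -> 0 <= x -> Cmod (z j x) <= C5 * N.
  move=> hjm hj x0.
  have z0 : Cmod (z j 0) <= C0 * (C3 * N).
    by apply: zbc hjm => l hl; apply: plus => //; exact: Rle_refl.
  have w0 : Cmod (w j 0) <= C4 * N.
    have -> : w j 0 = (z j 0 + (w j 0 - z j 0))%G by rewrite addrC subrK.
    apply: Rle_trans (Cmod_add_le z0 (wz j 0 hj (Rle_refl 0))) _.
    by rewrite /C4; lra.
  have := @comparison_forward (w j) (fun x => mu j + beta j j x)%G (r j) C0 rho C00 
    (fun x => @w_continuous j x hj) (fun x => @w_derivable j x hj)
    (fun x x0 => rb j x hj x0).
  move=> hcmp.
  have {hcmp} h : Cmod (w j x) ^ 2 <= E * (Cmod (w j 0) ^ 2 + rho ^ 2).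
    apply: hcmp => // t t0; rewrite Re_add; have := mu_minus hjm.
    have := Rle_trans _ _ _ (Rabs_Re_le (beta j j t)) (hb hj hj (Rlt_le _ _ t0)).
    by have := Rle_abs (Re (beta j j t)); lra.
  have h' : Cmod (w j x) <= E * (C4 * N + rho).
    have n4 : 0 <= C4 * N by exact: Rmult_le_pos.
    apply: sqr_le_bound; first by apply: Rmult_le_pos; lra.
    apply: Rle_trans h _.
    have : Cmod (w j 0) ^ 2 <= (C4 * N) ^ 2.
      by apply: pow_incr; split=> //; exact: Cmod_ge_0.
    move=> w2; rewrite Rpow_mult_distr.
    have s1 : Cmod (w j 0) ^ 2 + rho ^ 2 <= (C4 * N + rho) ^ 2 by nra.
    have s0 : 0 <= (C4 * N + rho) ^ 2 by exact: pow2_ge_0.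
    have : E * (Cmod (w j 0) ^ 2 + rho ^ 2) <= E * (C4 * N + rho) ^ 2.
      by apply: Rmult_le_compat_l => //; exact: E0.
    move=> le; apply: Rle_trans le _; apply: Rmult_le_compat_r => //.
    by have := E1; rewrite /=; nra.
  have -> : z j x = (w j x - (w j x - z j x))%G by rewrite opprB addrC subrK.
  apply: Rle_trans (Cmod_sub_le h' (wz j x hj x0)) _.
  by rewrite /C5 /rho; lra.
have NM : (C3 + C5) * N <= M / 2.
  have h1 : (C3 + C5) * 2 <= kappa by move: hkappa; rewrite /modal_threshold; lra.
  have -> : M / 2 = kappa / 2 * N by rewrite /N; field; lra.
  by apply: Rmult_le_compat_r => //; lra.
have := Rmult_le_pos _ _ C30 N0; have := Rmult_le_pos _ _ C50 N0 => n5 n3.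
move=> l x hl x0; case: (ltnP l m) => lm.
  by apply: Rle_trans (minus l x lm hl x0) _; lra.
by apply: Rle_trans (plus l x _ x0) _; [rewrite lm | lra].
Qed.

Lemma modal_system_trivial (j : nat) (x : R) : (j < D)%N -> 0 <= x -> z j x = 0%G.
Proof.
move=> hj x0.
(* A first bound, from which the halving can start: compactness on [0, X] and decay beyond X. *)
have [M0 M00 hM0] : exists2 M, 0 <= M &
    forall l x, (l < D)%N -> 0 <= x -> Cmod (z l x) <= M.
  have [X X0 hX] := zlim Rlt_0_1.
  have [B B0 hB] : exists2 B, 0 <= B &
      forall l x, (l < D)%N -> 0 <= x <= X -> Cmod (z l x) <= B.
    have bnd l : (l < D)%N -> exists B, forall x, 0 <= x <= X -> Cmod (z l x) <= B.
      move=> hl; have hc (t : R) : 0 <= t <= X -> continuity_pt (fun t => Cmod (z l t) ^ 2) t.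
        case=> t0 _; have [h1 h2] := zc hl t0.
        have := continuity_pt_plus _ _ _ (continuity_pt_mult _ _ _ h1 h1)
          (continuity_pt_mult _ _ _ h2 h2).
        congr continuity_pt.
        by apply: funext => s; rewrite Cmod_sqr /plus_fct /mult_fct /=; ring.
      have [t [ht _]] := continuity_ab_maj _ 0 X X0 hc.
      exists (Cmod (z l t)) => s hs; apply: sqr_le_bound; first exact: Cmod_ge_0.
      exact: ht.
    elim: D bnd => [|n IH] bnd; first by exists 0 => //; exact: Rle_refl.
    have [B B0 hB] := IH (fun l hl => bnd l (ltnW hl)); have [B' hB'] := bnd n (ltnSn n).
    exists (Rmax B B'); first exact: Rle_trans B0 (Rmax_l _ _).
    move=> l t; rewrite ltnS leq_eqVlt => /orP[/eqP->|hl] ht.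
      exact: Rle_trans (hB' t ht) (Rmax_r _ _).
    exact: Rle_trans (hB l t hl ht) (Rmax_l _ _).
  exists (Rmax B 1); first exact: Rle_trans B0 (Rmax_l _ _).
  move=> l t hl t0; case: (Rle_lt_dec t X) => tX.
    exact: Rle_trans (hB l t hl (conj t0 tX)) (Rmax_l _ _).
  exact: Rle_trans (hX l t hl (Rlt_le _ _ tX)) (Rmax_r _ _).
have hn n l t : (l < D)%N -> 0 <= t -> Cmod (z l t) <= M0 * (1 / 2) ^ n.
  elim: n l t => [|n IH] l t hl t0; first by rewrite /= Rmult_1_r; exact: hM0.
  have p0 : 0 <= M0 * (1 / 2) ^ n by apply: Rmult_le_pos => //; apply: pow_le; lra.
  by have := halving p0 IH hl t0; rewrite /=; lra.
apply: Cmod_eq0; apply: Rle_antisym; last exact: Cmod_ge_0.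
apply: le_epsilon => eps e0.
have [N hN] := pow_lt_1_zero (1 / 2) ltac:(rewrite Rabs_pos_eq; lra)
  (eps / (M0 + 1)) ltac:(apply: Rdiv_lt_0_compat; lra).
have := hN N (le_n N); rewrite Rabs_pos_eq; last by apply: pow_le; lra.
move=> hN'; apply: Rle_trans (hn N j x hj x0) _.
have p0 := pow_le (1 / 2) N ltac:(lra).
have : eps / (M0 + 1) * (M0 + 1) = eps by field; lra.
nra.
Qed.

End ModalSystem.

(** * Series in powers of exp(-x) *)

Definition is_seriesC (u : nat -> C) (l : C) : Prop :=
  is_series (fun n => Re (u n)) (Re l) /\ is_series (fun n => Im (u n)) (Im l).

Lemma is_seriesC_ext (u v : nat -> C) (l : C) : (forall n, u n = v n) ->
  is_seriesC u l -> is_seriesC v l.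
Proof.
by move=> e [h1 h2]; split; [apply: is_series_ext h1 | apply: is_series_ext h2] => n;
   rewrite e.
Qed.

Lemma is_seriesC_unique (u : nat -> C) (l l' : C) :
  is_seriesC u l -> is_seriesC u l' -> l = l'.
Proof.
move=> [h1 h2] [h3 h4]; apply: C_ext.
  by rewrite -(is_series_unique _ _ h1) -(is_series_unique _ _ h3).
by rewrite -(is_series_unique _ _ h2) -(is_series_unique _ _ h4).
Qed.

Lemma CSeries_eq (u : nat -> C) (l : C) : is_seriesC u l -> CSeries u = l.
Proof.
by case=> h1 h2; apply: C_ext; rewrite /CSeries /=; apply: is_series_unique.
Qed.

Lemma is_seriesC_add (u v : nat -> C) (l l' : C) : is_seriesC u l -> is_seriesC v l' ->
  is_seriesC (fun n => u n + v n)%G (l + l')%G.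
Proof.
by move=> [h1 h2] [h3 h4]; split;
   [exact: is_series_plus h1 h3 | exact: is_series_plus h2 h4].
Qed.

Lemma is_seriesC_scale (c : C) (u : nat -> C) (l : C) : is_seriesC u l ->
  is_seriesC (fun n => c * u n)%G (c * l)%G.
Proof.
move=> [h1 h2]; split.
- rewrite Re_mul; have := is_series_minus _ _ _ _ (is_series_scal_l (Re c) _ _ h1)
    (is_series_scal_l (Im c) _ _ h2).
  exact: is_series_ext.
- rewrite Im_mul; have := is_series_plus _ _ _ _ (is_series_scal_l (Re c) _ _ h2)
    (is_series_scal_l (Im c) _ _ h1).
  exact: is_series_ext.
Qed.

Lemma is_seriesC_zero : is_seriesC (fun _ => 0%G) 0%G.
Proof.
have h : is_series (fun _ : nat => 0) 0.
  apply/is_series_Reals => eps e0; exists 0%N => n _.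
  have -> : sum_f_R0 (fun _ => 0) n = 0 by elim: n => //= n ->; ring.
  by rewrite R_dist_eq.
by split.
Qed.

Lemma is_seriesC_sum (n : nat) (u : nat -> nat -> C) (l : nat -> C) :
  (forall i, (i < n)%N -> is_seriesC (u i) (l i)) ->
  is_seriesC (fun j => \sum_(i < n) u i j)%G (\sum_(i < n) l i)%G.
Proof.
elim: n => [|n IH] h.
  rewrite big_ord0; apply: is_seriesC_ext is_seriesC_zero => j.
  by rewrite big_ord0.
rewrite big_ord_recr.
apply: is_seriesC_ext (is_seriesC_add (IH (fun i hi => h i (ltnW hi))) (h n (ltnSn n))) => j.
by rewrite big_ord_recr.
Qed.

Lemma ex_series_Rabs_le (u : nat -> R) (v : nat -> R) :
  (forall n, Rabs (u n) <= v n) -> ex_series v -> ex_series (fun n => Rabs (u n)).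
Proof.
move=> le; apply: ex_series_le => n.
by rewrite /norm /= /abs /= Rabs_Rabsolu; exact: le.
Qed.

Lemma ex_series_le_R (u : nat -> R) (v : nat -> R) :
  (forall n, 0 <= u n <= v n) -> ex_series v -> ex_series u.
Proof.
move=> le; apply: ex_series_le => n.
by rewrite /norm /= /abs /= Rabs_pos_eq; case: (le n).
Qed.

Lemma Rabs_Series_le (u v : nat -> R) :
  (forall n, Rabs (u n) <= v n) -> ex_series v -> Rabs (Series u) <= Series v.
Proof.
move=> le hv; apply: Rle_trans (Series_Rabs _ (ex_series_Rabs_le le hv)) _.
by apply: Series_le hv => n; split; [exact: Rabs_pos | exact: le].
Qed.

(** * Absolutely summable sequences and their power series *)

Definition summable (a : nat -> C) : Prop := ex_series (fun n => Cmod (a n)).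

Lemma summable_le (a : nat -> C) (v : nat -> R) :
  (forall n, Cmod (a n) <= v n) -> ex_series v -> summable a.
Proof. by move=> le; apply: ex_series_le_R => n; split=> //; exact: Cmod_ge_0. Qed.

(** The factor 2 comes from estimating real and imaginary parts separately. *)
Lemma is_seriesC_of_le (u : nat -> C) (v : nat -> R) :
  (forall n, Cmod (u n) <= v n) -> ex_series v ->
  is_seriesC u (CSeries u) /\ Cmod (CSeries u) <= 2 * Series v.
Proof.
move=> le hv.
have leR n := Rle_trans _ _ _ (Rabs_Re_le (u n)) (le n).
have leI n := Rle_trans _ _ _ (Rabs_Im_le (u n)) (le n).
split.
  by split; apply: Series_correct; apply: ex_series_Rabs;
    [exact: ex_series_Rabs_le leR hv | exact: ex_series_Rabs_le leI hv].
apply: Rle_trans (Cmod_le_ReIm _) _.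
have := Rabs_Series_le leR hv; have := Rabs_Series_le leI hv.
rewrite /CSeries /=; lra.
Qed.

Definition eser (a : nat -> C) (z : R) : C :=
  CSeries (fun n => a n * RtoC (z ^ n))%G.

Lemma pow_le1 (z : R) (n : nat) : 0 <= z <= 1 -> 0 <= z ^ n <= 1.
Proof.
move=> hz; split; first by apply: pow_le; lra.
by rewrite -(pow1 n); apply: pow_incr.
Qed.

Lemma Cmod_term_le (a : nat -> C) (z : R) (n : nat) : 0 <= z <= 1 ->
  Cmod (a n * RtoC (z ^ n))%G <= Cmod (a n).
Proof.
move=> hz; rewrite Cmod_mul Cmod_RtoC; have [h1 h2] := pow_le1 n hz.
by rewrite Rabs_pos_eq //; have := Cmod_ge_0 (a n); nra.
Qed.

Lemma eser_is (a : nat -> C) (z : R) : summable a -> 0 <= z <= 1 ->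
  is_seriesC (fun n => a n * RtoC (z ^ n))%G (eser a z).
Proof.
by move=> ha hz; case: (is_seriesC_of_le (fun n => Cmod_term_le a n hz) ha).
Qed.

Lemma eser_eq (a : nat -> C) (z : R) (l : C) :
  is_seriesC (fun n => a n * RtoC (z ^ n))%G l -> eser a z = l.
Proof. exact: CSeries_eq. Qed.

Lemma eser_ext (a b : nat -> C) (z : R) : (forall n, a n = b n) -> eser a z = eser b z.
Proof. by move=> e; congr eser; apply: funext. Qed.

Lemma eser_bound (a : nat -> C) (v : nat -> R) (z : R) :
  (forall n, Cmod (a n) <= v n) -> ex_series v -> 0 <= z <= 1 ->
  Cmod (eser a z) <= 2 * Series v.
Proof.
move=> le hv hz.
by case: (is_seriesC_of_le (fun n => Rle_trans _ _ _ (Cmod_term_le a n hz) (le n)) hv).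
Qed.

(** Without constant term one factor z can be taken out. At z = exp(-x) this is the decay required
    of the coupling and of the remainder. *)
Lemma eser_bound0 (a : nat -> C) (v : nat -> R) (z : R) : a 0%N = 0%G ->
  (forall n, Cmod (a n) <= v n) -> ex_series v -> 0 <= z <= 1 ->
  Cmod (eser a z) <= 2 * Series v * z.
Proof.
move=> a0 le hv hz.
have hv' : ex_series (fun n => v n * z).
  by have := ex_series_scal_r z v hv.
have le' n : Cmod (a n * RtoC (z ^ n))%G <= v n * z.
  case: n => [|n].
    rewrite a0 mul0r Cmod_zero; apply: Rmult_le_pos; last lra.
    exact: Rle_trans (Cmod_ge_0 _) (le 0%N).
  rewrite Cmod_mul Cmod_RtoC; have [h1 h2] := pow_le1 n hz.
  apply: Rmult_le_compat => //; [exact: Cmod_ge_0 | exact: Rabs_pos |].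
  by rewrite Rabs_pos_eq /=; nra.
have [_ h] := is_seriesC_of_le le' hv'.
by rewrite Series_scal_r in h; rewrite Rmult_assoc.
Qed.

Lemma eser_scale (c : C) (a : nat -> C) (z : R) : summable a -> 0 <= z <= 1 ->
  eser (fun n => c * a n)%G z = (c * eser a z)%G.
Proof.
move=> ha hz; apply: eser_eq; apply: is_seriesC_ext (is_seriesC_scale c (eser_is ha hz)) => n.
by rewrite mulrA.
Qed.

Lemma eser_add (a b : nat -> C) (z : R) : summable a -> summable b -> 0 <= z <= 1 ->
  eser (fun n => a n + b n)%G z = (eser a z + eser b z)%G.
Proof.
move=> ha hb hz; apply: eser_eq.
apply: is_seriesC_ext (is_seriesC_add (eser_is ha hz) (eser_is hb hz)) => n.
by rewrite mulrDl.
Qed.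

Lemma eser_sum (N : nat) (a : nat -> nat -> C) (z : R) :
  (forall i, (i < N)%N -> summable (a i)) -> 0 <= z <= 1 ->
  eser (fun n => \sum_(i < N) a i n)%G z = (\sum_(i < N) eser (a i) z)%G.
Proof.
move=> ha hz; apply: eser_eq.
have := @is_seriesC_sum N (fun i n => a i n * RtoC (z ^ n))%G (fun i => eser (a i) z)
  (fun i hi => eser_is (ha i hi) hz).
by apply: is_seriesC_ext => n; rewrite mulr_suml.
Qed.

Lemma summable_add (a b : nat -> C) : summable a -> summable b ->
  summable (fun n => a n + b n)%G.
Proof.
move=> ha hb; apply: (@summable_le _ (fun n => Cmod (a n) + Cmod (b n))) => [n|].
  exact: Cmod_add.
exact: ex_series_plus ha hb.
Qed.

Lemma summable_scale (c : C) (a : nat -> C) : summable a -> summable (fun n => c * a n)%G.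
Proof.
move=> ha; apply: (@summable_le _ (fun n => Cmod c * Cmod (a n))) => [n|].
  by rewrite Cmod_mul; exact: Rle_refl.
exact: ex_series_scal_l ha.
Qed.

Lemma summable_sum (N : nat) (a : nat -> nat -> C) :
  (forall i, (i < N)%N -> summable (a i)) -> summable (fun n => \sum_(i < N) a i n)%G.
Proof.
elim: N => [|N IH] h.
  apply: (@summable_le _ (fun _ => 0)) => [n|].
    by rewrite big_ord0 Cmod_zero; exact: Rle_refl.
  by exists 0; case: is_seriesC_zero.
have := summable_add (IH (fun i hi => h i (ltnW hi))) (h N (ltnSn N)).
by congr summable; apply: funext => n; rewrite big_ord_recr.
Qed.

Definition convol (a b : nat -> C) (n : nat) : C :=
  (\sum_(j < n.+1) a j * b (n - j)%N)%G.

Lemma is_seriesC_mul (u v : nat -> C) (l l' : C) :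
  is_seriesC u l -> is_seriesC v l' -> summable u -> summable v ->
  is_seriesC (convol u v) (l * l')%G.
Proof.
move=> [u1 u2] [v1 v2] hu hv.
have aR (w : nat -> C) : summable w -> ex_series (fun n => Rabs (Re (w n))).
  exact: ex_series_Rabs_le (fun n => Rabs_Re_le (w n)).
have aI (w : nat -> C) : summable w -> ex_series (fun n => Rabs (Im (w n))).
  exact: ex_series_Rabs_le (fun n => Rabs_Im_le (w n)).
have rr := is_series_mult _ _ _ _ u1 v1 (aR _ hu) (aR _ hv).
have ii := is_series_mult _ _ _ _ u2 v2 (aI _ hu) (aI _ hv).
have ri := is_series_mult _ _ _ _ u1 v2 (aR _ hu) (aI _ hv).
have ir := is_series_mult _ _ _ _ u2 v1 (aI _ hu) (aR _ hv).
split.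
- rewrite Re_mul; have := is_series_minus _ _ _ _ rr ii; apply: is_series_ext => n.
  rewrite /convol (@Re_sum n (fun j => u j * v (n - j)%N)%G) sum_n_Reals.
  by rewrite -[plus _ _]/(Rminus _ _) -minus_sum.
- rewrite Im_mul; have := is_series_plus _ _ _ _ ri ir; apply: is_series_ext => n.
  rewrite /convol (@Im_sum n (fun j => u j * v (n - j)%N)%G) sum_n_Reals.
  by rewrite -[plus _ _]/(Rplus _ _) -plus_sum.
Qed.

Lemma Cmod_sum_f_R0 (n : nat) (F : nat -> C) :
  Cmod (\sum_(j < n.+1) F j)%G <= sum_f_R0 (fun j => Cmod (F j)) n.
Proof.
elim: n => [|n IH].
  by rewrite big_ord_recl big_ord0 addr0; exact: Rle_refl.
rewrite big_ord_recr tech5; apply: Rle_trans (Cmod_add _ _) _.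
exact: Rplus_le_compat_r.
Qed.

Lemma summable_convol (a b : nat -> C) : summable a -> summable b ->
  summable (convol a b).
Proof.
move=> ha hb.
have aa (w : nat -> C) : summable w -> ex_series (fun n => Rabs (Cmod (w n))).
  by apply: ex_series_ext => n; rewrite Rabs_pos_eq //; exact: Cmod_ge_0.
have h := is_series_mult _ _ _ _ (Series_correct _ ha) (Series_correct _ hb)
  (aa _ ha) (aa _ hb).
have hx : ex_series (fun n => sum_f_R0 (fun j => Cmod (a j) * Cmod (b (n - j)%N)) n).
  by exists (Series (fun n => Cmod (a n)) * Series (fun n => Cmod (b n))).
apply: (summable_le _ hx) => n.
apply: Rle_trans (@Cmod_sum_f_R0 n (fun j => a j * b (n - j)%N)%G) _; apply: Req_le; apply: sum_eq => i _.
by rewrite Cmod_mul.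
Qed.

Lemma eser_mul (a b : nat -> C) (z : R) : summable a -> summable b -> 0 <= z <= 1 ->
  (eser a z * eser b z)%G = eser (convol a b) z.
Proof.
move=> ha hb hz; symmetry; apply: eser_eq.
have sa (c : nat -> C) : summable c -> summable (fun n => c n * RtoC (z ^ n))%G.
  exact: (summable_le (fun n => Cmod_term_le c n hz)).
have := is_seriesC_mul (eser_is ha hz) (eser_is hb hz) (sa _ ha) (sa _ hb).
apply: is_seriesC_ext => n; rewrite /convol mulr_suml; apply: eq_bigr => j _.
have -> : z ^ n = z ^ j * z ^ (n - j)%N.
  by rewrite -Rdef_pow_add plusE subnKC // -ltnS.
by rewrite RtoC_mult; cring.
Qed.

Lemma eser_PSeries (a : nat -> C) (z : R) :
  Re (eser a z) = PSeries (fun n => Re (a n)) z /\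
  Im (eser a z) = PSeries (fun n => Im (a n)) z.
Proof.
split; rewrite /eser /CSeries /=; apply: Series_ext => n.
  by rewrite -[LHS]/(Re (a n * RtoC (z ^ n))%G) (Re_mul (a n)) /Re /Im /=; ring.
by rewrite -[LHS]/(Im (a n * RtoC (z ^ n))%G) (Im_mul (a n)) /Re /Im /=; ring.
Qed.

(** For x > 0 the point exp(-x) lies strictly inside the disc of convergence, whose radius is at
    least 1; the chain rule then replaces a_n by -n a_n. *)
Lemma PSeries_exp_is_derive (a : nat -> R) (x : R) :
  ex_series (fun n => Rabs (a n)) -> 0 < x ->
  is_derive (fun t => PSeries a (exp (- t))) x
            (PSeries (fun n => - INR n * a n) (exp (- x))).
Proof.
move=> ha x0; set z := exp (- x).
have z0 : 0 < z by exact: exp_pos.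
have z1 : z < 1 by rewrite /z -exp_0; apply: exp_increasing; lra.
have rad : Rbar_lt (Rabs z) (CV_radius a).
  apply: (@Rbar_lt_le_trans _ 1); first by rewrite /= Rabs_pos_eq; lra.
  rewrite /CV_radius /Lub_Rbar; case: ex_lub_Rbar => l [ub _] /=; apply: ub.
  by apply: ex_series_ext ha => n; rewrite pow1 Rmult_1_r.
have hexp : is_derive (fun t => exp (- t)) x (- z).
  by rewrite /z; auto_derive => //; ring.
have := @is_derive_comp _ _ (PSeries a) (fun t => exp (- t)) x _ _
  (is_derive_PSeries a z rad) hexp.
congr is_derive; rewrite /scal /= /mult /=.
have -> : - z * PSeries (PS_derive a) z = - (z * PSeries (PS_derive a) z) by ring.
rewrite -PSeries_incr_1 -PSeries_opp; apply: PSeries_ext => -[|n].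
  by rewrite /PS_opp /PS_incr_1 /opp /zero /=; ring.
by rewrite /PS_opp /PS_incr_1 /PS_derive /opp /=; ring.
Qed.

Lemma eser_exp_derivable (a : nat -> C) (x : R) : summable a -> 0 < x ->
  derivableC (fun t => eser a (exp (- t))) x
             (eser (fun n => - (n%:R) * a n)%G (exp (- x))).
Proof.
move=> ha x0.
have aR : ex_series (fun n => Rabs (Re (a n))).
  exact: ex_series_Rabs_le (fun n => Rabs_Re_le (a n)) ha.
have aI : ex_series (fun n => Rabs (Im (a n))).
  exact: ex_series_Rabs_le (fun n => Rabs_Im_le (a n)) ha.
have eR n : Re (- (n%:R) * a n)%G = - INR n * Re (a n).
  by rewrite C_natr Re_mul Re_opp Im_opp /Re /Im /=; ring.
have eI n : Im (- (n%:R) * a n)%G = - INR n * Im (a n).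
  by rewrite C_natr Im_mul Re_opp Im_opp /Re /Im /=; ring.
split.
- have := PSeries_exp_is_derive aR x0; congr is_derive.
    by apply: funext => t; case: (eser_PSeries a (exp (- t))).
  by case: (eser_PSeries (fun n => - (n%:R) * a n)%G (exp (- x))) => -> _; 
     apply: PSeries_ext => n.
- have := PSeries_exp_is_derive aI x0; congr is_derive.
    by apply: funext => t; case: (eser_PSeries a (exp (- t))).
  by case: (eser_PSeries (fun n => - (n%:R) * a n)%G (exp (- x))) => _ ->; 
     apply: PSeries_ext => n.
Qed.

Lemma pow_sub1_le (z : R) (n : nat) : 0 <= z <= 1 -> 0 <= 1 - z ^ n <= INR n * (1 - z).
Proof.
move=> hz; elim: n => [|n IH]; first by rewrite /=; lra.
by rewrite S_INR /=; have [h1 h2] := pow_le1 n hz; nra.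
Qed.

(** At x = 0 the variable z = 1 may lie on the circle of convergence, where termwise differentiation
    of power series is not at hand; 1 - z^n <= n (1 - z) still yields continuity there. *)
Lemma eser_lipschitz1 (a : nat -> C) (z : R) : summable a ->
  summable (fun n => n%:R * a n)%G -> 0 <= z <= 1 ->
  Cmod (eser a 1 - eser a z)%G <= 2 * Series (fun n => Cmod (n%:R * a n)%G) * (1 - z).
Proof.
move=> ha hna hz.
have h1 : 0 <= 1 <= 1 by lra.
have h := is_seriesC_add (eser_is ha h1) (is_seriesC_scale (- 1)%G (eser_is ha hz)).
rewrite mulN1r in h.
have le n : Cmod (a n * RtoC (1 ^ n) + -1 * (a n * RtoC (z ^ n)))%G
            <= Cmod (n%:R * a n)%G * (1 - z).
  have -> : (a n * RtoC (1 ^ n) + -1 * (a n * RtoC (z ^ n)))%G = (a n * RtoC (1 - z ^ n))%G.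
    by rewrite pow1 mulN1r -mulrBr RtoC_minus.
  have [p0 p1] := pow_sub1_le n hz.
  rewrite !Cmod_mul Cmod_RtoC C_natr Cmod_RtoC !Rabs_pos_eq //; last exact: pos_INR.
  by have := Cmod_ge_0 (a n); nra.
have [h2 h3] := is_seriesC_of_le le (ex_series_scal_r (1 - z) _ hna).
rewrite (is_seriesC_unique h h2); apply: Rle_trans h3 _.
by rewrite Series_scal_r; lra.
Qed.

Lemma exp_neg_bounds (x : R) : 0 <= x -> 0 <= exp (- x) <= 1.
Proof.
move=> x0; split; first exact/Rlt_le/exp_pos.
rewrite -exp_0; case: (Req_dec x 0) => [->|ne]; first by rewrite Ropp_0; lra.
by apply/Rlt_le/exp_increasing; lra.
Qed.

(* The series may diverge for x < 0, whence the constant extension. *)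
Definition expser (a : nat -> C) (x : R) : C := eser a (exp (- Rmax 0 x)).

Lemma expserE (a : nat -> C) (x : R) : 0 <= x -> expser a x = eser a (exp (- x)).
Proof. by move=> x0; rewrite /expser Rmax_right. Qed.

Lemma expser_derivable (a : nat -> C) (x : R) : summable a -> 0 < x ->
  derivableC (expser a) x (expser (fun n => - (n%:R) * a n)%G x).
Proof.
move=> ha x0; rewrite expserE; last exact: Rlt_le.
apply: derivableC_ext_right x0 _ (eser_exp_derivable ha x0) => t t0.
by rewrite expserE.
Qed.

Lemma expser_continuous (a : nat -> C) (x : R) : summable a ->
  summable (fun n => n%:R * a n)%G -> 0 <= x -> continuousC (expser a) x.
Proof.
move=> ha hna [x0|<-]; first exact: derivableC_continuous (expser_derivable ha x0).
pose K := 2 * Series (fun n => Cmod (n%:R * a n)%G) + 1.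
have K0 : 0 < K.
  have : 0 <= 2 * Series (fun n => Cmod (n%:R * a n)%G).
    apply: Rle_trans (Cmod_ge_0 (eser (fun n => n%:R * a n)%G 1)) _.
    by apply: eser_bound => // [n|]; [exact: Rle_refl | lra].
  by rewrite /K; lra.
have lip t : Cmod (expser a t - expser a 0)%G <= K * Rabs t.
  rewrite /expser (Rmax_left 0 0); last exact: Rle_refl.
  rewrite Ropp_0 exp_0 Cmod_subC.
  have m0 : 0 <= Rmax 0 t by exact: Rmax_l.
  apply: Rle_trans (eser_lipschitz1 ha hna (exp_neg_bounds m0)) _.
  have e1 : 1 - exp (- Rmax 0 t) <= Rmax 0 t.
    by have := exp_ineq1_le (- Rmax 0 t); lra.
  have e2 : Rmax 0 t <= Rabs t.
    by apply: Rmax_lub; [exact: Rabs_pos | exact: Rle_abs].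
  have [e3 e4] := exp_neg_bounds m0.
  by rewrite /K; have := Rabs_pos t; rewrite /K in K0; nra.
have cont (u : R -> R) : (forall t, Rabs (u t - u 0) <= K * Rabs t) -> continuity_pt u 0.
  move=> hu eps e0; exists (eps / K); split; first by apply: Rdiv_lt_0_compat.
  move=> t [_]; rewrite /= /R_dist Rminus_0_r => ht.
  apply: Rle_lt_trans (hu t) _.
  have -> : eps = K * (eps / K) by field; lra.
  exact: Rmult_lt_compat_l.
split; apply: cont => t; apply: Rle_trans (lip t).
  exact: (Rabs_Re_le (expser a t - expser a 0)%G).
exact: (Rabs_Im_le (expser a t - expser a 0)%G).
Qed.

(** * Solutions of the pencil equation *)

Lemma is_derive_half_eps (f : R -> C) (x : R) (l : C) : 0 <= x -> is_derive_half f x l ->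
  forall eps, 0 < eps -> exists2 d, 0 < d & forall t, 0 <= t -> Rabs (t - x) < d ->
    Cmod (f t - f x - RtoC (t - x) * l)%G <= eps * Rabs (t - x).
Proof.
move=> x0 [_ h] eps e0.
have hlim : is_filter_lim (within (fun t : R => 0 <= t) (locally x)) x.
  by move=> P; exact: filter_le_within.
have [d hd] := h x hlim (mkposreal _ e0).
exists d; first exact: cond_pos.
move=> t t0 tx.
(* This is the norm of the normed module used by [is_derive_half], written out in components. *)
have hdt : sqrt (Rabs (Re (f t) - Re (f x) - (t - x) * Re l) ^ 2 +
                 Rabs (Im (f t) - Im (f x) - (t - x) * Im l) ^ 2) <= eps * Rabs (t - x).
  exact: hd t tx t0.
apply: Rle_trans hdt; rewrite !pow2_abs /Cmod; apply: Req_le; congr (sqrt (_ ^ 2 + _ ^ 2)).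
  by rewrite -[LHS]/(Re _) !(Re_add, Re_opp, Re_mul) /Re /Im /=; ring.
by rewrite -[LHS]/(Im _) !(Im_add, Im_opp, Im_mul) /Re /Im /=; ring.
Qed.

Lemma is_derive_half_derivable (f : R -> C) (x : R) (l : C) : 0 < x ->
  is_derive_half f x l -> derivableC f x l.
Proof.
move=> x0 /(is_derive_half_eps (Rlt_le _ _ x0)) h.
have comp (u : R -> R) (v : R) :
    (forall t, Rabs (u t - u x - (t - x) * v) <= Cmod (f t - f x - RtoC (t - x) * l)%G) ->
    is_derive u x v.
  move=> hu; apply/is_derive_Reals => eps e0.
  have [d d0 hd] := h (eps / 2) ltac:(lra).
  have d'0 : 0 < Rmin d x by exact: Rmin_glb_lt.
  exists (mkposreal _ d'0) => t tn0 /= ht.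
  have tx : x + t - x = t by ring.
  have hdt := hd (x + t); rewrite tx in hdt.
  have t1 : Rabs t < d by apply: Rlt_le_trans ht (Rmin_l _ _).
  have t2 : Rabs t < x by apply: Rlt_le_trans ht (Rmin_r _ _).
  have t3 : 0 <= x + t by move: t2 => /Rabs_def2; lra.
  have t4 := Rabs_pos_lt _ tn0.
  have := hu (x + t); rewrite tx => hut; have := hdt t3 t1 => hdt'.
  have -> : (u (x + t) - u x) / t - v = (u (x + t) - u x - t * v) / t by field.
  rewrite Rabs_div //; apply: (Rmult_lt_reg_r (Rabs t)) => //.
  have -> : Rabs (u (x + t) - u x - t * v) / Rabs t * Rabs t = Rabs (u (x + t) - u x - t * v).
    by field; lra.
  apply: Rle_lt_trans hut _; apply: Rle_lt_trans hdt' _; nra.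
split; apply: comp => t.
  apply: Rle_trans (Rabs_Re_le (f t - f x - RtoC (t - x) * l)%G); apply: Req_le; congr Rabs.
  by rewrite !(Re_add, Re_opp, Re_mul) /Re /Im /=; ring.
apply: Rle_trans (Rabs_Im_le (f t - f x - RtoC (t - x) * l)%G); apply: Req_le; congr Rabs.
by rewrite !(Im_add, Im_opp, Im_mul) /Re /Im /=; ring.
Qed.

Lemma is_derive_half_continuous0 (f : R -> C) (l : C) :
  is_derive_half f 0 l -> continuousC (fun x => f (Rmax 0 x)) 0.
Proof.
move=> /(is_derive_half_eps (Rle_refl 0)) h; have [d d0 hd] := h 1 Rlt_0_1.
have L0 : 0 < Cmod l + 1 by have := Cmod_ge_0 l; lra.
have lip t : Rabs t < d -> Cmod (f (Rmax 0 t) - f (Rmax 0 0))%G <= (Cmod l + 1) * Rabs t.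
  move=> td; rewrite (Rmax_left 0 0); last exact: Rle_refl.
  have m0 : 0 <= Rmax 0 t by exact: Rmax_l.
  have mt : Rabs (Rmax 0 t) <= Rabs t.
    rewrite Rabs_pos_eq //.
    by apply: Rmax_lub; [exact: Rabs_pos | exact: Rle_abs].
  have := hd _ m0; rewrite !Rminus_0_r => h1; have := h1 (Rle_lt_trans _ _ _ mt td) => h2.
  have -> : (f (Rmax 0 t) - f 0 =
     (f (Rmax 0 t) - f 0 - RtoC (Rmax 0 t) * l) + RtoC (Rmax 0 t) * l)%G.
    by rewrite subrK.
  have h3 : Cmod (RtoC (Rmax 0 t) * l)%G <= Rabs t * Cmod l.
    by rewrite Cmod_mul Cmod_RtoC; apply: Rmult_le_compat_r => //; exact: Cmod_ge_0.
  by apply: Rle_trans (Cmod_add_le h2 h3) _; lra.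
have comp (u : R -> R) : (forall t, Rabs (u t - u 0) <= Cmod (f (Rmax 0 t) - f (Rmax 0 0))%G) ->
    continuity_pt u 0.
  move=> hu eps e0; exists (Rmin d (eps / (Cmod l + 1))); split.
    by apply: Rmin_glb_lt => //; exact: Rdiv_lt_0_compat.
  move=> t [_]; rewrite /= /R_dist Rminus_0_r => ht.
  have t1 := Rlt_le_trans _ _ _ ht (Rmin_l _ _).
  have t2 := Rlt_le_trans _ _ _ ht (Rmin_r _ _).
  apply: Rle_lt_trans (hu t) _; apply: Rle_lt_trans (lip t t1) _.
  have -> : eps = (Cmod l + 1) * (eps / (Cmod l + 1)) by field; lra.
  exact: Rmult_lt_compat_l.
split; apply: comp => t.
  exact: (Rabs_Re_le (f (Rmax 0 t) - f (Rmax 0 0))%G).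
exact: (Rabs_Im_le (f (Rmax 0 t) - f (Rmax 0 0))%G).
Qed.

(** The equation is imposed for x > 0, where one-sided and ordinary derivatives agree; continuity at
    0 carries the boundary values. *)
Definition pencil_solution (m : nat) (p : nat -> nat -> nat -> C) (k : C)
    (Y : nat -> R -> C) : Prop :=
  half_line_system (2 * m).-1 Y /\ (forall x, 0 < x -> pencil_expr m p k Y x = RtoC 0).

(** Replacing x by max(0, x) turns one-sided differentiability at 0 into two-sided continuity and
    changes nothing on the half-line. *)
Lemma eigenvalue_solution (m : nat) (p : nat -> nat -> nat -> C) (k : C) :
  (0 < m)%N -> is_eigenvalue m p k ->
  exists Y, [/\ pencil_solution m p k Y, often_small (fun x => Cmod (Y 0%N x)),
    exists2 x, 0 <= x & Y 0%N x <> 0%G & forall j, (j < m)%N -> Y j 0 = 0%G].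
Proof.
move=> m0 [y [Y [L2y [[x [x0 yx]] [[Y0 dY] [eqY bcY]]]]]].
exists (fun j t => Y j (Rmax 0 t)).
have ltD j : (j <= (2 * m).-1)%N -> (j < 2 * m)%N.
  by case: m m0 {L2y eqY bcY dY} => // n _; rewrite mulnS.
split.
- split; last first.
    move=> t t0; have := eqY t (Rlt_le _ _ t0).
    by rewrite /pencil_expr Rmax_right //; exact: Rlt_le.
  split=> j t /ltD hj; last first.
    move=> t0; rewrite [Rmax 0 t]Rmax_right; last exact: Rlt_le.
    apply: derivableC_ext_right t0 _ (is_derive_half_derivable t0 (dY j t hj (Rlt_le _ _ t0))).
    by move=> s s0; rewrite Rmax_right.
  case=> [t0|<-].
    apply: (@derivableC_continuous _ _ (Y j.+1 t)).
    apply: derivableC_ext_right t0 _ (is_derive_half_derivable t0 (dY j t hj (Rlt_le _ _ t0))).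
    by move=> s s0; rewrite Rmax_right.
  exact: is_derive_half_continuous0 (dY j 0 hj (Rle_refl 0)).
- move=> eps h e0 h0; have [X hX] := L2_often_small L2y e0 h0.
  exists (Rmax 0 X) => t ht; have [s hs ys] := hX t (Rle_trans _ _ _ (Rmax_r _ _) ht).
  exists s => //; have s0 : 0 <= s by have := Rmax_l 0 X; lra.
  by rewrite Rmax_right // Y0.
- by exists x => //; rewrite Rmax_right // Y0.
- by move=> j hj; rewrite Rmax_left; [exact: bcY | exact: Rle_refl].
Qed.

(** The potentials start at n = 1 while power series start at n = 0, so the arbitrary value of [p]
    at n = 0 is replaced by 0. *)
Definition coef (p : nat -> nat -> nat -> C) (g s n : nat) : C :=
  if n is 0%N then 0%G else p g s n.

Lemma sum_n_ge_term (F : nat -> R) (n i : nat) : (forall j, 0 <= F j) -> (i <= n)%N ->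
  F i <= sum_n F n.
Proof.
move=> F0; have S0 N : 0 <= sum_n F N.
  by rewrite sum_n_Reals; apply: cond_pos_sum.
elim: n => [|n IH]; first by rewrite leqn0 => /eqP ->; rewrite sum_O; exact: Rle_refl.
rewrite sum_Sn /plus /= leq_eqVlt => /orP[/eqP->|/IH].
  by have := S0 n; lra.
by have := F0 n.+1; lra.
Qed.

Lemma double_pred (m : nat) : (0 < m)%N -> (2 * m - 2).+1 = (2 * m).-1.
Proof. by case: m => // m _; rewrite mulnS addKn. Qed.

Section Pencil.
Variables (m : nat) (p : nat -> nat -> nat -> C).
Hypotheses (m0 : (0 < m)%N) (hp : summable_coef m p).
Local Notation D := (2 * m)%N.

Lemma coef_bound : exists v : nat -> R, [/\ ex_series v, forall n, 0 <= v n &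
  forall g s n, (g < D.-1)%N -> (s < D - g)%N ->
    INR n ^ (g + s) * Cmod (coef p g s n) <= v n].
Proof.
pose A n := sum_n (fun g : nat =>
      sum_n (fun s : nat => INR n.+1 ^ (g + s)%N * Cmod (p g s n.+1))
        (2 * m - g - 1)%N) (2 * m - 2)%N.
have A0 n : 0 <= A n.
  rewrite /A sum_n_Reals; apply: cond_pos_sum => g.
  rewrite sum_n_Reals; apply: cond_pos_sum => s.
  by apply: Rmult_le_pos; [apply: pow_le; exact: pos_INR | exact: Cmod_ge_0].
exists (fun n => if n is n'.+1 then A n' else 0); split.
- exact: (proj2 (ex_series_incr_1 (fun n => if n is n'.+1 then A n' else 0)) hp).
- by case=> //; exact: Rle_refl.
- move=> g s [|n] hg hs.
    by rewrite /coef Cmod_zero Rmult_0_r; exact: Rle_refl.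
  have T0 g' s' : 0 <= INR n.+1 ^ (g' + s')%N * Cmod (p g' s' n.+1).
    by apply: Rmult_le_pos; [apply: pow_le; exact: pos_INR | exact: Cmod_ge_0].
  apply: Rle_trans (@sum_n_ge_term (fun g : nat =>
      sum_n (fun s : nat => INR n.+1 ^ (g + s)%N * Cmod (p g s n.+1))
        (2 * m - g - 1)%N) (2 * m - 2)%N g _ _).
  + apply: (@sum_n_ge_term (fun s : nat => INR n.+1 ^ (g + s)%N * Cmod (p g s n.+1))) => //.
    by rewrite subn1 -ltnS prednK // (leq_ltn_trans _ hs).
  + by move=> g'; rewrite sum_n_Reals; apply: cond_pos_sum => s'.
  + by rewrite -ltnS double_pred.
Qed.

Lemma coef_le (v : nat -> R) (g s n : nat) :
  (forall n, 0 <= v n) -> INR n ^ (g + s) * Cmod (coef p g s n) <= v n ->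
  Cmod (coef p g s n) <= v n.
Proof.
case: n => [|n] v0 h; first by rewrite /coef Cmod_zero.
have n1 : 1 <= INR n.+1 by rewrite S_INR; have := pos_INR n; lra.
have := pow_R1_Rle _ (g + s)%N n1; have := Cmod_ge_0 (coef p g s n.+1); nra.
Qed.

(** If g + s >= 1, the weight n^(g+s) pays for one factor n, so the termwise derivative is still
    summable. It is applied with g + s = 2m - 1, to the part of the coupling that must be
    differentiated. *)
Lemma coef_derivative_le (v : nat -> R) (g s n : nat) : (0 < g + s)%N ->
  (forall n, 0 <= v n) -> INR n ^ (g + s) * Cmod (coef p g s n) <= v n ->
  Cmod (n%:R * coef p g s n)%G <= v n.
Proof.
move=> gs v0 h; rewrite Cmod_mul C_natr Cmod_RtoC Rabs_pos_eq; last exact: pos_INR.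
case: n h => [|n] h; first by rewrite /= Rmult_0_l.
apply: Rle_trans h; apply: Rmult_le_compat_r; first exact: Cmod_ge_0.
have n1 : 1 <= INR n.+1 by rewrite S_INR; have := pos_INR n; lra.
rewrite -(prednK gs) /=; have := pow_R1_Rle _ (g + s).-1 n1; rewrite -/(INR n.+1); nra.
Qed.

Lemma potential_expser (g : nat) (x : R) (k : C) : (g < D.-1)%N -> 0 <= x ->
  potential m p g x k = (\sum_(s < D - g) k ^+ s * expser (coef p g s) x)%G.
Proof.
move=> hg x0; have [v [hv v0 hc]] := coef_bound.
rewrite /potential sum_n_big.
have gD : (0 < D - g)%N by rewrite subn_gt0 (leq_trans hg) // leq_pred.
have -> : (2 * m - g - 1).+1 = (D - g)%N by rewrite subn1 prednK.
apply: eq_bigr => s _; apply: CSeries_eq.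
have hs : summable (coef p g s).
  by apply: (summable_le _ hv) => n; apply: coef_le => //; apply: hc.
have := is_seriesC_scale (k ^+ s)%G (eser_is hs (exp_neg_bounds x0)).
rewrite expserE // => -[h1 h2].
have term n : (p g s n.+1 * k ^ s * RtoC (exp (- INR n.+1 * x)))%C =
    (k ^+ s * (coef p g s n.+1 * RtoC (exp (- x) ^ n.+1)))%G.
  have -> : exp (- INR n.+1 * x) = exp (- x) ^ n.+1.
    elim: n => [|n IH]; first by rewrite /= Rmult_1_r; congr exp; ring.
    by rewrite -tech_pow_Rmult -IH -exp_plus (S_INR n.+1); congr exp; ring.
  by rewrite Cpow_exp /coef; cring.
have z0 : (k ^+ s * (coef p g s 0 * RtoC (exp (- x) ^ 0)))%G = 0%G.
  by rewrite /coef mul0r mulr0.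
split.
- apply: is_series_ext (fun n => esym (congr1 Re (term n))) _.
  apply: (@is_series_incr_1 _ _ (fun n => Re (k ^+ s * (coef p g s n * RtoC (exp (- x) ^ n)))%G)).
  by rewrite z0 /plus /= Rplus_0_r.
- apply: is_series_ext (fun n => esym (congr1 Im (term n))) _.
  apply: (@is_series_incr_1 _ _ (fun n => Im (k ^+ s * (coef p g s n * RtoC (exp (- x) ^ n)))%G)).
  by rewrite z0 /plus /= Rplus_0_r.
Qed.

Lemma pencil_exprE (k : C) (Y : nat -> R -> C) (x : R) :
  pencil_expr m p k Y x = ((-1) ^+ m * Y D x +
    \sum_(g < D.-1) potential m p g x k * Y g x - k ^+ D * Y 0%N x)%G.
Proof.
rewrite /pencil_expr sum_n_big !Cpow_exp.
rewrite double_pred //.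
have -> : RtoC ((- 1) ^ m) = ((- 1) ^+ m)%G.
  rewrite RtoC_exp; congr (_ ^+ _)%G.
  by apply: C_ext; rewrite /Re /Im /=; ring.
by [].
Qed.

Lemma sign_sqr : ((-1) ^+ m * (-1) ^+ m = 1 :> C)%G.
Proof. by rewrite -exprMn mulrNN mulr1 expr1n. Qed.

Lemma pencil_top (k : C) (Y : nat -> R -> C) (x : R) :
  pencil_expr m p k Y x = 0%G ->
  Y D x = ((-1) ^+ m * (k ^+ D * Y 0%N x - \sum_(g < D.-1) potential m p g x k * Y g x))%G.
Proof.
rewrite pencil_exprE => h.
have -> : (k ^+ D * Y 0%N x - \sum_(g < D.-1) potential m p g x k * Y g x =
   (-1) ^+ m * Y D x - ((-1) ^+ m * Y D x +
    \sum_(g < D.-1) potential m p g x k * Y g x - k ^+ D * Y 0%N x))%G.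
  by cring.
by rewrite h subr0 mulrA sign_sqr mul1r.
Qed.

Lemma pow_le_1plus (t : R) (s n : nat) : 0 <= t -> (s <= n)%N -> t ^ s <= (1 + t) ^ n.
Proof.
move=> t0 /leP sn; apply: Rle_trans (Rle_pow (1 + t) s n _ sn); last lra.
by apply: pow_incr; lra.
Qed.

Lemma pencil_top_bound (k : C) : exists2 B, 0 <= B & forall Y, pencil_solution m p k Y ->
  forall x M, 0 < x -> (forall j, (j <= D.-1)%N -> Cmod (Y j x) <= M) ->
  Cmod (Y D x) <= B * M.
Proof.
have [v [hv v0 hc]] := coef_bound.
pose V := Series v; have V0 : 0 <= V.
  rewrite -(Rmult_0_r (/ 2)); have := @eser_bound (fun _ => 0%G) v 0
    (fun n => Rle_trans _ _ _ (Req_le _ _ Cmod_zero) (v0 n)) hv (conj (Rle_refl 0) Rle_0_1).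
  have := Cmod_ge_0 (eser (fun _ => 0%G) 0); rewrite /V; lra.
pose K := (1 + Cmod k) ^ D.
have K0 : 0 <= K by apply: pow_le; have := Cmod_ge_0 k; lra.
have hpot g x : (g < D.-1)%N -> 0 <= x -> Cmod (potential m p g x k) <= INR D * (K * (2 * V)).
  move=> hg x0; rewrite potential_expser //.
  apply: Rle_trans (@Cmod_sum (D - g) (fun s => k ^+ s * expser (coef p g s) x)%G
     (K * (2 * V)) _) _.
    move=> s hs; apply: Cmod_mul_le.
      rewrite Cmod_exp; apply: pow_le_1plus; first exact: Cmod_ge_0.
      by apply: leq_trans (ltnW hs) _; exact: leq_subr.
    rewrite expserE //; apply: eser_bound => //; last exact: exp_neg_bounds.
    by move=> n; apply: coef_le => //; apply: hc.
  apply: Rmult_le_compat_r; first by apply: Rmult_le_pos; lra.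
  by apply: le_INR; apply/leP; exact: leq_subr.
exists (K + INR D * (INR D * (K * (2 * V)))).
  have i0 := pos_INR D.
  have : 0 <= K * (2 * V) by apply: Rmult_le_pos; lra.
  by move=> h; have := Rmult_le_pos _ _ i0 (Rmult_le_pos _ _ i0 h); lra.
move=> Y [_ eqY] x M x0 hM.
have D0 : (0 <= D.-1)%N by [].
have M0 := Rle_trans _ _ _ (Cmod_ge_0 _) (hM 0%N D0).
rewrite (pencil_top (eqY x x0)) Cmod_mul Cmod_exp Cmod_N Cmod_one pow1 Rmult_1_l.
have h1 : Cmod (k ^+ D * Y 0%N x)%G <= K * M.
  apply: Cmod_mul_le; last exact: hM.
  by rewrite Cmod_exp; apply: pow_le_1plus => //; exact: Cmod_ge_0.
have h2 : Cmod (\sum_(g < D.-1) potential m p g x k * Y g x)%G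
    <= INR D.-1 * (INR D * (K * (2 * V)) * M).
  apply: (@Cmod_sum _ (fun g => potential m p g x k * Y g x)%G) => g hg.
  by apply: Cmod_mul_le; [apply: hpot => //; exact: Rlt_le | apply: hM; exact: ltnW].
apply: Rle_trans (Cmod_sub_le h1 h2) _; rewrite Rmult_plus_distr_r.
apply: Rplus_le_compat_l; rewrite [X in _ <= X]Rmult_assoc; apply: Rmult_le_compat_r.
  apply: Rmult_le_pos => //; apply: Rmult_le_pos; first exact: pos_INR.
  by apply: Rmult_le_pos; lra.
by apply: le_INR; apply/leP; exact: leq_pred.
Qed.

Lemma prednD : D.-1.+1 = D.
Proof. by rewrite prednK // muln_gt0. Qed.

Definition decays (Y : nat -> R -> C) : Prop :=
  forall eps, 0 < eps -> exists2 X, 0 <= X &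
    forall j x, (j < D)%N -> X <= x -> Cmod (Y j x) <= eps.

Lemma often_small_decays (k : C) (Y : nat -> R -> C) : pencil_solution m p k Y ->
  often_small (fun x => Cmod (Y 0%N x)) -> decays Y.
Proof.
move=> solY hY eps e0; have [B B0 hB] := pencil_top_bound k.
have hB' t M : 0 < t -> (forall i, (i <= D.-1)%N -> Cmod (Y i t) <= M) ->
    Cmod (Y D.-1.+1 t) <= B * M by rewrite prednD; exact: hB.
have [X X0 hX] := energy_tends_to_0 (proj1 solY) hB' hY (pow_lt _ 2 e0).
exists X => // j x hj hx; apply: sqr_le_bound; first exact: Rlt_le.
apply: Rle_trans (hX x hx); apply: energy_ge.
by rewrite -ltnS prednD.
Qed.

Lemma pencil_solution_unique (k : C) (Y : nat -> R -> C) (x0 : R) :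
  pencil_solution m p k Y -> 0 <= x0 -> (forall j, (j < D)%N -> Y j x0 = 0%G) ->
  forall j x, (j < D)%N -> 0 <= x -> Y j x = 0%G.
Proof.
move=> solY hx0 h0 j x hj hx; have [B B0 hB] := pencil_top_bound k.
have hB' t M : 0 < t -> (forall i, (i <= D.-1)%N -> Cmod (Y i t) <= M) ->
    Cmod (Y D.-1.+1 t) <= B * M by rewrite prednD; exact: hB.
apply: (system_unique (proj1 solY) hB' hx0) => //.
  by move=> i hi; apply: h0; rewrite -prednD ltnS.
by rewrite -ltnS prednD.
Qed.

Lemma pencil_solution_add (k : C) (Y Z : nat -> R -> C) :
  pencil_solution m p k Y -> pencil_solution m p k Z ->
  pencil_solution m p k (fun j x => Y j x + Z j x)%G.
Proof.
move=> [[Yc Yd] Ye] [[Zc Zd] Ze]; split; [split=> j x hj x0 | move=> x x0].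
- by apply: continuousC_add; [exact: Yc | exact: Zc].
- by apply: derivableC_add; [exact: Yd | exact: Zd].
- have e : (pencil_expr m p k Y x + pencil_expr m p k Z x = 0)%G.
    by rewrite Ye // Ze //; exact: addr0.
  apply: etrans e; rewrite !pencil_exprE.
  have -> : (\sum_(g < D.-1) potential m p g x k * (Y g x + Z g x) =
     \sum_(g < D.-1) potential m p g x k * Y g x + \sum_(g < D.-1) potential m p g x k * Z g x)%G.
    by rewrite -big_split /=; apply: eq_bigr => g _; rewrite mulrDr.
  by cring.
Qed.

Lemma pencil_solution_scale (k c : C) (Y : nat -> R -> C) :
  pencil_solution m p k Y -> pencil_solution m p k (fun j x => c * Y j x)%G.
Proof.
move=> [[Yc Yd] Ye]; split; [split=> j x hj x0 | move=> x x0].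
- by apply: continuousC_mul; [exact: continuousC_const | exact: Yc].
- by apply: derivableC_scale; exact: Yd.
- have e : (c * pencil_expr m p k Y x = 0)%G by rewrite Ye //; exact: mulr0.
  apply: etrans e; rewrite !pencil_exprE.
  have -> : (\sum_(g < D.-1) potential m p g x k * (c * Y g x) =
     c * \sum_(g < D.-1) potential m p g x k * Y g x)%G.
    by rewrite mulr_sumr; apply: eq_bigr => g _; rewrite mulrCA.
  by cring.
Qed.

Lemma pencil_solution_sum (k : C) (N : nat) (c : nat -> C) (Y : nat -> nat -> R -> C) :
  (forall l, (l < N)%N -> pencil_solution m p k (Y l)) ->
  pencil_solution m p k (fun j x => \sum_(l < N) c l * Y l j x)%G.
Proof.
elim: N => [|N IH] h; last first.
  have := pencil_solution_add (IH (fun l hl => h l (ltnW hl)))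
    (pencil_solution_scale (c N) (h N (ltnSn N))).
  by congr pencil_solution; apply: funext => j; apply: funext => x; rewrite big_ord_recr.
have -> : (fun j x => \sum_(l < 0) c l * Y l j x)%G = (fun (j : nat) (x : R) => 0%G : C).
  by apply: funext => j; apply: funext => x; rewrite big_ord0.
split; first by split=> j x _ _; [exact: continuousC_const | exact: derivableC_const].
move=> x _; rewrite pencil_exprE big1 ?mulr0 ?addr0 ?subr0 //.
by move=> g _; rewrite mulr0.
Qed.

End Pencil.

(** * Absence of eigenvalues for large |k| *)

(** Writing phi = arg k - nu pi/m, which lies in ]0, pi/m[, one has Re(theta_l k) = -|k| sin(l pi/m
    + phi); the angle lies in ]0, pi[ for l < m and in ]pi, 2 pi[ for m <= l < 2m. *)
Lemma sector_sign (m nu l : nat) (k : C) : (0 < m)%N -> sector m nu k ->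
  ((l < m)%N -> Re (theta m nu l * k)%G < 0) /\
  ((m <= l < 2 * m)%N -> 0 < Re (theta m nu l * k)%G).
Proof.
move=> hm [r [t [r0 [ht ->]]]]; have m0 := lt_0_INR m (elimT ltP hm).
set d := PI / INR m; have d0 : 0 < d by apply: Rdiv_lt_0_compat => //; exact: PI_RGT_0.
have md : INR m * d = PI by rewrite /d; field; lra.
pose phi := t - INR nu * d.
have hphi : 0 < phi < d.
  move: ht; rewrite S_INR.
  have -> : INR nu * PI / INR m = INR nu * d by rewrite /d; field; lra.
  have -> : (INR nu + 1) * PI / INR m = INR nu * d + d by rewrite /d; field; lra.
  by rewrite /phi; lra.
set z : C := (_, _).
have e : Re (theta m nu l * z)%G = - r * sin (INR l * d + phi).
  rewrite Re_mul /z.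
  rewrite /theta /cis -/d /Re /Im /=.
  pose u := INR l * d + phi - t.
  have -> : INR l * d + (PI / 2 - INR nu * d) = PI / 2 + u by rewrite /u /phi; ring.
  have -> : INR l * d + phi = u + t by rewrite /u; ring.
  by rewrite cos_plus (sin_plus (PI / 2)) (sin_plus u) cos_PI2 sin_PI2; ring.
rewrite e.
have l0 := pos_INR l; split.
- move=> lm; have h : INR l + 1 <= INR m by rewrite -S_INR; apply: le_INR; exact/leP.
  have : 0 < sin (INR l * d + phi) by apply: sin_gt_0; nra.
  nra.
- case/andP=> ml lm.
  have h1 : INR m <= INR l by apply: le_INR; exact/leP.
  have h2 : INR l + 1 <= 2 * INR m.
    have -> : 2 * INR m = INR (2 * m)%N by rewrite -multE mult_INR.
    by rewrite -S_INR; apply: le_INR; exact/leP.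
  have : sin (INR l * d + phi) < 0 by apply: sin_lt_0; nra.
  nra.
Qed.

(** A strictly wrong sign at k would persist at nearby points of the open sector, since theta has
    modulus 1. *)
Lemma closed_sector_sign (m nu l : nat) (k : C) : (0 < m)%N -> closed_sector m nu k ->
  ((l < m)%N -> Re (theta m nu l * k)%G <= 0) /\
  ((m <= l < 2 * m)%N -> 0 <= Re (theta m nu l * k)%G).
Proof.
move=> hm hk; set t := theta m nu l.
have near z e : Cmod (z - k)%G < e -> Rabs (Re (t * z)%G - Re (t * k)%G) < e.
  move=> h; have -> : Re (t * z)%G - Re (t * k)%G = Re (t * (z - k))%G.
    by rewrite mulrBr Re_add Re_opp.
  apply: Rle_lt_trans (Rabs_Re_le _) _.
  by rewrite Cmod_mul Cmod_theta Rmult_1_l.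
have aux (a b e : R) : Rabs (a - b) < e -> (e <= b -> 0 < a) /\ (e <= - b -> a < 0).
  by move=> /Rabs_def2 h; split; lra.
split=> hl; apply: Rnot_lt_le => hlt.
- have [z [hz /near /aux [h2 _]]] := hk (mkposreal _ hlt).
  have [/(_ hl) h _] := sector_sign l hm hz.
  exact: Rlt_asym h (h2 (Rle_refl _)).
- have [z [hz /near /aux [_ h2]]] := hk (mkposreal _ (Ropp_0_gt_lt_contravar _ hlt)).
  have [_ /(_ hl) h] := sector_sign l hm hz.
  exact: Rlt_asym h (h2 (Rle_refl _)).
Qed.

Section Modal.
Variables (m : nat) (p : nat -> nat -> nat -> C) (nu : nat).
Hypotheses (m0 : (0 < m)%N) (hp : summable_coef m p).
Local Notation D := (2 * m)%N.
Local Notation th := (theta m nu).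

Lemma D_gt0 : (0 < D)%N. Proof. by rewrite muln_gt0. Qed.

Lemma mu_exp (k : C) (l : nat) : ((th l * k) ^+ D = (-1) ^+ m * k ^+ D)%G.
Proof. by rewrite exprMn theta_exp. Qed.

Lemma sign_neq0 : ((-1) ^+ m : C)%G != 0%G.
Proof. by apply/eqP => h; have := sign_sqr m; rewrite h mul0r => /eqP; rewrite eq_sym oner_eq0. Qed.

Section FixedK.
Variable k : C.
Hypothesis k0 : k != 0%G.
Local Notation mu := (fun l => th l * k)%G.
Local Notation c := ((-1) ^+ m * k ^+ D)%G.

Lemma c_neq0 : c != 0%G.
Proof. by rewrite mulf_neq0 ?sign_neq0 // expf_neq0. Qed.

Lemma mu_inj (l l' : nat) : (l < D)%N -> (l' < D)%N -> mu l = mu l' -> l = l'.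
Proof. by move=> hl hl' /(mulIf k0); exact: theta_inj. Qed.

Lemma mu_neq0 (l : nat) : mu l != 0%G.
Proof. by rewrite mulf_neq0 //; apply/eqP; exact: cis_neq0. Qed.

Lemma Cmod_mu (l : nat) : Cmod (mu l) = Cmod k.
Proof. by rewrite Cmod_mul Cmod_theta Rmult_1_l. Qed.

(** The coordinates of (Y_0, ..., Y_(D-1)) in the basis of vectors (mu_l^i)_i, that is, along the
    exponential solutions of the equation with all p_gamma = 0. *)
Definition modal (Y : nat -> R -> C) (j : nat) (x : R) : C :=
  ((D%:R)^-1 * \sum_(i < D) (mu j ^- i * Y i x))%G.

Lemma modal_inverse (Y : nat -> R -> C) (i : nat) (x : R) : (i < D)%N ->
  Y i x = (\sum_(l < D) (mu l ^+ i * modal Y l x))%G.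
Proof.
move=> hi; have := @modal_expansion D c mu (fun i => Y i x) i c_neq0.
by apply=> //; [move=> l _; exact: mu_exp | exact: mu_inj].
Qed.

Lemma modal_bound (Y : nat -> R -> C) (i : nat) (x M : R) : (i < D)%N ->
  (forall l, (l < D)%N -> Cmod (modal Y l x) <= M) ->
  Cmod (Y i x) <= INR D * (Cmod k ^ i * M).
Proof.
move=> hi hM; rewrite (modal_inverse Y x hi).
apply: (@Cmod_sum D (fun l => mu l ^+ i * modal Y l x)%G) => l hl.
by apply: Cmod_mul_le (hM l hl); rewrite Cmod_exp Cmod_mu; exact: Rle_refl.
Qed.

Lemma modal_continuous (Y : nat -> R -> C) (j : nat) (x : R) :
  pencil_solution m p k Y -> 0 <= x -> continuousC (modal Y j) x.
Proof.
move=> [[Yc _] _] x0; apply: continuousC_mul; first exact: continuousC_const.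
apply: (@continuousC_sum D (fun i t => mu j ^- i * Y i t)%G) => i hi.
apply: continuousC_mul; first exact: continuousC_const.
by apply: Yc => //; rewrite -ltnS prednD.
Qed.

Lemma modal_derivable (Y : nat -> R -> C) (j : nat) (x : R) :
  pencil_solution m p k Y -> 0 < x ->
  derivableC (modal Y j) x (mu j * modal Y j x +
    (- (-1) ^+ m) * ((D%:R)^-1 * mu j ^- D.-1) *
      \sum_(g < D.-1) potential m p g x k * Y g x)%G.
Proof.
move=> [[Yc Yd] Ye] x0.
have h : derivableC (modal Y j) x ((D%:R)^-1 * \sum_(i < D) (mu j ^- i * Y i.+1 x))%G.
  apply: derivableC_scale.
  apply: (@derivableC_sum D (fun i t => mu j ^- i * Y i t)%G
     (fun i t => mu j ^- i * Y i.+1 t)%G) => i hi.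
  by apply: derivableC_scale; apply: Yd => //; rewrite -ltnS prednD.
move: h; congr derivableC; rewrite /modal.
have mj := mu_neq0 j.
(* Raising the derivative index multiplies the mode by mu_j up to the two end terms. As mu_j^D =
   (-1)^m k^D, these cancel in the unperturbed equation and leave only the potentials. *)
have shift : (\sum_(i < D) (mu j ^- i * Y i.+1 x) =
   mu j * \sum_(i < D) (mu j ^- i * Y i x) + mu j ^- D.-1 * (Y D x - mu j ^+ D * Y 0%N x))%G.
  have -> : (mu j ^- D.-1 * (Y D x - mu j ^+ D * Y 0%N x) =
             mu j ^- D.-1 * Y D x - mu j * Y 0%N x)%G.
    rewrite mulrBr mulrA; congr (_ - _ * _)%G.
    by rewrite -{2}(prednD m0) exprSr mulKf // expf_neq0.
  rewrite -(prednD m0); move: (D.-1) => n.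
  rewrite big_ord_recr /= [X in (mu j * X)%G]big_ord_recl /= expr0 invr1 mul1r.
  rewrite mulrDr mulr_sumr.
  have -> : (\sum_(i < n) mu j * (mu j ^- bump 0 i * Y (bump 0 i) x) =
             \sum_(i < n) mu j ^- i * Y i.+1 x)%G.
    by apply: eq_bigr => i _; rewrite /bump /= add1n exprS invfM !mulrA mulfV // mul1r.
  set S := (\sum_(i < n) _)%G; set u := (mu j * Y 0%N x)%G; set w := (_ * Y n.+1 x)%G.
  by cring.
rewrite shift mu_exp (pencil_top m0 (Ye x x0)).
set P := (\sum_(g < D.-1) _)%G; set S := (\sum_(i < D) _)%G.
set d := (D%:R^-1)%G; set b := (mu j ^- _)%G; set s := ((-1) ^+ m)%G.
set a := (th j * k)%G; set y := Y 0%N x; set q := (k ^+ D)%G.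
by cring.
Qed.

Lemma modal_decays (Y : nat -> R -> C) : decays m Y -> decays m (modal Y).
Proof.
move=> hY eps e0; have ck : 0 < Cmod k by apply: Cmod_gt0; exact/eqP.
pose L := (1 + / Cmod k) ^ D.
have ik : 0 < / Cmod k by exact: Rinv_0_lt_compat.
have L0 : 0 < L by apply: pow_lt; lra.
have [X X0 hX] := hY (eps / L) (Rdiv_lt_0_compat _ _ e0 L0).
exists X => // j x hj hx; rewrite /modal Cmod_mul Cmod_inv_ C_natr Cmod_RtoC.
have D0 : 0 < INR D by apply: lt_0_INR; apply/ltP; exact: D_gt0.
rewrite Rabs_pos_eq; last exact: Rlt_le.
apply: (Rmult_le_reg_l (INR D)) => //; rewrite -Rmult_assoc Rinv_r; last lra.
rewrite Rmult_1_l; apply: (@Cmod_sum D (fun i => mu j ^- i * Y i x)%G) => i hi.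
have -> : eps = L * (eps / L) by field; lra.
apply: Cmod_mul_le; last exact: hX.
rewrite Cmod_inv_ Cmod_exp Cmod_mu -pow_inv.
by apply: pow_le_1plus; [exact: Rlt_le | exact: ltnW].
Qed.

End FixedK.

(** The coefficients with g + s = 2m - 1, the only ones whose contribution k^s mu^g matches the
    power |k|^(2m-1) in the denominator. *)
Definition leading_coef (g n : nat) : C := coef p g (D.-1 - g) n.

(** The powers of k cancel in modulus, so this is bounded uniformly in k. The coefficients are a
    parameter so that the same expression, with termwise differentiated coefficients, gives the
    derivative in x. *)
Definition coupling (a : nat -> nat -> C) (k : C) (j l : nat) (x : R) : C :=
  (- (-1) ^+ m * ((D%:R)^-1 * (th j * k) ^- D.-1) *
    \sum_(g < D.-1) (k ^+ (D.-1 - g) * (th l * k) ^+ g) * expser (a g) x)%G.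

(** The contribution of g + s < 2m - 1. It is small of order 1/|k| and is never differentiated, so
    it may stay expressed in the Y_g. *)
Definition remainder (Y : nat -> R -> C) (k : C) (j : nat) (x : R) : C :=
  (- (-1) ^+ m * ((D%:R)^-1 * (th j * k) ^- D.-1) *
    \sum_(g < D.-1) (\sum_(s < D.-1 - g) k ^+ s * expser (coef p g s) x) * Y g x)%G.

Lemma Cmod_prefactor (k : C) (j : nat) :
  Cmod (- (-1) ^+ m * ((D%:R)^-1 * (th j * k) ^- D.-1))%G = / INR D * / Cmod k ^ D.-1.
Proof.
rewrite Cmod_mul Cmod_N Cmod_exp Cmod_N Cmod_one pow1 Rmult_1_l Cmod_mul !Cmod_inv_.
rewrite C_natr Cmod_RtoC Rabs_pos_eq; last exact: pos_INR.
by rewrite Cmod_exp Cmod_mul Cmod_theta Rmult_1_l.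
Qed.

Lemma potential_split (k : C) (g : nat) (x : R) : (g < D.-1)%N -> 0 <= x ->
  potential m p g x k = (k ^+ (D.-1 - g) * expser (leading_coef g) x +
    \sum_(s < D.-1 - g) k ^+ s * expser (coef p g s) x)%G.
Proof.
move=> hg x0; rewrite (potential_expser m0 hp k hg x0).
have -> : (D - g = (D.-1 - g).+1)%N by rewrite -{1}(prednD m0) subSn // ltnW.
by rewrite big_ord_recr addrC.
Qed.

Lemma coupling_decomposition (k : C) (Y : nat -> R -> C) (j : nat) (x : R) :
  k != 0%G -> 0 <= x ->
  (- (-1) ^+ m * ((D%:R)^-1 * (th j * k) ^- D.-1) *
    \sum_(g < D.-1) potential m p g x k * Y g x =
   \sum_(l < D) coupling leading_coef k j l x * modal k Y l x + remainder Y k j x)%G.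
Proof.
move=> k0 x0; rewrite /remainder /coupling.
set a := (- (-1) ^+ m * _)%G.
under [X in (_ = X + _)%G]eq_bigr => l _ do rewrite -mulrA.
rewrite -mulr_sumr -mulrDr; congr (_ * _)%G.
under [X in (_ = X + _)%G]eq_bigr => l _ do rewrite mulr_suml.
rewrite exchange_big -big_split /=; apply: eq_bigr => g _.
rewrite (potential_split k (ltn_ord g) x0) mulrDl; congr (_ + _)%G.
have hg : (g < D)%N by apply: leq_trans (ltn_ord g) _; exact: leq_pred.
rewrite {1}(modal_inverse k0 Y x hg) mulr_sumr; apply: eq_bigr => l _.
set b := (k ^+ _)%G; set d := expser _ _; set e := (_ ^+ g)%G; set f := modal _ _ _ _.
by cring.
Qed.

Lemma gap_exists : exists2 c0, 0 < c0 & forall j l, (j < D)%N -> (l < D)%N -> j <> l ->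
  c0 <= Cmod (th j - th l)%G.
Proof.
have [B B0 hB] := bounded_below2 (fun j l => / Cmod (th j - th l)%G) D D.
exists (/ (B + 1)); first by apply: Rinv_0_lt_compat; lra.
move=> j l hj hl jl.
have d0 : 0 < Cmod (th j - th l)%G.
  apply: Cmod_gt0 => /eqP; rewrite subr_eq0 => /eqP /(theta_inj hj hl); exact: jl.
rewrite -[X in _ <= X]Rinv_inv; apply: Rinv_le_contravar; first exact: Rinv_0_lt_compat.
by have := hB j l hj hl; lra.
Qed.

Lemma div_sum_le (n N : nat) (u : R) : (n <= N)%N -> (0 < N)%N -> 0 <= u ->
  / INR N * (INR n * u) <= u.
Proof.
move=> nN N0 u0; have i0 : 0 < INR N by apply: lt_0_INR; exact/ltP.
have h : INR n <= INR N by apply: le_INR; exact/leP.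
apply: (Rmult_le_reg_l (INR N)) => //; rewrite -Rmult_assoc Rinv_r; last lra.
by rewrite Rmult_1_l; apply: Rmult_le_compat_r.
Qed.

Lemma coupling_bound (a : nat -> nat -> C) (v : nat -> R) (k : C) (j l : nat) (x : R) :
  k != 0%G -> ex_series v -> (forall n, 0 <= v n) -> 0 <= x ->
  (forall g, (g < D.-1)%N -> a g 0%N = 0%G) ->
  (forall g n, (g < D.-1)%N -> Cmod (a g n) <= v n) ->
  Cmod (coupling a k j l x) <= 2 * Series v * exp (- x).
Proof.
move=> k0 hv v0 x0 ha0 ha.
have ck : 0 < Cmod k by apply: Cmod_gt0; exact/eqP.
rewrite /coupling Cmod_mul Cmod_prefactor.
set W := 2 * Series v * exp (- x).
have W0 : 0 <= W.
  apply: Rle_trans (Cmod_ge_0 (eser (fun _ => 0%G) (exp (- x)))) _.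
  apply: eser_bound0 => //; last exact: exp_neg_bounds.
  by move=> n; rewrite Cmod_zero.
have h : Cmod (\sum_(g < D.-1) (k ^+ (D.-1 - g) * (th l * k) ^+ g) * expser (a g) x)%G
    <= INR D.-1 * (Cmod k ^ D.-1 * W).
  apply: (@Cmod_sum D.-1 (fun g => (k ^+ (D.-1 - g) * (th l * k) ^+ g) * expser (a g) x)%G) => g hg.
  apply: Cmod_mul_le.
    rewrite Cmod_mul !Cmod_exp Cmod_mul Cmod_theta Rmult_1_l -Rdef_pow_add plusE.
    by rewrite subnK; [exact: Rle_refl | exact: ltnW].
  rewrite expserE //; apply: eser_bound0 => //; try exact: exp_neg_bounds; first exact: ha0.
  by move=> n; exact: ha.
have kD : 0 < Cmod k ^ D.-1 by exact: pow_lt.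
apply: Rle_trans (Rmult_le_compat_l _ _ _ _ h) _.
  apply: Rmult_le_pos; apply/Rlt_le/Rinv_0_lt_compat => //.
  by apply: lt_0_INR; apply/ltP; exact: D_gt0.
have -> : / INR D * / Cmod k ^ D.-1 * (INR D.-1 * (Cmod k ^ D.-1 * W)) =
  / INR D * (INR D.-1 * W).
  by field; split; apply: Rgt_not_eq => //; apply: lt_0_INR; apply/ltP; exact: D_gt0.
by apply: div_sum_le => //; [exact: leq_pred | exact: D_gt0].
Qed.

Lemma remainder_bound (v : nat -> R) (k : C) (Y : nat -> R -> C) (j : nat) (x M : R) :
  1 <= Cmod k -> ex_series v -> (forall n, 0 <= v n) -> 0 <= x -> 0 <= M ->
  (forall g s n, (g < D.-1)%N -> (s < D - g)%N -> Cmod (coef p g s n) <= v n) ->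
  (forall l, (l < D)%N -> Cmod (modal k Y l x) <= M) ->
  Cmod (remainder Y k j x) <= INR D * INR D * (2 * Series v) / Cmod k * M * exp (- x).
Proof.
move=> ck hv v0 x0 M0 hc hM.
have ck0 : 0 < Cmod k by lra.
have k0 : k != 0%G by apply/eqP => e; move: ck0; rewrite e Cmod_zero; lra.
have i0 : 0 < INR D by apply: lt_0_INR; apply/ltP; exact: D_gt0.
set W := 2 * Series v * exp (- x).
have W0 : 0 <= W.
  apply: Rle_trans (Cmod_ge_0 (eser (fun _ => 0%G) (exp (- x)))) _.
  apply: eser_bound0 => //; last exact: exp_neg_bounds.
  by move=> n; rewrite Cmod_zero.
have kD : 0 < Cmod k ^ D.-1 by exact: pow_lt.
have hg' g : (g < D.-1)%N ->
    Cmod ((\sum_(s < D.-1 - g) k ^+ s * expser (coef p g s) x) * Y g x)%G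
    <= Cmod k ^ D.-1 / Cmod k * (INR D * INR D * W * M).
  move=> hg.
  have hgD : (g < D)%N by apply: leq_trans hg _; exact: leq_pred.
  (* The largest s that occurs; e + g = D - 2 is one less than the exponent of the prefactor, whence
     the gain 1/|k|. *)
  pose e := (D.-1 - g).-1.
  have h1 : Cmod (\sum_(s < D.-1 - g) k ^+ s * expser (coef p g s) x)%G
      <= INR D * (Cmod k ^ e * W).
    apply: Rle_trans (@Cmod_sum (D.-1 - g) (fun s => k ^+ s * expser (coef p g s) x)%G
       (Cmod k ^ e * W) _) _.
      move=> s hs; apply: Cmod_mul_le.
        rewrite Cmod_exp; apply: Rle_pow => //; apply/leP.
        by rewrite /e -ltnS prednK // (leq_ltn_trans _ hs).
      rewrite expserE //; apply: eser_bound0 => //; try exact: exp_neg_bounds.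
      move=> n; apply: hc => //; apply: leq_trans hs _; apply: leq_sub2r.
      exact: leq_pred.
    apply: Rmult_le_compat_r.
      by apply: Rmult_le_pos => //; apply: pow_le; lra.
    apply: le_INR; apply/leP; apply: leq_trans (leq_subr _ _) _; exact: leq_pred.
  apply: Rle_trans (Cmod_mul_le h1 (modal_bound k0 hgD hM)) _.
  have -> : Cmod k ^ D.-1 / Cmod k = Cmod k ^ e * Cmod k ^ g.
    have -> : D.-1 = (e + g).+1.
      by rewrite -addSn /e prednK ?subn_gt0 // subnK // ltnW.
    by rewrite -Rdef_pow_add plusE /=; field; lra.
  by apply: Req_le; ring.
have h : Cmod (\sum_(g < D.-1) (\sum_(s < D.-1 - g) k ^+ s * expser (coef p g s) x) * Y g x)%G
    <= INR D.-1 * (Cmod k ^ D.-1 / Cmod k * (INR D * INR D * W * M)).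
  exact: (@Cmod_sum D.-1
    (fun g => (\sum_(s < D.-1 - g) k ^+ s * expser (coef p g s) x) * Y g x)%G).
rewrite /remainder Cmod_mul Cmod_prefactor.
apply: Rle_trans (Rmult_le_compat_l _ _ _ _ h) _.
  by apply: Rmult_le_pos; apply/Rlt_le/Rinv_0_lt_compat.
have -> : / INR D * / Cmod k ^ D.-1 * (INR D.-1 * (Cmod k ^ D.-1 / Cmod k * (INR D * INR D * W * M))) =
  / INR D * (INR D.-1 * (INR D * INR D * W * M / Cmod k)).
  by field; repeat split; lra.
apply: Rle_trans (div_sum_le _ _ _) _; [exact: leq_pred | exact: D_gt0 | |].
  apply: Rmult_le_pos; last exact/Rlt_le/Rinv_0_lt_compat.
  by do 3?apply: Rmult_le_pos => //; lra.
by apply: Req_le; rewrite /W; field; lra.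
Qed.

Lemma no_decaying_solution : exists K0, forall k, closed_sector m nu k -> K0 <= Cmod k ->
  forall Y, pencil_solution m p k Y -> decays m Y ->
  (forall j, (j < m)%N -> Y j 0 = 0%G) ->
  forall j x, (j < D)%N -> 0 <= x -> Y j x = 0%G.
Proof.
have [v [hv v0 hcv]] := coef_bound m0 hp.
have hc g s n : (g < D.-1)%N -> (s < D - g)%N -> Cmod (coef p g s n) <= v n.
  by move=> hg hs; apply: coef_le => //; exact: hcv.
have [c0 c00 hgap] := gap_exists.
have ltmD l : (l < m)%N -> (l < D)%N.
  by move=> lm; apply: leq_trans lm _; rewrite mul2n -addnn leq_addr.
have [B B0 hB] := @vandermonde_bound m th
  (fun l l' hl hl' => @theta_inj m nu l l' (ltmD l hl) (ltmD l' hl')) (Cmod_theta m nu).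
have V0 : 0 <= 2 * Series v.
  apply: Rle_trans (Cmod_ge_0 (eser (fun _ => 0%G) 1)) _.
  apply: eser_bound => //; last lra.
  by move=> n; rewrite Cmod_zero.
have i0 := pos_INR D.
have P0 : 0 <= INR D * INR D * (2 * Series v) by apply: Rmult_le_pos => //; exact: Rmult_le_pos.
(* One constant for three purposes: the coupling and its derivative, the remainder, and the boundary
   conditions. *)
pose C0 := 2 * Series v + INR D * INR D * (2 * Series v) + B.
have C00 : 0 <= C0 by rewrite /C0; lra.
exists (Rmax 1 (modal_threshold D C0 c0)) => k hk hK Y solY decY bcY.
have k1 := Rle_trans _ _ _ (Rmax_l _ _) hK.
have kth := Rle_trans _ _ _ (Rmax_r _ _) hK.
have ck0 : 0 < Cmod k by lra.
have k0 : k != 0%G by apply/eqP => e; move: ck0; rewrite e Cmod_zero; lra.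
pose dlead g n : C := (- (n%:R) * leading_coef g n)%G.
have lead_idx g : (g < D.-1)%N -> (D.-1 - g < D - g)%N.
  by move=> hg; rewrite ltn_sub2r // ?prednD // (leq_trans hg) // leq_pred.
have hlead g n : (g < D.-1)%N -> Cmod (leading_coef g n) <= v n.
  by move=> hg; apply: hc => //; exact: lead_idx.
have D1 : (0 < D.-1)%N by case: (m) m0 => // m' _; rewrite mulnS.
have hdlead' g n : (g < D.-1)%N -> Cmod (n%:R * leading_coef g n)%G <= v n.
  move=> hg; apply: coef_derivative_le => //; last by apply: hcv => //; exact: lead_idx.
  by rewrite subnKC // ltnW.
have hdlead g n : (g < D.-1)%N -> Cmod (dlead g n) <= v n.
  by move=> hg; rewrite /dlead mulNr Cmod_N; exact: hdlead'.
have sl g : (g < D.-1)%N -> summable (leading_coef g).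
  by move=> hg; apply: (summable_le _ hv) => n; exact: hlead.
have sdl g : (g < D.-1)%N -> summable (fun n => n%:R * leading_coef g n)%G.
  by move=> hg; apply: (summable_le _ hv) => n; exact: hdlead'.
have z0 : forall j x, (j < D)%N -> 0 <= x -> modal k Y j x = 0%G.
  apply: (@modal_system_trivial D m C0 c0 C00 c00 (Cmod k) (fun l => th l * k)%G
    (modal k Y) (coupling leading_coef k) (coupling dlead k) (remainder Y k)) => //.
  - by move=> j x _ x0; exact: modal_continuous solY x0.
  - move=> j x _ x0; rewrite -coupling_decomposition //; last exact: Rlt_le.
    exact: modal_derivable solY x0.
  - move=> j x M _ x0 hM.
    have M0 : 0 <= M by apply: Rle_trans (Cmod_ge_0 _) (hM 0%N D_gt0).
    apply: Rle_trans (remainder_bound j k1 hv v0 (Rlt_le _ _ x0) M0 hc hM) _.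
    apply: Rmult_le_compat_r; first exact/Rlt_le/exp_pos.
    apply: Rmult_le_compat_r => //; apply: Rmult_le_compat_r.
      exact/Rlt_le/Rinv_0_lt_compat.
    by rewrite /C0; lra.
  - move=> j l x _ _ x0; apply: continuousC_mul; first exact: continuousC_const.
    apply: (@continuousC_sum D.-1
      (fun g t => (k ^+ (D.-1 - g) * (th l * k) ^+ g) * expser (leading_coef g) t)%G) => g hg.
    apply: continuousC_mul; first exact: continuousC_const.
    by apply: expser_continuous => //; [exact: sl | exact: sdl].
  - move=> j l x _ _ x0; apply: derivableC_scale.
    apply: (@derivableC_sum D.-1
      (fun g t => (k ^+ (D.-1 - g) * (th l * k) ^+ g) * expser (leading_coef g) t)%G
      (fun g t => (k ^+ (D.-1 - g) * (th l * k) ^+ g) * expser (dlead g) t)%G) => g hg.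
    by apply: derivableC_scale; apply: expser_derivable => //; exact: sl.
  - move=> j l x _ _ x0; apply: Rle_trans (coupling_bound j l k0 hv v0 x0 _ hlead) _ => //.
    by apply: Rmult_le_compat_r; [exact/Rlt_le/exp_pos | rewrite /C0; lra].
  - move=> j l x _ _ x0.
    apply: Rle_trans (coupling_bound j l k0 hv v0 (Rlt_le _ _ x0) _ hdlead) _.
      by move=> g _; rewrite /dlead /leading_coef /coef mulr0.
    by apply: Rmult_le_compat_r; [exact/Rlt_le/exp_pos | rewrite /C0; lra].
  - move=> j l hj hl jl; rewrite -mulrBl Cmod_mul; apply: Rmult_le_compat_r; first lra.
    exact: hgap.
  - by move=> j hj; case: (closed_sector_sign j m0 hk) => h _; exact: h.
  - by move=> j hj; case: (closed_sector_sign j m0 hk) => _; exact.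
  - exact: modal_decays.
  - move=> M hM j hj.
    have hj0 : Cmod (modal k Y j 0) <= B * M.
      apply: (hB (fun l => modal k Y l 0)) => // i hi.
      (* The condition Y_i(0) = 0 reads k^i times the sum of theta_l^i z_l(0); after cancelling k^i
         the Vandermonde matrix, and with it the bound B, is independent of k. *)
      have ki : (k ^+ i)%G != 0%G by rewrite expf_neq0.
      apply: (mulfI ki); apply: etrans (esym (mulr0 _)).
      apply: etrans (bcY i hi); rewrite (modal_inverse k0 Y 0 (ltmD i hi)) mulr_sumr.
      apply: eq_bigr => l _.
      by rewrite exprMn mulrA (mulrC (k ^+ i)%G).
    apply: Rle_trans hj0 _; apply: Rmult_le_compat_r; last by rewrite /C0; lra.
    apply: Rle_trans (Cmod_ge_0 _) (hM m _).
    by rewrite leqnn /= mul2n -addnn -{1}(addn0 m) ltn_add2l.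
move=> j x hj x0; rewrite (modal_inverse k0 Y x hj) big1 // => l _.
by rewrite z0 // mulr0.
Qed.

End Modal.

(** * Recursions of convolution type *)

Section CourseOfValues.
Variables (T : Type) (x0 : T) (F : nat -> (nat -> T) -> T).

(** Course-of-values recursion: only the values of [history n] below [n] are meaningful, the others
    are placeholders. *)
Fixpoint history (n : nat) : nat -> T :=
  if n is n'.+1 then
    let h := history n' in fun j => if (j < n')%N then h j else F n' h
  else fun _ => x0.

Definition course_of_values (n : nat) : T := history n.+1 n.

Lemma history_lt (n j : nat) : (j < n)%N -> history n j = course_of_values j.
Proof.
elim: n => [//|n IH]; rewrite ltnS leq_eqVlt => /orP[/eqP->//|hj].
by rewrite -IH //= hj.
Qed.

Lemma course_of_valuesE (n : nat) :
  (forall h h' : nat -> T, (forall j, (j < n)%N -> h j = h' j) -> F n h = F n h') ->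
  course_of_values n = F n course_of_values.
Proof.
move=> hF; rewrite {1}/course_of_values /= ltnn; apply: hF => j hj.
exact: history_lt.
Qed.

End CourseOfValues.

(** * Finite real sums and summability of nonnegative sequences *)

Lemma sum_f_R0_big (n : nat) (F : nat -> R) :
  sum_f_R0 F n = (\sum_(i < n.+1) F i)%G.
Proof.
elim: n => [|n IH]; first by rewrite big_ord_recl big_ord0 addr0.
by rewrite big_ord_recr -IH.
Qed.

Lemma Rsum_ge0 (n : nat) (F : nat -> R) : (forall i, (i < n)%N -> 0 <= F i) ->
  0 <= (\sum_(i < n) F i)%G.
Proof.
elim: n => [|n IH] h; first by rewrite big_ord0; exact: Rle_refl.
rewrite big_ord_recr; apply: Rplus_le_le_0_compat; last exact: h.
by apply: IH => i hi; apply: h; exact: ltnW.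
Qed.

Lemma Rsum_le (n : nat) (F G : nat -> R) : (forall i, (i < n)%N -> F i <= G i) ->
  (\sum_(i < n) F i)%G <= (\sum_(i < n) G i)%G.
Proof.
elim: n => [|n IH] h; first by rewrite !big_ord0; exact: Rle_refl.
rewrite !big_ord_recr; apply: Rplus_le_compat; last exact: h.
by apply: IH => i hi; apply: h; exact: ltnW.
Qed.

Lemma Rsum_const (n : nat) (F : nat -> R) (M : R) : (forall i, (i < n)%N -> F i <= M) ->
  (\sum_(i < n) F i)%G <= INR n * M.
Proof.
elim: n => [|n IH] h; first by rewrite big_ord0 Rmult_0_l; exact: Rle_refl.
rewrite big_ord_recr S_INR Rmult_plus_distr_r Rmult_1_l.
apply: Rplus_le_compat; last exact: h.
by apply: IH => i hi; apply: h; exact: ltnW.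
Qed.

Lemma Rsum_add (n : nat) (F G H : nat -> R) :
  (forall i, (i < n)%N -> H i = F i + G i) ->
  (\sum_(i < n) F i)%G + (\sum_(i < n) G i)%G = (\sum_(i < n) H i)%G.
Proof.
move=> h; apply: etrans (esym (big_split _ _ _ _ _)) _.
by apply: eq_bigr => i _; rewrite h.
Qed.

Lemma Rsum_scale (n : nat) (c : R) (F G : nat -> R) :
  (forall i, (i < n)%N -> G i = c * F i) ->
  c * (\sum_(i < n) F i)%G = (\sum_(i < n) G i)%G.
Proof.
move=> h; apply: etrans (mulr_sumr _ _ _ _) _.
by apply: eq_bigr => i _; rewrite h.
Qed.

Lemma partial_sum_le_Series (v : nat -> R) (n : nat) : (forall i, 0 <= v i) -> ex_series v ->
  sum_f_R0 v n <= Series v.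
Proof.
move=> v0 hv; rewrite -sum_n_Reals.
apply: (is_lim_seq_incr_compare (sum_n v)).
  exact: Series_correct hv.
by move=> i; rewrite sum_Sn /plus /=; have := v0 i.+1; lra.
Qed.

Lemma ex_series_of_bounded (u : nat -> R) (M : R) : (forall n, 0 <= u n) ->
  (forall n, sum_f_R0 u n <= M) -> ex_series u.
Proof.
move=> u0 hM.
have [l hl] : ex_finite_lim_seq (sum_n u).
  apply: (ex_finite_lim_seq_incr _ M) => n.
    by rewrite sum_Sn /plus /=; have := u0 n.+1; lra.
  by rewrite sum_n_Reals.
by exists l.
Qed.

(** Interchange of the two summations; the nonnegative terms v_0 w_j are added so that the inner
    sums become partial sums of v. *)
Lemma convolution_partial_sum (v w : nat -> R) (N : nat) (V : R) :
  (forall n, 0 <= v n) -> (forall n, 0 <= w n) -> (forall n, sum_f_R0 v n <= V) ->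
  sum_f_R0 (fun n => (\sum_(j < n) v (n - j)%N * w j)%G) N <= V * sum_f_R0 w N.
Proof.
move=> v0 w0 hV.
have step n : sum_f_R0 (fun n => (\sum_(j < n) v (n - j)%N * w j)%G) n <=
    (\sum_(j < n.+1) (sum_f_R0 v (n - j)%N * w j))%G.
  elim: n => [|n IH].
    rewrite /= big_ord0 big_ord_recl big_ord0 addr0.
    by apply: Rmult_le_pos; [exact: v0 | exact: w0].
  rewrite tech5 [X in _ <= X]big_ord_recr /= subnn.
  apply: Rle_trans (Rplus_le_compat_r _ _ _ IH) _.
  rewrite (@Rsum_add _ (fun j => sum_f_R0 v (n - j) * w j) (fun j => v (n.+1 - j)%N * w j)
     (fun j => sum_f_R0 v (n.+1 - j) * w j)); last first.
    by move=> j hj; rewrite subSn // tech5 Rmult_plus_distr_r.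
  have := Rmult_le_pos _ _ (v0 0%N) (w0 n.+1).
  move=> h; rewrite -[X in X <= _]Rplus_0_r; exact: Rplus_le_compat_l.
apply: Rle_trans (step N) _; rewrite sum_f_R0_big.
rewrite (@Rsum_scale _ V w (fun j => V * w j)) //.
apply: (@Rsum_le _ (fun j => sum_f_R0 v (N - j) * w j) (fun j => V * w j)) => j _.
exact: Rmult_le_compat_r.
Qed.

(* The weight (j + 1)^-2 makes all but finitely many terms of the recursion
   contract by a factor 1/2. *)
Lemma convolution_recursion_summable (v u : nat -> R) (H : R) :
  0 <= H -> (forall n, 0 <= v n) -> ex_series v -> (forall n, 0 <= u n) ->
  (forall n, (0 < n)%N -> u n = H * (\sum_(j < n) v (n - j)%N * (u j / INR j.+1 ^ 2)%R)%G) ->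
  ex_series u.
Proof.
move=> H0 v0 hv u0 hu.
pose V := Series v; pose w j := u j / INR j.+1 ^ 2.
have s0 j : 0 < INR j.+1 ^ 2 by apply: pow_lt; apply: lt_0_INR; apply/ltP.
have w0 j : 0 <= w j by apply: Rmult_le_pos => //; apply/Rlt_le/Rinv_0_lt_compat.
have V0 : 0 <= V.
  by apply: Rle_trans (partial_sum_le_Series 0 v0 hv); exact: v0.
(* Since (j + 1)^2 >= 2 H V once j + 1 >= 2 H V + 1, the weight halves all later terms. *)
have [J hJ] : exists J, forall j, (J <= j)%N -> H * V * w j <= u j / 2.
  have [J hJ] := INR_unbounded (2 * (H * V) + 1).
  exists J => j Jj.
  have j1 : 2 * (H * V) + 1 <= INR j.+1.
    have : INR J <= INR j.+1 by apply: le_INR; apply/leP; exact: leqW.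
    lra.
  have HV := Rmult_le_pos _ _ H0 V0.
  have e : w j * INR j.+1 ^ 2 = u j by rewrite /w; field; have := lt_0_INR j.+1 (Nat.lt_0_succ j); lra.
  have h : 2 * (H * V) <= INR j.+1 ^ 2.
    by move: j1; set t := INR j.+1 => j1; nra.
  by have := Rmult_le_compat_l _ _ _ (w0 j) h; lra.
have wu j : w j <= u j.
  have e : w j * INR j.+1 ^ 2 = u j by rewrite /w; field; have := lt_0_INR j.+1 (Nat.lt_0_succ j); lra.
  have : 1 <= INR j.+1 ^ 2.
    by rewrite S_INR; have := pos_INR j; nra.
  by move=> h; have := Rmult_le_compat_l _ _ _ (w0 j) h; lra.
have split N : H * V * sum_f_R0 w N <= H * V * sum_f_R0 u J + sum_f_R0 u N / 2.
  have HV := Rmult_le_pos _ _ H0 V0.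
  have S0 n : 0 <= sum_f_R0 u n by apply: cond_pos_sum.
  elim: N => [|N IH] /=.
    have : u 0%N <= sum_f_R0 u J.
      have [->|J0] := posnP J; first exact: Rle_refl.
      have := @sum_n_ge_term u J 0%N u0 (leq0n J); rewrite sum_n_Reals; exact.
    move=> h; have := u0 0%N.
    by have := Rmult_le_compat_l _ _ _ HV (Rle_trans _ _ _ (wu 0%N) h); lra.
  case: (leqP J N.+1) => hJN.
    by have := hJ _ hJN; lra.
  have h1 : sum_f_R0 w N.+1 <= sum_f_R0 u J.
    apply: Rle_trans (_ : sum_f_R0 u N.+1 <= _); first exact: sum_Rle.
    elim: J hJN {hJ IH} => [//|J IHJ]; rewrite ltnS leq_eqVlt => /orP[/eqP<-|h].
      by rewrite [sum_f_R0 u N.+2]tech5; have := u0 N.+2; lra.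
    by rewrite [sum_f_R0 u J.+1]tech5; have := IHJ h; have := u0 J.+1; lra.
  have := Rmult_le_compat_l _ _ _ HV h1; have := S0 N.+1; rewrite !tech5; lra.
(* The partial sum is at most u_0 plus a constant plus half of itself; solving for it gives a bound
   independent of N. *)
have bound N : sum_f_R0 u N <= 2 * (u 0%N + H * V * sum_f_R0 u J).
  have h : sum_f_R0 u N <= u 0%N + H * (V * sum_f_R0 w N).
    have := @convolution_partial_sum v w N V v0 w0 (fun n => partial_sum_le_Series n v0 hv).
    move/(Rmult_le_compat_l _ _ _ H0) => hc; apply: Rle_trans (Rplus_le_compat_l _ _ _ hc).
    elim: N {hc} => [|N IH].
      by rewrite /= big_ord0 -[0%G]/0 Rmult_0_r Rplus_0_r; exact: Rle_refl.
    rewrite !tech5 Rmult_plus_distr_l -Rplus_assoc (hu N.+1 isT).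
    by apply: Rplus_le_compat; [exact: IH | exact: Rle_refl].
  have := split N; lra.
exact: ex_series_of_bounded u0 bound.
Qed.

(** Partial sums converge uniformly on [Om], and their norm bounds are partial sums of the majorant.
    The tail is taken below eps/2 because the bound of a complex series costs a factor 2. *)
Lemma approx_series (Om : C -> Prop) (K : R) (f : nat -> C -> C) (M : nat -> R) :
  0 <= K -> (forall x, Om x -> Cmod x <= K) ->
  (forall n, approximable Om K (M n) (f n)) -> ex_series M ->
  approximable Om K (Series M) (fun x => CSeries (fun n => f n x)).
Proof.
move=> K0 OmK hf hM.
have M0 n : 0 <= M n by exact: approx_ge0 (hf n).
apply: (approx_limit) => eps e0.
have [N hN] : exists N, Series (fun n => M (N.+1 + n)%N) <= eps / 2.
  have := Series_correct _ hM => /is_series_Reals /(_ (eps / 2) ltac:(lra)) [N hN].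
  exists N; have := hN N (le_n N); rewrite /R_dist.
  have := @Series_incr_n M N.+1 (Nat.lt_0_succ N) hM.
  rewrite [Init.Nat.pred _]/= => ->.
  have -> : sum_f_R0 M N - (sum_f_R0 M N + Series (fun k => M (N.+1 + k)%coq_nat)) =
     - Series (fun k => M (N.+1 + k)%coq_nat) by ring.
  by rewrite Rabs_Ropp => /Rlt_le; apply: Rle_trans; exact: Rle_abs.
exists (fun x => \sum_(i < N.+1) f i x)%G.
  apply: approx_le (approx_sum K0 (fun i (hi : (i < N.+1)%N) => hf i)).
  by rewrite -sum_f_R0_big; exact: partial_sum_le_Series.
move=> x hx.
have le n : Cmod (f n x) <= M n by exact: approx_bound (hf n) hx.
have [h1 _] := is_seriesC_of_le le hM.
have hMN : ex_series (fun n => M (N.+1 + n)%N) := proj1 (ex_series_incr_n M N.+1) hM.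
have [h2 h3] := is_seriesC_of_le (fun n => le (N.+1 + n)%N) hMN.
have e : (CSeries (fun n => f n x) = CSeries (fun n => f (N.+1 + n)%N x) + \sum_(i < N.+1) f i x)%G.
  case: h1 => r1 i1; case: h2 => r2 i2.
  apply: C_ext.
    rewrite Re_add (@Re_sum N (fun i => f i x)).
    have := @is_series_decr_n _ _ (fun n => Re (f n x)) N.+1 _ (Nat.lt_0_succ N) _.
    move=> /(_ (Re (CSeries (fun n => f (N.+1 + n)%N x)) + sum_n (fun i => Re (f i x)) N)) h.
    rewrite -(is_series_unique _ _ r1) ; apply: is_series_unique; apply: h.
    rewrite /plus /opp /=.
    by have -> : forall a b, a + b + - b = a by move=> a b; ring.
  rewrite Im_add (@Im_sum N (fun i => f i x)).
  have := @is_series_decr_n _ _ (fun n => Im (f n x)) N.+1 _ (Nat.lt_0_succ N) _.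
  move=> /(_ (Im (CSeries (fun n => f (N.+1 + n)%N x)) + sum_n (fun i => Im (f i x)) N)) h.
  rewrite -(is_series_unique _ _ i1) ; apply: is_series_unique; apply: h.
  rewrite /plus /opp /=.
  by have -> : forall a b, a + b + - b = a by move=> a b; ring.
by rewrite e addrK; lra.
Qed.

Lemma eser_sub_const (a : nat -> C) (z : R) : summable a -> 0 <= z <= 1 ->
  Cmod (eser a z - a 0%N)%G <= 2 * Series (fun n => Cmod (a n.+1)) * z.
Proof.
move=> ha hz.
have ha' : ex_series (fun n => Cmod (a n.+1)) := proj1 (ex_series_incr_1 _) ha.
have le n : Cmod (a n.+1 * RtoC (z ^ n.+1))%G <= Cmod (a n.+1) * z.
  rewrite Cmod_mul Cmod_RtoC; have [h1 h2] := pow_le1 n hz.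
  apply: Rmult_le_compat_l; first exact: Cmod_ge_0.
  by rewrite Rabs_pos_eq /=; nra.
have [h1 h2] := is_seriesC_of_le le (ex_series_scal_r z _ ha').
have t0 : (a 0%N * RtoC (z ^ 0))%G = a 0%N by rewrite /= -C_1E mulr1.
have h : is_seriesC (fun n => a n.+1 * RtoC (z ^ n.+1))%G (eser a z - a 0%N)%G.
  have [r i] := eser_is ha hz; split.
    apply: (@is_series_incr_1 _ _ (fun n => Re (a n * RtoC (z ^ n))%G)).
    rewrite t0 Re_add Re_opp /plus /=.
    by have -> : forall a b, a + - b + b = a by move=> u b; ring.
  apply: (@is_series_incr_1 _ _ (fun n => Im (a n * RtoC (z ^ n))%G)).
  rewrite t0 Im_add Im_opp /plus /=.
  by have -> : forall a b, a + - b + b = a by move=> u b; ring.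
rewrite (is_seriesC_unique h h1); apply: Rle_trans h2 _.
by rewrite Series_scal_r; lra.
Qed.

(** * The Frobenius recursion *)

Lemma uniform_bound (P : nat -> R -> Prop) (n : nat) :
  (forall i M M', M <= M' -> P i M -> P i M') ->
  (forall i, (i < n)%N -> exists M, P i M) ->
  exists2 M, 1 <= M & forall i, (i < n)%N -> P i M.
Proof.
move=> mono; elim: n => [|n IH] h; first by exists 1 => //; exact: Rle_refl.
have [M M1 hM] := IH (fun i hi => h i (ltnW hi)); have [M' hM'] := h n (ltnSn n).
exists (Rmax M M'); first exact: Rle_trans M1 (Rmax_l _ _).
move=> i; rewrite ltnS leq_eqVlt => /orP[/eqP->|hi].
  exact: mono (Rmax_r _ _) hM'.
exact: mono (Rmax_l _ _) (hM i hi).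
Qed.

Section ApproxMore.
Variables (Om : C -> Prop) (K : R).
Hypotheses (K0 : 0 <= K) (OmK : forall x, Om x -> Cmod x <= K).
Local Notation approx := (approximable Om K).

(** The step is 1 - (1 - t)^(n+1) = 1 - (1 - t)^n + t (1 - t)^n. The point is a bound linear in tau,
    hence small with tau. *)
Lemma approx_one_minus_pow (t : C -> C) (tau : R) (n : nat) : tau <= 1 -> approx tau t ->
  approx (2 ^ n * tau) (fun k => 1 - (1 - t k) ^+ n)%G.
Proof.
move=> t1 ht; have t0 := approx_ge0 K0 ht.
elim: n => [|n IH].
  rewrite /= Rmult_1_l; apply: (approx_le (M := Cmod 0%G)); first by rewrite Cmod_zero.
  by apply: approx_ext (approx_const _ _ 0%G) => x _; rewrite expr0 subrr.
have h1 : approx 2 (fun k => 1 - t k)%G.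
  have := approx_add K0 (approx_const Om K 1%G) (approx_opp K0 OmK ht).
  by apply: approx_le; rewrite Cmod_one; lra.
have h2 := approx_add K0 IH (approx_mul K0 OmK ht (approx_exp K0 OmK n h1)).
have -> : 2 ^ n.+1 * tau = 2 ^ n * tau + tau * 2 ^ n by rewrite /=; ring.
by apply: approx_ext h2 => x _; rewrite exprS; set u := ((1 - t x) ^+ n)%G; cring.
Qed.

(** The quotient is the product without its i-th factor, so no bound on 1 / F_i is required. *)
Lemma approx_prod_div (n i : nat) (F : nat -> C -> C) :
  (forall j, (j < n)%N -> exists M, approx M (F j)) -> (i < n)%N ->
  (forall x, Om x -> F i x <> 0%G) ->
  exists M, approx M (fun x => (\prod_(j < n) F j x) / F i x)%G.
Proof.
elim: n => [//|n IH] h; rewrite ltnS leq_eqVlt => /orP[/eqP ein|hi] Fi0.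
  have [M hM] := @approx_prod Om K K0 OmK n F (fun j hj => h j (ltnW hj)).
  exists M; apply: approx_ext hM => x hx.
  by rewrite big_ord_recr /= -ein mulfK //; apply/eqP; exact: Fi0.
have [M hM] := IH (fun j hj => h j (ltnW hj)) hi Fi0.
have [M' hM'] := h n (ltnSn n).
exists (M * M'); apply: approx_ext (approx_mul K0 OmK hM hM') => x hx.
by rewrite big_ord_recr /= mulrAC.
Qed.

End ApproxMore.

Lemma approx_sub (Om Om' : C -> Prop) (K M : R) (f : C -> C) :
  (forall x, Om' x -> Om x) -> approximable Om K M f -> approximable Om' K M f.
Proof.
move=> sub hf eps e0; have [P [hP h]] := hf eps e0.
by exists P; split=> // x /sub; exact: h.
Qed.

Section Frobenius.
Variables (m : nat) (p : nat -> nat -> nat -> C) (nu : nat).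
Hypotheses (m0 : (0 < m)%N) (hp : summable_coef m p).
Local Notation D := (2 * m)%N.
Local Notation th := (theta m nu).

(* Inserting y = sum_n a_n exp((theta k - n) x) into l(y) = 0 and comparing
   coefficients of exp((theta k - n) x) gives the recursion solved by frob. *)
Definition indicial (l n : nat) (k : C) : C :=
  ((-1) ^+ m * (th l * k - n%:R) ^+ D - k ^+ D)%G.

Definition kern (l : nat) (k : C) (n j : nat) : C :=
  (\sum_(g < D.-1) (\sum_(s < D - g) k ^+ s * coef p g s (n - j)%N)
     * (th l * k - j%:R) ^+ g)%G.

(** Normalized by the value 1 at index 0. At a resonance the inverse of 0 is 0 and the value is a
    default; the solution is formed only where the denominators do not vanish. *)
Definition frob (l : nat) (k : C) : nat -> C :=
  course_of_values 0%G (fun n h => if n is 0%N then 1%G else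
    - (indicial l n k)^-1 * \sum_(j < n) kern l k n j * h j)%G.

Lemma frob0 (l : nat) (k : C) : frob l k 0 = 1%G.
Proof. by []. Qed.

Lemma frobE (l n : nat) (k : C) : (0 < n)%N ->
  frob l k n = (- (indicial l n k)^-1 * \sum_(j < n) kern l k n j * frob l k j)%G.
Proof.
case: n => // n _; apply: course_of_valuesE => h h' e.
by congr (_ * _)%G; apply: eq_bigr => j _; rewrite e.
Qed.

Section OnDisc.
Variables (Om : C -> Prop) (K : R).
Hypotheses (K0 : 0 <= K) (OmK : forall x, Om x -> Cmod x <= K).
Local Notation approx := (approximable Om K).

Lemma approx_mu (l : nat) : approx K (fun k => th l * k)%G.
Proof.
have := approx_scale K0 OmK (th l) (approx_id Om K).
by rewrite Cmod_theta Rmult_1_l.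
Qed.

Lemma approx_shift (l n : nat) : approx ((1 + K) * INR n.+1) (fun k => th l * k - n%:R)%G.
Proof.
have := approx_add K0 (approx_mu l) (approx_opp K0 OmK (approx_const Om K (n%:R)%G)).
apply: approx_le; rewrite C_natr Cmod_RtoC Rabs_pos_eq; last exact: pos_INR.
by rewrite S_INR; have := pos_INR n; nra.
Qed.

Lemma approx_indicial (l n : nat) : exists M, approx M (indicial l n).
Proof.
have h1 := approx_mul K0 OmK (approx_const Om K ((-1) ^+ m)%G)
  (approx_exp K0 OmK D (approx_shift l n)).
have h2 := approx_opp K0 OmK (approx_exp K0 OmK D (approx_id Om K)).
have h := approx_add K0 h1 h2.
by eexists; apply: approx_ext h => x _.
Qed.

(** With t = theta k / n and D even, n^D can be taken out and a factor 1 - g remains, where g is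
    small for n large compared with |k|; then g serves in the geometric series. *)
Lemma indicial_factor (l n : nat) (k : C) : (0 < n)%N ->
  indicial l n k = ((-1) ^+ m * n%:R ^+ D *
    (1 - (1 - (1 - th l / n%:R * k) ^+ D + (th l / n%:R * k) ^+ D)))%G.
Proof.
move=> n0; have nz := C_natr_neq0 n0; rewrite /indicial.
have -> : (k ^+ D = (-1) ^+ m * (th l * k) ^+ D)%G.
  by rewrite exprMn theta_exp // mulrA sign_sqr mul1r.
set t := (th l / n%:R * k)%G.
have et : (th l * k = n%:R * t)%G by rewrite /t mulrA mulrCA divff // mulr1.
have -> : ((th l * k - n%:R) ^+ D = n%:R ^+ D * (1 - t) ^+ D)%G.
  have s2 : ((-1 : C) ^+ D = 1)%G by rewrite exprM sqrrN !expr1n.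
  have -> : (th l * k - n%:R = -1 * (n%:R * (1 - t)))%G.
    by rewrite et mulN1r mulrBr mulr1 opprB.
  by rewrite exprMn s2 mul1r exprMn.
rewrite et exprMn.
set u := ((1 - t) ^+ D)%G; set w := (t ^+ D)%G; set s := ((-1) ^+ m)%G.
by set d := (n%:R ^+ D)%G; cring.
Qed.

Lemma indicial_large : exists N0, forall l n, (N0 < n)%N ->
  approx (2 / INR n ^ D) (fun k => (indicial l n k)^-1)%G /\
  forall k, Om k -> indicial l n k <> 0%G.
Proof.
(* For such n the norm of g is at most (2^D + 1) K / n <= 1/2. *)
have [N0 hN0] := INR_unbounded (2 * (2 ^ D + 1) * (K + 1)).
exists N0 => l n Nn.
have p1 : 1 <= 2 ^ D by apply: pow_R1_Rle; lra.
have nbig : 2 * (2 ^ D + 1) * (K + 1) <= INR n.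
  have : INR N0 <= INR n by apply: le_INR; apply/leP; exact: ltnW.
  lra.
have n0 : (0 < n)%N by exact: leq_ltn_trans Nn.
have n0' : 0 < INR n by apply: lt_0_INR; exact/ltP.
pose tau := K / INR n.
have tau0 : 0 <= tau by apply: Rmult_le_pos => //; apply/Rlt_le/Rinv_0_lt_compat.
have tn : tau * INR n = K by rewrite /tau; field; lra.
have tau2 : (2 ^ D + 1) * tau <= 1 / 2.
  apply: (Rmult_le_reg_r (INR n)) => //; nra.
have tau1 : tau <= 1 by nra.
have ht : approx tau (fun k => th l / n%:R * k)%G.
  have := approx_scale K0 OmK (th l / n%:R)%G (approx_id Om K).
  apply: approx_le; rewrite Cmod_mul Cmod_theta Cmod_inv_ C_natr Cmod_RtoC Rabs_pos_eq; last lra.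
  by rewrite /tau; apply: Req_le; field; lra.
have hg : approx (1 / 2)
    (fun k => 1 - (1 - th l / n%:R * k) ^+ D + (th l / n%:R * k) ^+ D)%G.
  have := approx_add K0 (approx_one_minus_pow K0 OmK D tau1 ht) (approx_exp K0 OmK D ht).
  apply: approx_le.
  have : tau ^ D <= tau.
    rewrite -(prednD m0) /=; have := pow_le1 D.-1 (conj tau0 tau1); nra.
  lra.
have g1 k : Om k -> (1 - (1 - (1 - th l / n%:R * k) ^+ D + (th l / n%:R * k) ^+ D))%G != 0%G.
  move=> hk; apply/eqP => e; have := approx_bound OmK hg hk.
  move/eqP: e; rewrite subr_eq0 => /eqP <-; rewrite Cmod_one; lra.
split; last first.
  move=> k hk; apply/eqP; rewrite indicial_factor //.
  by rewrite !mulf_neq0 ?sign_neq0 ?g1 // expf_neq0 // C_natr_neq0.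
have hf : approx 2 (fun k =>
    (1 - (1 - (1 - th l / n%:R * k) ^+ D + (th l / n%:R * k) ^+ D))^-1)%G.
  by apply: (approx_geometric K0 OmK hg) => x hx; rewrite mulVf // g1.
have := approx_scale K0 OmK ((-1) ^+ m * n%:R ^+ D)^-1%G hf.
have -> : Cmod ((-1) ^+ m * n%:R ^+ D)^-1%G * 2 = 2 / INR n ^ D.
  rewrite Cmod_inv_ Cmod_mul !Cmod_exp Cmod_N Cmod_one pow1 Rmult_1_l C_natr Cmod_RtoC.
  by rewrite Rabs_pos_eq /Rdiv; [ring | lra].
by apply: approx_ext => x _; rewrite indicial_factor // [RHS]invfM.
Qed.

(** As g <= D - 2, the kernel grows in j only like (j + 1)^(D-2). Against the bound u_j / (j + 1)^D
    for the coefficients this leaves the weight (j + 1)^(-2) of the scalar recursion. *)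
Lemma approx_kern (v : nat -> R) (l n j : nat) : (forall n, 0 <= v n) ->
  (forall g s n, (g < D.-1)%N -> (s < D - g)%N -> Cmod (coef p g s n) <= v n) ->
  approx (INR D * (INR D * ((1 + K) ^ D * v (n - j)%N) * ((1 + K) ^ D * INR j.+1 ^ (D - 2))))
    (fun k => kern l k n j).
Proof.
move=> v0 hv; have i0 := pos_INR D.
have K1 : 0 <= (1 + K) ^ D by apply: pow_le; lra.
have j1 : 1 <= INR j.+1 by rewrite S_INR; have := pos_INR j; lra.
set w := INR D * _ * _.
have hw g : (g < D.-1)%N -> approx w (fun k =>
    (\sum_(s < D - g) k ^+ s * coef p g s (n - j)%N) * (th l * k - j%:R) ^+ g)%G.
  move=> hg.
  have h1 : approx (\sum_(s < D - g) ((1 + K) ^ D * v (n - j)%N)%R)%G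
      (fun k => \sum_(s < D - g) k ^+ s * coef p g s (n - j)%N)%G.
    apply: (@approx_sum Om K K0 (D - g) (fun _ => (1 + K) ^ D * v (n - j)%N)
      (fun s k => k ^+ s * coef p g s (n - j)%N)%G) => s hs.
    have := approx_mul K0 OmK (approx_exp K0 OmK s (approx_id Om K))
      (approx_const Om K (coef p g s (n - j)%N)).
    apply: approx_le; apply: Rmult_le_compat; first exact: pow_le.
    - exact: Cmod_ge_0.
    - by apply: pow_le_1plus => //; apply: leq_trans (ltnW hs) (leq_subr _ _).
    - exact: hv.
  have := approx_mul K0 OmK h1 (approx_exp K0 OmK g (approx_shift l j)).
  apply: approx_le; apply: Rmult_le_compat.
  - by apply: (@Rsum_ge0 _ (fun _ => (1 + K) ^ D * v (n - j)%N)) => i _; exact: Rmult_le_pos.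
  - by apply: pow_le; apply: Rmult_le_pos; lra.
  - apply: Rle_trans (@Rsum_const (D - g) (fun _ => (1 + K) ^ D * v (n - j)%N) _
      (fun _ _ => Rle_refl _)) _.
    apply: Rmult_le_compat_r; first exact: Rmult_le_pos.
    by apply: le_INR; apply/leP; exact: leq_subr.
  - rewrite Rpow_mult_distr; apply: Rmult_le_compat; try by apply: pow_le; lra.
      by apply: Rle_pow; [lra | apply/leP; apply: leq_trans (ltnW hg) _; exact: leq_pred].
    by apply: Rle_pow => //; apply/leP; rewrite -ltnS double_pred.
have w0 : 0 <= w.
  by apply: Rmult_le_pos; apply: Rmult_le_pos => //; [exact: Rmult_le_pos | apply: pow_le; lra].
have := @approx_sum Om K K0 D.-1 (fun _ => w) _ hw.
apply: approx_le; apply: Rle_trans (@Rsum_const _ (fun _ => w) _ (fun _ _ => Rle_refl _)) _.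
by apply: Rmult_le_compat_r => //; apply: le_INR; apply/leP; exact: leq_pred.
Qed.

End OnDisc.

(** Here q is the product of all denominators with n <= N0, beyond which they are invertible on the
    disc. Each step with n <= N0 costs one factor q and later steps cost none, so q^N0 clears all
    coefficients at once; the recursion is linear and survives the scaling. The factor (n + 1)^(-D)
    later pays for D derivatives. *)
Lemma frobenius_family (r : R) : 0 < r ->
  exists (q : C -> C) (b : nat -> nat -> C -> C) (u : nat -> R),
  [/\ exists M, approximable (fun k => Cmod k <= r) (4 * r) M q,
      ex_series u /\ (forall n, 0 <= u n),
      forall l n, (l < D)%N ->
        approximable (fun k => and (Cmod k <= r) (q k <> 0%G)) (4 * r)
          (u n / INR n.+1 ^ D) (b l n),
      forall l k, (l < D)%N -> q k <> 0%G -> Cmod k <= r -> b l 0%N k <> 0%G /\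
        forall n, (0 < n)%N ->
          (indicial l n k * b l n k = - \sum_(j < n) kern l k n j * b l j k)%G
    & forall k, Cmod k <= r ->
        (forall l n, (l < D)%N -> (0 < n)%N -> indicial l n k <> 0%G) -> q k <> 0%G].
Proof.
move=> r0; pose K := 4 * r; have K0 : 0 <= K by rewrite /K; lra.
pose Disc (k : C) := Cmod k <= r.
have DiscK x : Disc x -> Cmod x <= K by rewrite /Disc /K; lra.
have [N0 hN0] := indicial_large K0 DiscK.
pose ql l k := (\prod_(n < N0) indicial l n.+1 k)%G.
pose q k := (\prod_(l < D) ql l k)%G.
pose Om (k : C) := Cmod k <= r /\ q k <> 0%G.
have OmK x : Om x -> Cmod x <= K by case=> /DiscK.
have OmDisc x : Om x -> Disc x by case.
have hql l : exists M, approximable Disc K M (ql l).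
  apply: (approx_prod K0 DiscK (n := N0) (f := fun n => indicial l n.+1)) => n _.
  exact: approx_indicial.
have [Mq0 hq0] : exists M, approximable Disc K M q.
  by apply: (approx_prod K0 DiscK (n := D) (f := ql)) => l _; exact: hql.
have hqOm : approximable Om K (Rmax 1 Mq0) q.
  by apply: approx_le (approx_sub OmDisc hq0); exact: Rmax_r.
set Mq := Rmax 1 Mq0 in hqOm; have Mq1 : 1 <= Mq by exact: Rmax_l.
pose MN := Mq ^ N0; have MN1 : 1 <= MN by apply: pow_R1_Rle.
have hqpow d : (d <= N0)%N -> approximable Om K MN (fun k => q k ^+ d)%G.
  move=> dN; apply: approx_le (approx_exp K0 OmK d hqOm).
  by apply: Rle_pow => //; exact/leP.
have ql_neq0 l k : (l < D)%N -> Om k -> ql l k <> 0%G.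
  move=> hl [_ /eqP]; rewrite /q prodf_seq_neq0 => /allP h.
  apply/eqP; exact: (h (Ordinal hl) (mem_index_enum _)).
have ind_neq0 l n k : (l < D)%N -> (n < N0)%N -> Om k -> indicial l n.+1 k <> 0%G.
  move=> hl hn /(ql_neq0 l k hl) /eqP; rewrite /ql prodf_seq_neq0 => /allP h.
  apply/eqP; exact: (h (Ordinal hn) (mem_index_enum _)).
have ind_neq0' l n k : (l < D)%N -> (0 < n)%N -> Om k -> indicial l n k <> 0%G.
  move=> hl n0 hk; case: (leqP n N0) => nN.
    by rewrite -(prednK n0); apply: ind_neq0 => //; rewrite prednK.
  by case: (hN0 l n nN) => _; apply; case: hk.
have [G G1 hG] : exists2 G, 1 <= G & forall l n, (l < D)%N -> (n < N0)%N ->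
    approximable Om K G (fun k => q k / indicial l n.+1 k)%G.
  have [||G G1 hG] := @uniform_bound (fun l G => forall n, (n < N0)%N ->
      approximable Om K G (fun k => q k / indicial l n.+1 k)%G) D.
  - by move=> l G G' le h n hn; apply: approx_le le _; exact: h.
  - move=> l hl.
    have [||G _ hG] := @uniform_bound (fun n G =>
      approximable Om K G (fun k => q k / indicial l n.+1 k)%G) N0; last by exists G.
    + by move=> n G G' le; exact: approx_le.
    + move=> n hn.
      have [||M1 h1] := @approx_prod_div Om K K0 OmK D l ql _ hl.
      * by move=> j _; have [M hM] := hql j; exists M; exact: approx_sub hM.
      * by move=> x; exact: ql_neq0.
      have [||M2 h2] := @approx_prod_div Om K K0 OmK N0 n (fun n => indicial l n.+1) _ hn.
      * by move=> j _; exact: approx_indicial.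
      * by move=> x; exact: ind_neq0.
      exists (M1 * M2); apply: approx_ext (approx_mul K0 OmK h1 h2) => x hx.
      by rewrite mulrA divfK //; apply/eqP; exact: ql_neq0.
  by exists G => // l n hl hn; exact: hG.
have [v [hv v0 hcv]] := coef_bound m0 hp.
have hc g s n : (g < D.-1)%N -> (s < D - g)%N -> Cmod (coef p g s n) <= v n.
  by move=> hg hs; apply: coef_le => //; exact: hcv.
(* The first summand serves the finitely many n <= N0, the second n > N0, where n + 1 <= 2 n. *)
pose GG := G * INR N0.+2 ^ D + 2 * 2 ^ D.
(* The power of q that clears the n-th coefficient. *)
pose e n := minn n N0.
pose lead l n k := (if (n <= N0)%N then q k / indicial l n k else (indicial l n k)^-1)%G.
have S0 n : 0 < INR n.+1 ^ D by apply: pow_lt; apply: lt_0_INR; apply/ltP.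
have hlead l n : (l < D)%N -> (0 < n)%N -> approximable Om K (GG / INR n.+1 ^ D) (lead l n).
  move=> hl n0; rewrite /lead; case: leqP => nN.
    have := hG l n.-1 hl; rewrite prednK // => /(_ nN); apply: approx_le.
    apply: (Rmult_le_reg_r (INR n.+1 ^ D)) => //.
    have -> : GG / INR n.+1 ^ D * INR n.+1 ^ D = GG by field; have := S0 n; lra.
    have h1 : INR n.+1 ^ D <= INR N0.+2 ^ D.
      by apply: pow_incr; split; [exact: pos_INR | apply: le_INR; apply/leP; exact: leqW].
    have h2 : 0 < 2 ^ D by apply: pow_lt; lra.
    by rewrite /GG; have := S0 n; nra.
  have [h _] := hN0 l n nN; apply: approx_le (approx_sub OmDisc h).
  have n0' : 1 <= INR n by apply: (le_INR 1); apply/leP.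
  have np : 0 < INR n ^ D by apply: pow_lt; lra.
  have h1 : INR n.+1 ^ D <= 2 ^ D * INR n ^ D.
    by rewrite -Rpow_mult_distr; apply: pow_incr; rewrite S_INR; lra.
  have g0 : 0 <= G * INR N0.+2 ^ D by apply: Rmult_le_pos; [lra | exact/Rlt_le/S0].
  apply: (Rmult_le_reg_r (INR n.+1 ^ D)) => //.
  have -> : GG / INR n.+1 ^ D * INR n.+1 ^ D = GG by field; have := S0 n; lra.
  apply: (Rmult_le_reg_r (INR n ^ D)) => //.
  have -> : 2 / INR n ^ D * INR n.+1 ^ D * INR n ^ D = 2 * INR n.+1 ^ D by field; lra.
  by rewrite /GG; nra.
pose Kc := INR D * (INR D * (1 + K) ^ D * (1 + K) ^ D).
have Kc0 : 0 <= Kc.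
  have i0 := pos_INR D; have k0 : 0 <= (1 + K) ^ D by apply: pow_le; lra.
  by do 3?apply: Rmult_le_pos.
have GG0 : 0 <= GG.
  have h2 : 0 < 2 ^ D by apply: pow_lt; lra.
  by rewrite /GG; have := S0 N0.+1; nra.
pose H := GG * MN * Kc.
have H0 : 0 <= H by rewrite /H; do 2?apply: Rmult_le_pos => //; lra.
pose ustep n (h : nat -> R) : R := if n is 0%N then 1 else
  H * (\sum_(j < n) v (n - j)%N * (h j / INR j.+1 ^ 2)%R)%G.
pose u := course_of_values 0 ustep.
have uE n : (0 < n)%N -> u n = H * (\sum_(j < n) v (n - j)%N * (u j / INR j.+1 ^ 2)%R)%G.
  case: n => // n _; apply: course_of_valuesE => h h' eh.
  by congr (_ * _); apply: eq_bigr => j _; rewrite eh.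
have sq0 j : 0 < INR j.+1 ^ 2 by apply: pow_lt; apply: lt_0_INR; apply/ltP.
have u0 n : 0 <= u n.
  elim/ltn_ind: n => n IH; have [->|n0] := posnP n; first exact: Rle_0_1.
  rewrite uE //; apply: Rmult_le_pos => //.
  apply: (@Rsum_ge0 n (fun j => v (n - j)%N * (u j / INR j.+1 ^ 2))) => j hj.
  apply: Rmult_le_pos => //; apply: Rmult_le_pos; first exact: IH.
  exact/Rlt_le/Rinv_0_lt_compat.
have su : ex_series u by exact: convolution_recursion_summable H0 v0 hv u0 uE.
have main l n : (l < D)%N ->
    approximable Om K (u n / INR n.+1 ^ D) (fun k => q k ^+ e n * frob l k n)%G.
  move=> hl; elim/ltn_ind: n => n IH; have [->|n0] := posnP n.
    have -> : u 0%N / INR 1 ^ D = Cmod 1%G.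
      by rewrite Cmod_one [u 0%N]/= /Rdiv [INR 1]/= pow1 Rinv_1 Rmult_1_l.
    apply: approx_ext (approx_const Om K 1%G) => x _.
    by rewrite /e min0n expr0 mul1r.
  (* The power of q left over once the factor q of [lead] (for n <= N0) and the power belonging to
     the j-th coefficient are taken out. *)
  pose d j := (if (n <= N0)%N then n.-1 - j else N0 - e j)%N.
  have hd j : (d j <= N0)%N.
    rewrite /d; case: (leqP n N0) => nN; last exact: leq_subr.
    by apply: leq_trans (leq_subr _ _) _; apply: leq_trans (leq_pred _) nN.
  have jbound j : (j < n)%N -> approximable Om K (Kc * MN * (v (n - j)%N * (u j / INR j.+1 ^ 2)))
      (fun k => - kern l k n j * q k ^+ d j * (q k ^+ e j * frob l k j))%G.
    move=> hj.
    have := approx_mul K0 OmK (approx_mul K0 OmK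
      (approx_opp K0 OmK (approx_kern K0 OmK l n j v0 hc)) (hqpow _ (hd j))) (IH j hj).
    apply: approx_le; apply: Req_le; rewrite -/K.
    have -> : INR j.+1 ^ D = INR j.+1 ^ (D - 2) * INR j.+1 ^ 2.
      rewrite -Rdef_pow_add plusE subnK //.
      by case: (m) m0 => // m' _; rewrite mulnS.
    have j0 : 0 < INR j.+1 by apply: lt_0_INR; apply/ltP.
    have j2 : 0 < INR j.+1 ^ (D - 2) by exact: pow_lt.
    move: (INR j.+1) j0 j2 => t j0 j2; rewrite /Kc; field.
    by split; lra.
  have hs := @approx_sum Om K K0 n _ _ jbound.
  have := approx_mul K0 OmK (hlead l n hl n0) hs.
  have -> : GG / INR n.+1 ^ D *
      (\sum_(j < n) (Kc * MN * (v (n - j)%N * (u j / INR j.+1 ^ 2)))%R)%G = u n / INR n.+1 ^ D.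
    rewrite uE //.
    rewrite -(@Rsum_scale n (Kc * MN) (fun j => v (n - j)%N * (u j / INR j.+1 ^ 2)) _
      (fun j _ => erefl)).
    set S := (\sum_(j < n) _)%G.
    by rewrite /H; field; have := S0 n; lra.
  apply: approx_ext => k hk; rewrite frobE // mulr_sumr.
  have i0 : indicial l n k != 0%G by apply/eqP; exact: ind_neq0'.
  rewrite !mulr_sumr; apply: eq_bigr => j _; rewrite /lead /d /e.
  case: (leqP n N0) => nN.
    have jn : (j <= n.-1)%N by rewrite -ltnS prednK.
    have -> : minn j N0 = j by apply/minn_idPl; apply: leq_trans (ltnW (ltn_ord j)) nN.
    have -> : (q k ^+ n = q k * (q k ^+ (n.-1 - j) * q k ^+ j))%G.
      by rewrite -exprD subnK // -exprS prednK.
    set a := (q k ^+ (n.-1 - j))%G; set c := (q k ^+ j)%G; set i := (indicial l n k)^-1%G.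
    by cring.
  have -> : (q k ^+ N0 = q k ^+ (N0 - minn j N0) * q k ^+ minn j N0)%G.
    by rewrite -exprD subnK // geq_minr.
  set a := (q k ^+ (N0 - _))%G; set c := (q k ^+ minn j N0)%G; set i := (indicial l n k)^-1%G.
  by cring.
exists q, (fun l n k => q k ^+ N0 * frob l k n)%G, (fun n => MN * u n); split.
- by exists Mq0.
- split; first exact: ex_series_scal_l su.
  by move=> n; apply: Rmult_le_pos => //; lra.
- move=> l n hl.
  have := approx_mul K0 OmK (hqpow (N0 - e n)%N (leq_subr _ _)) (main l n hl).
  have -> : MN * (u n / INR n.+1 ^ D) = MN * u n / INR n.+1 ^ D by rewrite /Rdiv; ring.
  apply: approx_ext => k _; rewrite mulrA -exprD subnK //; exact: geq_minr.
- move=> l k hl qk rk; split.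
    by rewrite frob0 mulr1; apply/eqP; rewrite expf_neq0 //; exact/eqP.
  move=> n n0; have i0 : indicial l n k != 0%G by apply/eqP; apply: ind_neq0'.
  rewrite (frobE l k n0) mulNr !mulrN; congr (- _)%G.
  rewrite mulrCA (mulrA (indicial l n k)) mulfV // mul1r mulr_sumr.
  by apply: eq_bigr => j _; rewrite mulrCA.
- move=> k rk h; apply/eqP; rewrite /q prodf_seq_neq0; apply/allP => l _ /=.
  rewrite /ql prodf_seq_neq0; apply/allP => n _ /=.
  by apply/eqP; exact: h.
Qed.

End Frobenius.

(** * Jost solutions *)

Lemma argmax_below (F : nat -> R) (n : nat) : (0 < n)%N ->
  exists2 j, (j < n)%N & forall i, (i < n)%N -> F i <= F j.
Proof.
elim: n => [//|[|n] IH] _.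
  by exists 0%N => // i; rewrite ltnS leqn0 => /eqP->; exact: Rle_refl.
have [j hj hF] := IH isT.
case: (Rle_lt_dec (F n.+1) (F j)) => h.
  exists j; first exact: ltnW.
  by move=> i; rewrite ltnS leq_eqVlt => /orP[/eqP->//|]; exact: hF.
exists n.+1 => // i; rewrite ltnS leq_eqVlt => /orP[/eqP->|hi]; first exact: Rle_refl.
by have := hF i hi; lra.
Qed.

Lemma exp_neg_small (eps : R) : 0 < eps -> exists2 X, 0 <= X &
  forall x, X <= x -> exp (- x) <= eps.
Proof.
move=> e0; exists (Rmax 0 (- ln eps)); first exact: Rmax_l.
move=> x hx; have h := Rle_trans _ _ _ (Rmax_r _ _) hx.
rewrite -[X in _ <= X](exp_ln eps) //.
case: (Req_dec (- x) (ln eps)) => [->|ne]; first exact: Rle_refl.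
by apply/Rlt_le/exp_increasing; lra.
Qed.

Lemma Cmod_mul_le0 (beta : R) (z : C) : 0 < beta -> beta * Cmod z <= 0 -> z = 0%G.
Proof. by move=> b0 h; apply: Cmod_eq0; have := Cmod_ge_0 z; nra. Qed.

Section Jost.
Variables (m : nat) (p : nat -> nat -> nat -> C) (nu : nat).
Hypotheses (m0 : (0 < m)%N) (hp : summable_coef m p).
Local Notation D := (2 * m)%N.
Local Notation th := (theta m nu).

Section FixedK.
Variables (k : C) (b : nat -> nat -> C) (w : nat -> R).
Hypotheses (k0 : k != 0%G) (hw : ex_series w)
  (hb : forall l n, (l < D)%N -> Cmod (b l n) <= w n / INR n.+1 ^ D)
  (b0 : forall l, (l < D)%N -> b l 0%N <> 0%G)
  (rec : forall l n, (l < D)%N -> (0 < n)%N ->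
     (indicial m nu l n k * b l n = - \sum_(j < n) kern m p nu l k n j * b l j)%G).

Local Notation mu := (fun l => th l * k)%G.

(** The factor by which the i-th derivative acts on exp((mu - n) x); [jost] takes out exp(mu x),
    leaving a series in exp(-x). *)
Definition jost_coef (l i n : nat) : C := ((mu l - n%:R) ^+ i * b l n)%G.

Definition jost (l i : nat) (x : R) : C :=
  (Cexp (mu l * RtoC x) * expser (jost_coef l i) x)%G.

Let L : R := (1 + Cmod k) ^ D.

Let Cmod_shift (l n : nat) : Cmod (mu l - n%:R)%G <= (1 + Cmod k) * INR n.+1.
Proof.
apply: Rle_trans (Cmod_sub_le (Req_le _ _ (Cmod_mu _ _ _ _)) (Rle_refl _)) _.
rewrite C_natr Cmod_RtoC Rabs_pos_eq; last exact: pos_INR.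
by rewrite S_INR; have := pos_INR n; have := Cmod_ge_0 k; nra.
Qed.

(** The weight (n + 1)^(-D) on the coefficients absorbs the growth of up to D derivatives. *)
Let b_le (l i n : nat) : (l < D)%N -> (i <= D)%N ->
  ((1 + Cmod k) * INR n.+1) ^ i * Cmod (b l n) <= L * w n.
Proof.
move=> hl hi.
have n1 : 1 <= INR n.+1 by rewrite S_INR; have := pos_INR n; lra.
have k1 : 1 <= 1 + Cmod k by have := Cmod_ge_0 k; lra.
have hk : 1 <= (1 + Cmod k) * INR n.+1 by nra.
have N0 : 0 < INR n.+1 ^ D by apply: pow_lt; lra.
apply: Rle_trans (_ : ((1 + Cmod k) * INR n.+1) ^ D * (w n / INR n.+1 ^ D) <= _).
  apply: Rmult_le_compat; [|exact: Cmod_ge_0| |exact: hb].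
    by apply: pow_le; lra.
  by apply: Rle_pow => //; exact/leP.
by rewrite Rpow_mult_distr /L; apply: Req_le; field; lra.
Qed.

Lemma jost_coef_le (l i n : nat) : (l < D)%N -> (i <= D)%N ->
  Cmod (jost_coef l i n) <= L * w n.
Proof.
move=> hl hi; apply: Rle_trans (b_le n hl hi).
rewrite /jost_coef Cmod_mul Cmod_exp; apply: Rmult_le_compat_r; first exact: Cmod_ge_0.
by apply: pow_incr; split; [exact: Cmod_ge_0 | exact: Cmod_shift].
Qed.

Lemma jost_coef_derivative_le (l i n : nat) : (l < D)%N -> (i < D)%N ->
  Cmod (n%:R * jost_coef l i n)%G <= L * w n.
Proof.
move=> hl hi; apply: Rle_trans (b_le n hl hi).
rewrite /jost_coef !Cmod_mul Cmod_exp -Rmult_assoc; apply: Rmult_le_compat_r; first exact: Cmod_ge_0.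
rewrite Cmod_natr -tech_pow_Rmult; apply: Rmult_le_compat.
- exact: pos_INR.
- by apply: pow_le; exact: Cmod_ge_0.
- by rewrite S_INR; have := pos_INR n; have := Cmod_ge_0 k; nra.
- by apply: pow_incr; split; [exact: Cmod_ge_0 | exact: Cmod_shift].
Qed.

Let hLw : ex_series (fun n => L * w n). Proof. exact: ex_series_scal_l hw. Qed.

Let jost_summable (l i : nat) : (l < D)%N -> (i <= D)%N -> summable (jost_coef l i).
Proof. by move=> hl hi; apply: (summable_le _ hLw) => n; exact: jost_coef_le. Qed.

Let jost_derivative_summable (l i : nat) : (l < D)%N -> (i < D)%N ->
  summable (fun n => n%:R * jost_coef l i n)%G.
Proof. by move=> hl hi; apply: (summable_le _ hLw) => n; exact: jost_coef_derivative_le. Qed.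

Let jost_derivable (l i : nat) (x : R) : (l < D)%N -> (i < D)%N -> 0 < x ->
  derivableC (jost l i) x (jost l i.+1 x).
Proof.
move=> hl hi x0; have x0' := Rlt_le _ _ x0; have hz := exp_neg_bounds x0'.
have s1 := jost_summable hl (ltnW hi); have s2 := jost_derivative_summable hl hi.
have := derivableC_mul (derivableC_Cexp (mu l) x) (expser_derivable s1 x0).
congr derivableC; rewrite /jost !expserE //.
have -> : eser (jost_coef l i.+1) (exp (- x)) =
   (mu l * eser (jost_coef l i) (exp (- x)) +
    eser (fun n => - (n%:R) * jost_coef l i n)%G (exp (- x)))%G.
  have s3 : summable (fun n => - (n%:R) * jost_coef l i n)%G.
    have := summable_scale (-1)%G s2; congr summable; apply: funext => n.
    by rewrite mulN1r mulNr.
  rewrite -eser_scale // -eser_add //; last exact: summable_scale.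
  by apply: eser_ext => n; rewrite /jost_coef exprS -mulrA -mulrDl.
set A := Cexp _; set B := eser (jost_coef l i) _; set E := eser _ _.
by cring.
Qed.

Let jost_continuous (l i : nat) (x : R) : (l < D)%N -> (i < D)%N -> 0 <= x ->
  continuousC (jost l i) x.
Proof.
move=> hl hi x0; apply: continuousC_mul.
  exact: derivableC_continuous (derivableC_Cexp (mu l) x).
by apply: expser_continuous => //; [exact: jost_summable (ltnW hi) | exact: jost_derivative_summable].
Qed.

Definition potential_coef (g n : nat) : C := (\sum_(s < D - g) k ^+ s * coef p g s n)%G.

Let coef_summable (g s : nat) : (g < D.-1)%N -> (s < D - g)%N -> summable (coef p g s).
Proof.
move=> hg hs; have [v [hv v0 hc]] := coef_bound m0 hp.
by apply: (summable_le _ hv) => n; apply: coef_le => //; exact: hc.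
Qed.

Let potential_eser (g : nat) (x : R) : (g < D.-1)%N -> 0 <= x ->
  potential m p g x k = eser (potential_coef g) (exp (- x)).
Proof.
move=> hg x0; have hz := exp_neg_bounds x0; rewrite potential_expser // /potential_coef.
rewrite (@eser_sum (D - g) (fun s n => k ^+ s * coef p g s n)%G) //; last first.
  by move=> s hs; apply: summable_scale; exact: coef_summable.
apply: eq_bigr => s _; rewrite expserE // eser_scale //.
exact: coef_summable.
Qed.

Let potential_summable (g : nat) : (g < D.-1)%N -> summable (potential_coef g).
Proof.
move=> hg; apply: (@summable_sum (D - g) (fun s n => k ^+ s * coef p g s n)%G) => s hs.
by apply: summable_scale; exact: coef_summable.
Qed.

Lemma jost_solution (l : nat) : (l < D)%N -> pencil_solution m p k (jost l).
Proof.
move=> hl; split.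
  by split=> i x; rewrite -ltnS prednD // => hi x0; [exact: jost_continuous | exact: jost_derivable].
move=> x x0; have x0' := Rlt_le _ _ x0; have hz := exp_neg_bounds x0'.
rewrite pencil_exprE // /jost !expserE //; set z := exp (- x) in hz *; set E := Cexp _.
have gD g : (g < D.-1)%N -> (g <= D)%N.
  by move=> hg; apply: leq_trans (ltnW hg) _; exact: leq_pred.
have -> : (\sum_(g < D.-1) potential m p g x k * (E * expser (jost_coef l g) x) =
   E * \sum_(g < D.-1) eser (convol (jost_coef l g) (potential_coef g)) z)%G.
  rewrite mulr_sumr; apply: eq_bigr => g _.
  rewrite potential_eser // expserE // -/z -eser_mul //.
  - by rewrite mulrCA [(_ * eser (jost_coef l g) z)%G]mulrC.
  - by apply: jost_summable => //; exact: gD.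
  - exact: potential_summable.
have sc g : (g < D.-1)%N -> summable (convol (jost_coef l g) (potential_coef g)).
  move=> hg; apply: summable_convol; last exact: potential_summable.
  by apply: jost_summable => //; exact: gD.
rewrite -(@eser_sum D.-1 (fun g => convol (jost_coef l g) (potential_coef g))) //.
have sD := jost_summable hl (leqnn D); have s0 := jost_summable hl (leq0n D).
set S := (fun n => \sum_(g < D.-1) _)%G.
have sS : summable S.
  exact: (@summable_sum D.-1 (fun g => convol (jost_coef l g) (potential_coef g)) sc).
(* The coefficient of exp((mu - n) x) in l(y): for n >= 1 it vanishes by the recursion, for n = 0
   because mu^D = (-1)^m k^D. *)
have total : (eser (fun n => (-1) ^+ m * jost_coef l D n + S n + - k ^+ D * jost_coef l 0 n)%G z
    = 0)%G.
  transitivity (eser (fun _ => 0%G) z); last first.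
    by apply: eser_eq; apply: is_seriesC_ext is_seriesC_zero => n; rewrite mul0r.
  apply: eser_ext => n; rewrite /S /convol.
  have -> : (\sum_(g < D.-1) \sum_(j < n.+1) jost_coef l g j * potential_coef g (n - j)%N =
      \sum_(j < n) kern m p nu l k n j * b l j)%G.
    (* The diagonal term j = n drops out because the potentials have no constant term. *)
    rewrite exchange_big big_ord_recr /= [X in (_ + X)%G]big1 ?addr0; last first.
      by move=> g _; rewrite subnn /potential_coef big1 ?mulr0 // => s _; rewrite mulr0.
    apply: eq_bigr => j _; rewrite /kern mulr_suml; apply: eq_bigr => g _.
    rewrite /jost_coef /potential_coef.
    set A := (\sum_(s < D - g) _)%G; set B := ((_ - _) ^+ g)%G.
    by cring.
  have -> : ((-1) ^+ m * jost_coef l D n = (indicial m nu l n k + k ^+ D) * b l n)%G.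
    by rewrite /indicial subrK /jost_coef mulrA.
  have -> : (- k ^+ D * jost_coef l 0 n = - (k ^+ D * b l n))%G.
    by rewrite /jost_coef expr0 mul1r mulNr.
  transitivity (indicial m nu l n k * b l n + \sum_(j < n) kern m p nu l k n j * b l j)%G.
    set A := indicial _ _ _ _ _; set B := (\sum_(j < n) _)%G; set q := (k ^+ D)%G.
    by cring.
  case: n => [|n]; last by rewrite rec // addNr.
  rewrite big_ord0 addr0 /indicial subr0 (mu_exp _ m0) mulrA sign_sqr mul1r subrr.
  by rewrite mul0r.
have e : eser (fun n => (-1) ^+ m * jost_coef l D n + S n + - k ^+ D * jost_coef l 0 n)%G z =
   ((-1) ^+ m * eser (jost_coef l D) z + eser S z - k ^+ D * eser (jost_coef l 0) z)%G.
  have t1 := summable_scale ((-1) ^+ m)%G sD; have t2 := summable_scale (- k ^+ D)%G s0.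
  rewrite (eser_add (summable_add t1 sS) t2 hz) (eser_add t1 sS hz).
  by rewrite (eser_scale _ sD hz) (eser_scale _ s0 hz) mulNr.
have -> : ((-1) ^+ m * (E * eser (jost_coef l D) z) + E * eser S z -
   k ^+ D * (E * eser (jost_coef l 0) z) = E * ((-1) ^+ m * eser (jost_coef l D) z +
   eser S z - k ^+ D * eser (jost_coef l 0) z))%G.
  by rewrite mulrBr mulrDr; congr (_ + _ - _)%G; rewrite mulrCA.
by rewrite -e total mulr0.
Qed.

Lemma jost_bound (l i : nat) (x : R) : (l < D)%N -> (i <= D)%N -> 0 <= x ->
  Cmod (jost l i x) <= exp (Re (mu l) * x) * (2 * Series (fun n => L * w n)).
Proof.
move=> hl hi x0; rewrite /jost; apply: Cmod_mul_le.
  rewrite Cmod_Cexp Re_mul; apply: Req_le; congr exp; rewrite /Re /Im /=; ring.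
rewrite expserE //; apply: eser_bound => //; last exact: exp_neg_bounds.
by move=> n; exact: jost_coef_le.
Qed.

Let V0 : 0 <= 2 * Series (fun n => L * w n).
Proof.
apply: Rle_trans (Cmod_ge_0 (eser (jost_coef 0 0) 1)) _.
apply: eser_bound => //; last lra.
by move=> n; apply: jost_coef_le => //; exact: D_gt0.
Qed.

Lemma jost_asymptotic (l i : nat) (x : R) : (l < D)%N -> (i <= D)%N -> 0 <= x ->
  Cmod (expser (jost_coef l i) x - mu l ^+ i * b l 0%N)%G
    <= 2 * Series (fun n => L * w n) * exp (- x).
Proof.
move=> hl hi x0; have hz := exp_neg_bounds x0.
have -> : (mu l ^+ i * b l 0%N = jost_coef l i 0)%G by rewrite /jost_coef subr0.
rewrite expserE //; apply: Rle_trans (eser_sub_const (jost_summable hl hi) hz) _.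
apply: Rmult_le_compat_r; first by case: hz.
apply: Rmult_le_compat_l; first lra.
rewrite (Series_incr_1 (fun n => L * w n)) //.
have h0 : 0 <= L * w 0%N by apply: Rle_trans (Cmod_ge_0 _) (jost_coef_le 0 hl hi).
have h : Series (fun n => Cmod (jost_coef l i n.+1)) <= Series (fun n => L * w n.+1).
  apply: Series_le; last by apply/(ex_series_incr_1 (fun n => L * w n)).
  by move=> n; split; [exact: Cmod_ge_0 | exact: jost_coef_le].
lra.
Qed.

(** The modes of the l-th Jost solution with exp(mu_l x) divided out. *)
Definition jost_matrix (x : R) (l j : nat) : C :=
  ((D%:R)^-1 * \sum_(i < D) (mu j ^- i * expser (jost_coef l i) x))%G.

Lemma modal_jost (l j : nat) (x : R) :
  modal m nu k (jost l) j x = (jost_matrix x l j * Cexp (mu l * RtoC x))%G.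
Proof.
rewrite /modal /jost_matrix -mulrA mulr_suml; congr (_ * _)%G.
by apply: eq_bigr => i _; rewrite /jost mulrCA [LHS]mulrC.
Qed.

(** At infinity the i-th derivative of the l-th solution behaves like mu_l^i b_l0 exp(mu_l x), and
    orthogonality of the modes makes the limit diagonal. *)
Lemma jost_matrix_limit : exists2 B, 0 <= B & forall l j x, (l < D)%N -> (j < D)%N -> 0 <= x ->
  Cmod (jost_matrix x l j - (if l == j then b l 0%N else 0))%G <= B * exp (- x).
Proof.
have ck : 0 < Cmod k by apply: Cmod_gt0; exact/eqP.
have ik : 0 < / Cmod k by exact: Rinv_0_lt_compat.
pose P := (1 + / Cmod k) ^ D.
have P0 : 0 <= P by apply: pow_le; lra.
exists (P * (2 * Series (fun n => L * w n))); first exact: Rmult_le_pos.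
move=> l j x hl hj x0.
have Dn := C_natr_neq0 (D_gt0 m0).
have -> : (if l == j then b l 0%N else 0)%G =
   ((D%:R)^-1 * \sum_(i < D) (mu j ^- i * (mu l ^+ i * b l 0%N)))%G.
  under eq_bigr do rewrite mulrA.
  rewrite -mulr_suml (@sum_ratio_pow D _ (fun l => th l * k)%G j l
     (c_neq0 m k0) (fun i _ => mu_exp nu m0 k i) _ hj hl); last exact: mu_inj.
  by rewrite eq_sym; case: eqP => _; rewrite ?mulr0n ?mul0r ?mulr0 // mulr1n mulKf.
rewrite /jost_matrix -mulrBr -sumrB.
under eq_bigr do rewrite -mulrBr.
rewrite Cmod_mul Cmod_inv_ C_natr Cmod_RtoC Rabs_pos_eq; last exact: pos_INR.
rewrite Rmult_assoc.
set W := 2 * _ * exp (- x).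
have W0 : 0 <= W by apply: Rmult_le_pos => //; exact/Rlt_le/exp_pos.
apply: Rle_trans (Rmult_le_compat_l _ _ _ _ (@Cmod_sum D (fun i => mu j ^- i *
   (expser (jost_coef l i) x - mu l ^+ i * b l 0%N))%G (P * W) _)) _.
- by apply/Rlt_le/Rinv_0_lt_compat; apply: lt_0_INR; apply/ltP; exact: D_gt0.
- move=> i hi; apply: Cmod_mul_le; last by apply: jost_asymptotic => //; exact: ltnW.
  rewrite Cmod_inv_ Cmod_exp Cmod_mu -pow_inv.
  by apply: pow_le_1plus; [exact: Rlt_le | exact: ltnW].
apply: div_sum_le => //; first exact: D_gt0.
exact: Rmult_le_pos.
Qed.

(* Near infinity the matrix is diagonally dominant. *)
Lemma jost_matrix_lower_bound : exists X beta : R, [/\ 0 <= X, 0 < beta &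
  forall x (c : nat -> C) zeta, X <= x ->
    (forall j, (j < D)%N -> Cmod (\sum_(l < D) jost_matrix x l j * c l)%G <= zeta) ->
    forall l, (l < D)%N -> beta * Cmod (c l) <= zeta].
Proof.
have [B B0 hB] := jost_matrix_limit.
have i0 : 0 < INR D by apply: lt_0_INR; apply/ltP; exact: D_gt0.
have [j0 hj0 hmin] := argmax_below (fun l => - Cmod (b l 0%N)) (D_gt0 m0).
(* Half of the smallest diagonal entry of the limit; the other half pays for the deviation from
   it. *)
pose beta := Cmod (b j0 0%N) / 2.
have bet0 : 0 < beta by have := Cmod_gt0 (b0 hj0); rewrite /beta; lra.
have e0 : 0 < beta / (INR D * (B + 1)).
  by apply: Rdiv_lt_0_compat => //; apply: Rmult_lt_0_compat; lra.
have [X X0 hX] := exp_neg_small e0.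
exists X, beta; split=> // x c zeta hx hz l hl.
have x0 := Rle_trans _ _ _ X0 hx.
(* Only the equation of the largest coefficient is used: there the diagonal term dominates the
   deviation. *)
have [j hj hmax] := argmax_below (fun l => Cmod (c l)) (D_gt0 m0).
apply: Rle_trans (Rmult_le_compat_l _ _ _ (Rlt_le _ _ bet0) (hmax l hl)) _.
apply: Rle_trans (hz j hj).
pose F i := ((jost_matrix x i j - (if i == j then b i 0%N else 0)) * c i)%G.
have err : Cmod (\sum_(i < D) F i)%G <= INR D * (B * exp (- x) * Cmod (c j)).
  by apply: Cmod_sum => i hi; apply: Cmod_mul_le; [exact: hB | exact: hmax].
have e : (\sum_(i < D) F i = \sum_(i < D) jost_matrix x i j * c i - b j 0%N * c j)%G.
  rewrite /F; under eq_bigr do rewrite mulrBl.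
  rewrite sumrB; congr (_ - _)%G.
  rewrite (bigD1 (Ordinal hj)) //= eqxx big1 ?addr0 // => i.
  by rewrite -val_eqE /= => /negbTE ->; rewrite mul0r.
rewrite e in err.
have bj : 2 * beta <= Cmod (b j 0%N) by have := hmin j hj; rewrite /beta; lra.
have he := hX x hx.
have cj := Cmod_ge_0 (c j).
have err2 : INR D * (B * exp (- x) * Cmod (c j)) <= beta * Cmod (c j).
  have -> : INR D * (B * exp (- x) * Cmod (c j)) = (INR D * B * exp (- x)) * Cmod (c j) by ring.
  apply: Rmult_le_compat_r => //.
  have ee : INR D * (B + 1) * (beta / (INR D * (B + 1))) = beta by field; lra.
  have h := Rmult_le_compat_l _ _ _ (Rlt_le _ _ (Rmult_lt_0_compat _ _ i0
    (ltac:(lra) : 0 < B + 1))) he.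
  have := Rmult_le_pos _ _ (Rlt_le _ _ i0) (Rlt_le _ _ (exp_pos (- x))).
  by rewrite ee in h; nra.
have big : 2 * beta * Cmod (c j) <= Cmod (b j 0%N * c j)%G.
  by rewrite Cmod_mul; exact: Rmult_le_compat_r.
set S := (\sum_(i < D) jost_matrix x i j * c i)%G in err *.
have tri : Cmod (b j 0%N * c j)%G <= Cmod S + Cmod (S - b j 0%N * c j)%G.
  have {1}-> : (b j 0%N * c j = S - (S - b j 0%N * c j))%G by rewrite opprB addrC subrK.
  exact: Cmod_sub.
move: big tri err; set u := Cmod (b j 0%N * c j)%G; set t := Cmod (S - _)%G.
move=> big tri err; have := Rle_trans _ _ _ err err2; lra.
Qed.

Lemma modal_sum (N : nat) (c : nat -> C) (Y : nat -> nat -> R -> C) (j : nat) (x : R) :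
  modal m nu k (fun i x => \sum_(l < N) c l * Y l i x)%G j x =
  (\sum_(l < N) c l * modal m nu k (Y l) j x)%G.
Proof.
rewrite /modal; under [in LHS]eq_bigr do rewrite mulr_sumr.
rewrite exchange_big mulr_sumr; apply: eq_bigr => l _ /=.
rewrite mulrCA; congr (_ * _)%G; rewrite mulr_sumr; apply: eq_bigr => i _.
by rewrite mulrCA.
Qed.

Let modal_jost_sum (c : nat -> C) (j : nat) (x : R) :
  modal m nu k (fun i x => \sum_(l < D) c l * jost l i x)%G j x =
  (\sum_(l < D) jost_matrix x l j * (c l * Cexp (mu l * RtoC x)))%G.
Proof.
rewrite modal_sum; apply: eq_bigr => l _; rewrite modal_jost.
by rewrite mulrCA.
Qed.

Lemma jost_independent (c : nat -> C) :
  (forall j x, (j < D)%N -> 0 <= x -> (\sum_(l < D) c l * jost l j x = 0)%G) ->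
  forall l, (l < D)%N -> c l = 0%G.
Proof.
move=> h l hl; have [X [beta [X0 bet0 hlow]]] := jost_matrix_lower_bound.
have := hlow X (fun l => c l * Cexp (mu l * RtoC X))%G 0 (Rle_refl X) _ l hl.
have hz j : (j < D)%N -> Cmod (\sum_(l < D) jost_matrix X l j * (c l * Cexp (mu l * RtoC X)))%G <= 0.
  move=> hj; rewrite -modal_jost_sum /modal big1 ?mulr0 ?Cmod_zero; first exact: Rle_refl.
  by move=> i _; rewrite h // mulr0.
move=> /(_ hz) hle; have : (c l * Cexp (mu l * RtoC X) = 0)%G.
  exact: Cmod_mul_le0 bet0 hle.
by move/eqP; rewrite mulf_eq0 => /orP[/eqP|/eqP /Cexp_neq0].
Qed.

(** The modes are matched at one point X where the matrix is invertible; the difference has zero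
    data at X and vanishes by uniqueness. *)
Lemma jost_expansion (Y : nat -> R -> C) : pencil_solution m p k Y ->
  exists c : nat -> C, forall j x, (j < D)%N -> 0 <= x ->
    Y j x = (\sum_(l < D) c l * jost l j x)%G.
Proof.
move=> solY; have [X [beta [X0 bet0 hlow]]] := jost_matrix_lower_bound.
pose A : 'M[C]_D := (\matrix_(l, j) jost_matrix X l j)%G.
have Au : A \in unitmx.
  rewrite unitmxE unitfE; apply/negP => /det0P [v v0 vA].
  move/negP: v0; apply; apply/eqP/rowP => l; rewrite [RHS]mxE.
  pose c n := if insub n is Some i then v ord0 i else 0%G.
  have cE (i : 'I_D) : c i = v ord0 i.
    by rewrite /c insubT //= => hi; congr (v _ _); exact: val_inj.
  have := hlow X c 0 (Rle_refl X) _ l (ltn_ord l).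
  have hz j : (j < D)%N -> Cmod (\sum_(l < D) jost_matrix X l j * c l)%G <= 0.
    move=> hj; have := congr1 (fun M : 'rV_D => M ord0 (Ordinal hj)) vA.
    rewrite !mxE => e; rewrite -[X in Cmod X](_ : 0%G = _); first by rewrite Cmod_zero; exact: Rle_refl.
    rewrite -[LHS]e; apply: eq_bigr => i _; rewrite !mxE cE; exact: mulrC.
  move=> /(_ hz); rewrite cE => hle; exact: Cmod_mul_le0 bet0 hle.
have [t tA] : exists t : 'rV[C]_D, (t *m A = \row_j modal m nu k Y j X)%G.
  by exists ((\row_j modal m nu k Y j X) *m invmx A)%G; rewrite mulmxKV.
pose d n := if insub n is Some i then t ord0 i else 0%G.
have dE (i : 'I_D) : d i = t ord0 i.
  by rewrite /d insubT //= => hi; congr (t _ _); exact: val_inj.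
pose c l := (d l / Cexp (mu l * RtoC X))%G.
pose Z j x := (Y j x + \sum_(l < D) (- c l) * jost l j x)%G.
have solZ : pencil_solution m p k Z.
  apply: pencil_solution_add => //.
  by apply: (@pencil_solution_sum _ _ m0 k D (fun l => - c l)%G jost) => l hl; exact: jost_solution.
have modZ j : (j < D)%N -> modal m nu k Z j X = 0%G.
  move=> hj.
  have -> : modal m nu k Z j X = (modal m nu k Y j X +
      modal m nu k (fun i x => \sum_(l < D) (- c l) * jost l i x)%G j X)%G.
    rewrite /modal -mulrDr -big_split /=; congr (_ * _)%G.
    by apply: eq_bigr => i _; rewrite /Z mulrDr.
  rewrite (modal_jost_sum (fun l => - c l)%G).
  have := congr1 (fun M : 'rV_D => M ord0 (Ordinal hj)) tA.
  rewrite !mxE => <-; rewrite -big_split /= big1 // => l _.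
  rewrite !mxE /c mulNr divfK; last by apply/eqP; exact: Cexp_neq0.
  by rewrite dE mulrN mulrC subrr.
have ZX i : (i < D)%N -> Z i X = 0%G.
  move=> hi; rewrite (modal_inverse nu m0 k0 Z X hi) big1 // => l _.
  by rewrite modZ // mulr0.
exists c => j x hj x0; apply/eqP; rewrite -subr_eq0; apply/eqP.
apply: etrans (pencil_solution_unique m0 hp solZ X0 ZX hj x0).
by rewrite /Z -sumrN; congr (_ + _)%G; apply: eq_bigr => l _; rewrite mulNr.
Qed.

(** The lower bound is applied to the products c_l exp(mu_l x) simultaneously, so no comparison
    between exponents is made. For Re mu_l >= 0 the exponential has modulus at least 1, imaginary
    exponents included. *)
Lemma decaying_jost_coef (c : nat -> C) (Y : nat -> R -> C) :
  (forall j x, (j < D)%N -> 0 <= x -> Y j x = (\sum_(l < D) c l * jost l j x)%G) ->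
  decays m Y -> forall l, (l < D)%N -> 0 <= Re (mu l) -> c l = 0%G.
Proof.
move=> eY decY l hl hmu; have [X [beta [X0 bet0 hlow]]] := jost_matrix_lower_bound.
apply: Cmod_eq0; apply: Rle_antisym; last exact: Cmod_ge_0.
apply: le_epsilon => eps e0; rewrite Rplus_0_l.
have eb : 0 < beta * eps by exact: Rmult_lt_0_compat.
have [X' X'0 hX'] := modal_decays nu m0 k0 decY eb.
pose x := Rmax X X'.
have x0 : 0 <= x by apply: Rle_trans X0 (Rmax_l _ _).
have := hlow x (fun l => c l * Cexp (mu l * RtoC x))%G (beta * eps) (Rmax_l _ _) _ l hl.
have hz j : (j < D)%N ->
    Cmod (\sum_(l < D) jost_matrix x l j * (c l * Cexp (mu l * RtoC x)))%G <= beta * eps.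
  move=> hj; rewrite -modal_jost_sum.
  have <- : modal m nu k Y j x = modal m nu k (fun i x => \sum_(l < D) c l * jost l i x)%G j x.
    by rewrite /modal; congr (_ * _)%G; apply: eq_bigr => i _; rewrite eY.
  by apply: hX' => //; exact: Rmax_r.
move=> /(_ hz); rewrite Cmod_mul Cmod_Cexp.
have -> : Re (mu l * RtoC x)%G = Re (mu l) * x by rewrite Re_mul /Re /Im /=; ring.
have e1 : 1 <= exp (Re (mu l) * x).
  rewrite -exp_0; case: (Req_dec (Re (mu l) * x) 0) => [->|ne]; first exact: Rle_refl.
  by apply/Rlt_le/exp_increasing; have := Rmult_le_pos _ _ hmu x0; lra.
have c0 := Cmod_ge_0 (c l) => h.
apply: (Rmult_le_reg_l beta) => //; apply: Rle_trans h.
by apply: Rmult_le_compat_l; [exact: Rlt_le | nra].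
Qed.

Lemma jost_decays (N : nat) (c : nat -> C) : (N <= D)%N ->
  (forall l, (l < N)%N -> Re (mu l) < 0) ->
  decays m (fun j x => \sum_(l < N) c l * jost l j x)%G.
Proof.
elim: N => [|N IH] hN hneg eps e0.
  by exists 0; [exact: Rle_refl | move=> j x _ _; rewrite big_ord0 Cmod_zero; exact: Rlt_le].
have [X X0 hX] := IH (ltnW hN) (fun l hl => hneg l (ltnW hl)) (eps / 2) ltac:(lra).
have hn := hneg N (ltnSn N).
pose V := Cmod (c N) * (2 * Series (fun n => L * w n)) + 1.
have Vp : 0 < V by have := Rmult_le_pos _ _ (Cmod_ge_0 (c N)) V0; rewrite /V; lra.
have eV : 0 < eps / 2 / V by apply: Rdiv_lt_0_compat; lra.
have [X' X'0 hX'] := exp_neg_small eV.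
exists (Rmax X (X' / - Re (mu N))).
  exact: Rle_trans X0 (Rmax_l _ _).
move=> j x hj hx; rewrite big_ord_recr.
have x1 := Rle_trans _ _ _ (Rmax_l _ _) hx.
have x2 := Rle_trans _ _ _ (Rmax_r _ _) hx.
have x0 := Rle_trans _ _ _ X0 x1.
have x3 : X' <= - (Re (mu N) * x).
  have -> : X' = X' / - Re (mu N) * - Re (mu N) by field; lra.
  have := Rmult_le_compat_r (- Re (mu N)) _ _ ltac:(lra) x2; lra.
have hexp := hX' _ x3; rewrite Ropp_involutive in hexp.
have hj' : Cmod (c N * jost N j x)%G <= eps / 2.
  rewrite Cmod_mul; apply: Rle_trans (Rmult_le_compat_l _ _ _ (Cmod_ge_0 _)
    (jost_bound hN (ltnW hj) x0)) _.
  have -> : eps / 2 = (eps / 2 / V) * V by field; lra.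
  have -> : Cmod (c N) * (exp (Re (mu N) * x) * (2 * Series (fun n => L * w n))) =
    exp (Re (mu N) * x) * (Cmod (c N) * (2 * Series (fun n => L * w n))) by ring.
  apply: Rmult_le_compat => //; first exact/Rlt_le/exp_pos.
    exact: Rmult_le_pos (Cmod_ge_0 _) V0.
  by rewrite /V; lra.
by apply: Rle_trans (Cmod_add_le (hX j x hj x1) hj') _; lra.
Qed.

Lemma jost_at_0 (l i : nat) : jost l i 0 = CSeries (jost_coef l i).
Proof.
rewrite /jost expserE; last exact: Rle_refl.
have -> : Cexp (mu l * RtoC 0)%G = 1%G.
  have -> : (mu l * RtoC 0 = 0)%G by exact: mulr0.
  by rewrite /Cexp /= exp_0 cis0 mulr1.
rewrite mul1r Ropp_0 exp_0 /eser; congr CSeries; apply: funext => n.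
by rewrite pow1 -C_1E mulr1.
Qed.

End FixedK.
End Jost.

(** * Finiteness of the eigenvalues *)

Section ApproxBigop.
Variables (Om : C -> Prop) (K : R).
Hypotheses (K0 : 0 <= K) (OmK : forall x, Om x -> Cmod x <= K).
Local Notation approx := (approximable Om K).

Lemma approx_bigsum (I : Type) (s : seq I) (f : I -> C -> C) :
  (forall i, exists M, approx M (f i)) ->
  exists M, approx M (fun x => \sum_(i <- s) f i x)%G.
Proof.
move=> h; elim: s => [|i s [M hM]].
  exists (Cmod 0%G); apply: approx_ext (approx_const Om K 0%G) => x _.
  by rewrite big_nil.
have [M' hM'] := h i; exists (M' + M).
by apply: approx_ext (approx_add K0 hM' hM) => x _; rewrite big_cons.
Qed.

Lemma approx_bigprod (I : Type) (s : seq I) (f : I -> C -> C) :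
  (forall i, exists M, approx M (f i)) ->
  exists M, approx M (fun x => \prod_(i <- s) f i x)%G.
Proof.
move=> h; elim: s => [|i s [M hM]].
  exists (Cmod 1%G); apply: approx_ext (approx_const Om K 1%G) => x _.
  by rewrite big_nil.
have [M' hM'] := h i; exists (M' * M).
by apply: approx_ext (approx_mul K0 OmK hM' hM) => x _; rewrite big_cons.
Qed.

Lemma approx_det (n : nat) (f : nat -> nat -> C -> C) :
  (forall i j, (i < n)%N -> (j < n)%N -> exists M, approx M (f i j)) ->
  exists M, approx M (fun x => \det (\matrix_(i < n, j < n) f i j x))%G.
Proof.
move=> h; rewrite /determinant.
apply: (approx_bigsum _ (f := fun (s : 'S_n) x =>
  ((-1) ^+ s * \prod_(i < n) (\matrix_(i < n, j < n) f i j x) i (s i))%G)) => s.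
have [M hM] := @approx_bigprod 'I_n (index_enum 'I_n) (fun i => f i (s i))
  (fun i => h i (s i) (ltn_ord i) (ltn_ord (s i))).
exists (Cmod ((-1) ^+ s)%G * M); apply: approx_ext (approx_scale K0 OmK ((-1) ^+ s)%G hM) => x _.
by congr (_ * _)%G; apply: eq_bigr => i _; rewrite mxE.
Qed.

End ApproxBigop.

Lemma Im_Cconj_exp (z : C) (n : nat) : Re (Cconj z ^+ n)%G = Re (z ^+ n)%G /\
  Im (Cconj z ^+ n)%G = - Im (z ^+ n)%G.
Proof.
elim: n => [|n [IH1 IH2]]; first by rewrite !expr0 /=; split=> //; ring.
rewrite !exprS !(Re_mul, Im_mul) IH1 IH2 /Cconj /Re /Im /=.
by split; ring.
Qed.

(* If |w - n| = |w| with n real nonzero, then w - n is minus the conjugate of w. *)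
Lemma shifted_power_real (w : C) (n : R) (d : nat) : n <> 0 ->
  ((w - RtoC n) ^+ (2 * d.+1) = w ^+ (2 * d.+1))%G -> Im (w ^+ (2 * d.+1))%G = 0.
Proof.
move=> n0 e.
have emod : Cmod (w - RtoC n)%G = Cmod w.
  have := congr1 Cmod e; rewrite !Cmod_exp => h.
  have inj (a b : R) : 0 <= a -> 0 <= b -> a < b -> a ^ (2 * d.+1)%N < b ^ (2 * d.+1)%N.
    move=> a0 b0 ab; rewrite mulnS add2n; elim: (2 * d).+1 => [|i IH] /=; first by rewrite !Rmult_1_r.
    by apply: Rmult_le_0_lt_compat => //; apply: (pow_le a i.+1).
  have := Cmod_ge_0 (w - RtoC n)%G; have := Cmod_ge_0 w => h1 h2.
  case: (Rtotal_order (Cmod (w - RtoC n)%G) (Cmod w)) => [lt|[//|lt]].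
    by have := inj _ _ h2 h1 lt; rewrite h => /Rlt_irrefl.
  by have := inj _ _ h1 h2 lt; rewrite h => /Rlt_irrefl.
have hre : 2 * Re w = n.
  have := congr1 (fun t => t ^ 2) emod; rewrite !Cmod_sqr.
  rewrite Re_add Im_add Re_opp Im_opp; rewrite /= -!/(Re _) -!/(Im _) => h.
  by apply: (Rmult_eq_reg_l n) => //; move: h; rewrite /Re /Im /=; lra.
have ew : (w - RtoC n = - Cconj w)%G.
  apply: C_ext; rewrite ?Re_add ?Im_add ?Re_opp ?Im_opp /Cconj /Re /Im /=.
    by move: hre; rewrite /Re => <-; ring.
  by ring.
(* The exponent is even, so the equation says that w^(2d+2) equals its own conjugate. *)
have s2 : ((-1 : C) ^+ (2 * d.+1) = 1)%G by rewrite exprM sqrrN !expr1n.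
move: e; rewrite ew -mulN1r exprMn s2 mul1r => e.
have [_ h] := Im_Cconj_exp w (2 * d.+1); rewrite e in h; lra.
Qed.

Section Main.
Variables (m : nat) (p : nat -> nat -> nat -> C) (nu : nat).
Hypotheses (m0 : (0 < m)%N) (hp : summable_coef m p).
Local Notation D := (2 * m)%N.
Local Notation th := (theta m nu).

(* On this ray no exponent theta_l k - n with n >= 1 is again an exponent. *)
Lemma nonresonant_point (r : R) : 0 < r -> exists k, [/\ Cmod k = r, sector m nu k &
  forall l n, (0 < n)%N -> indicial m nu l n k <> 0%G].
Proof.
move=> r0; have mp := lt_0_INR m (elimT ltP m0).
(* A quarter of the way into the sector, k^(2m) = i r^(2m) is purely imaginary, and so is (theta
   k)^(2m); a resonance would make it real. *)
pose t := INR nu * PI / INR m + PI / (4 * INR m).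
have pp := PI_RGT_0.
exists (RtoC r * cis t)%G; split.
- by rewrite Cmod_mul Cmod_RtoC Cmod_cis Rmult_1_r Rabs_pos_eq //; exact: Rlt_le.
- exists r, t; split=> //; split; last first.
    by apply: C_ext; rewrite ?Re_mul ?Im_mul /Re /Im /=; ring.
  have h1 : 0 < PI / (4 * INR m) by apply: Rdiv_lt_0_compat; lra.
  rewrite S_INR /t; split; first lra.
  have -> : (INR nu + 1) * PI / INR m = INR nu * PI / INR m + 4 * (PI / (4 * INR m)).
    by field; lra.
  lra.
- move=> l n n0; set k := (RtoC r * cis t)%G => e.
  have kD : (k ^+ D = RtoC (r ^ D) * cis (PI / 2))%G.
    rewrite /k exprMn RtoC_exp cis_exp; congr (_ * _)%G.
    have -> : INR D * t = INR nu * (2 * PI) + PI / 2.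
      by rewrite /t -multE mult_INR /=; field; lra.
    by rewrite cisD cis_2PI mul1r.
  have kw : (k ^+ D = (-1) ^+ m * (th l * k) ^+ D)%G.
    by rewrite mu_exp // mulrA sign_sqr mul1r.
  have n0' : INR n <> 0 by have := lt_0_INR n (elimT ltP n0); lra.
  have ew : ((th l * k - RtoC (INR n)) ^+ D = (th l * k) ^+ D)%G.
    apply: (mulfI (sign_neq0 m)); rewrite -C_natr -kw.
    by apply/eqP; rewrite -subr_eq0; apply/eqP.
  have := @shifted_power_real (th l * k)%G (INR n) m.-1 n0'; rewrite prednK // => /(_ ew).
  rewrite mu_exp // kD.
  have -> : cis (PI / 2) = Ci by rewrite /cis cos_PI2 sin_PI2.
  have rD : 0 < r ^ D by exact: pow_lt.
  have [->|->] : ((-1) ^+ m = 1 :> C)%G \/ ((-1) ^+ m = -1 :> C)%G.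
    by rewrite -signr_odd; case: odd; [right|left].
  - by rewrite mul1r Im_mul /Re /Im /=; lra.
  - by rewrite mulN1r Im_opp Im_mul /Re /Im /=; lra.
Qed.

(** Beyond the disc there are no eigenvalues. Inside, each one is 0, a zero of q or a zero of W; 0
    is set apart because all exponents theta_l k coincide there. *)
Lemma eigenvalues_finite :
  finite_set [set k : C | closed_sector m nu k /\ is_eigenvalue m p k]%classic.
Proof.
have [K0 hK0] := @no_decaying_solution m p nu m0 hp.
(* Every k with |k| >= r is covered by the a priori estimate, including the circle |k| = r, where W
   will be shown not to vanish. *)
pose r := Rmax 1 K0; have r1 : 1 <= r by exact: Rmax_l.
have r0 : 0 < r by lra.
have rK0 : K0 <= r by exact: Rmax_r.
have [q [b [u [[Mq hq] [su u0] hb hrec hq0]]]] := @frobenius_family m p nu m0 hp r r0.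
pose Om (k : C) := Cmod k <= r /\ q k <> 0%G.
pose K := 4 * r; have K1 : 0 <= K by rewrite /K; lra.
have OmK x : Om x -> Cmod x <= K by case=> h _; rewrite /K; lra.
have ltmD l : (l < m)%N -> (l < D)%N.
  by move=> lm; apply: leq_trans lm _; rewrite mul2n -addnn leq_addr.
have sumD (c : nat -> C) (F : nat -> C) : (forall l, (m <= l < D)%N -> c l = 0%G) ->
    (\sum_(l < D) c l * F l = \sum_(l < m) c l * F l)%G.
  move=> hc; rewrite mul2n -addnn big_split_ord /= [X in (_ + X)%G]big1 ?addr0 //.
  by move=> i _; rewrite hc ?mul0r // leq_addr /= mul2n -addnn ltn_add2l.
pose F l i k := CSeries (jost_coef m nu k (fun l n => b l n k) l i).
have hF l i : (l < m)%N -> (i < m)%N -> exists M, approximable Om K M (F l i).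
  move=> lm im; have hl := ltmD l lm; have hi := ltmD i im.
  exists (Series (fun n => (1 + K) ^ D * u n)).
  apply: (@approx_series Om K (fun n k => jost_coef m nu k (fun l n => b l n k) l i n)) => //.
    move=> n; have := approx_mul K1 OmK
      (approx_exp K1 OmK i (approx_shift m nu K1 OmK l n)) (hb l n hl).
    apply: approx_le.
    have n1 : 1 <= INR n.+1 by rewrite S_INR; have := pos_INR n; lra.
    have np : 0 < INR n.+1 ^ D by apply: pow_lt; lra.
    have -> : (1 + K) ^ D * u n = ((1 + K) * INR n.+1) ^ D * (u n / INR n.+1 ^ D).
      by rewrite Rpow_mult_distr; field; lra.
    apply: Rmult_le_compat_r.
      by apply: Rmult_le_pos => //; apply/Rlt_le/Rinv_0_lt_compat.
    by apply: Rle_pow; [nra | apply/leP; exact: ltnW].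
  exact: ex_series_scal_l su.
(* Rows are the first m Jost solutions and columns the boundary conditions, so a left kernel vector
   is a combination satisfying all of them. *)
pose W k := (\det (\matrix_(l < m, i < m) F l i k))%G.
have [MW hW] : exists M, approximable Om K M W by exact: approx_det.
have facts k : Om k ->
    (forall l n, (l < D)%N -> Cmod (b l n k) <= u n / INR n.+1 ^ D) /\
    (forall l, (l < D)%N -> b l 0%N k <> 0%G).
  move=> hk; split=> l => [n hl|hl]; first exact: approx_bound (hb l n hl) hk.
  by case: hk => h1 h2; case: (hrec l k hl h2 h1).
have recs k : Om k -> forall l n, (l < D)%N -> (0 < n)%N ->
     (indicial m nu l n k * b l n k = - \sum_(j < n) kern m p nu l k n j * b l j k)%G.
  by move=> [h1 h2] l n hl; case: (hrec l k hl h2 h1) => _; apply.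
have eig0 k : closed_sector m nu k -> Om k -> k <> 0%G -> is_eigenvalue m p k -> W k = 0%G.
  move=> sk hk /eqP kn0 /(eigenvalue_solution m0) [Y [solY smallY [x x0 Yx] bcY]].
  have [f1 f2] := facts k hk.
  have decY := often_small_decays m0 hp solY smallY.
  have [c hc] := jost_expansion m0 hp kn0 su f1 f2 (recs k hk) solY.
  (* Also on the boundary of the sector these exponents have real part at least 0. The coefficients
     with l < m then form a nonzero left kernel vector. *)
  have c0 l : (m <= l < D)%N -> c l = 0%G.
    move=> hl; have hlD : (l < D)%N by case/andP: hl.
    apply: (decaying_jost_coef m0 kn0 su f1 f2 hc decY hlD).
    by case: (closed_sector_sign l m0 sk) => _; apply.
  pose J := jost m nu k (fun l n => b l n k).
  apply/eqP/det0P; exists (\row_l c l)%G.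
    apply/eqP => /rowP cz; apply: Yx; rewrite hc ?muln_gt0 // (sumD c (fun l => J l 0%N x) c0) big1 // => l _.
    by have := cz l; rewrite !mxE => ->; rewrite mul0r.
  apply/rowP => i; rewrite !mxE.
  transitivity (Y i 0); last exact: bcY.
  rewrite hc ?ltmD //; last exact: Rle_refl.
  rewrite (sumD c (fun l => J l i 0) c0); apply: eq_bigr => l _; rewrite !mxE /F.
  by rewrite /J jost_at_0.
have [ks [kr sks nres]] := nonresonant_point r0.
have hks : Om ks.
  have ler := Req_le _ _ kr.
  by split=> //; apply: hq0 => // l n _; exact: nres.
have ksn0 : ks != 0%G.
  by apply/eqP => e; move: kr; rewrite e Cmod_zero; lra.
have Wks : W ks <> 0%G.
  move=> /eqP /det0P [v v0 vM]; have [f1 f2] := facts ks hks.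
  pose c n := if insub n is Some i then v ord0 i else 0%G.
  have cE (i : 'I_m) : c i = v ord0 i.
    by rewrite /c insubT //= => hi; congr (v _ _); exact: val_inj.
  have c0 l : (m <= l < D)%N -> c l = 0%G.
    by case/andP=> ml _; rewrite /c insubF // ltnNge ml.
  pose J := jost m nu ks (fun l n => b l n ks).
  have solJ l : (l < D)%N -> pencil_solution m p ks (J l).
    exact: (jost_solution m0 hp su f1 (recs ks hks)).
  (* The point lies in the open sector, so these real parts are strictly negative and any
     combination decays. *)
  have neg l : (l < m)%N -> Re (th l * ks)%G < 0.
    by move=> lm; case: (sector_sign l m0 sks) => h _; exact: h.
  have cs : closed_sector m nu ks.
    by move=> eps; exists ks; split=> //; rewrite -[X in Cmod X]/(ks - ks)%G subrr Cmod_zero; case: eps.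
  have solY : pencil_solution m p ks (fun j x => \sum_(l < m) c l * J l j x)%G.
    by apply: (pencil_solution_sum m0 c) => l /ltmD; exact: solJ.
  have mD : (m <= D)%N by rewrite mul2n -addnn leq_addr.
  have decY := jost_decays m0 su f1 c mD neg.
  have bcY i : (i < m)%N -> (\sum_(l < m) c l * J l i 0 = 0)%G.
    move=> hi; have := congr1 (fun M : 'rV_m => M ord0 (Ordinal hi)) vM.
    rewrite !mxE => e; apply: etrans e; apply: eq_bigr => l _.
    by rewrite !mxE cE /J jost_at_0.
  (* A kernel vector would give a decaying solution with zero boundary values at |k| = r; it
     vanishes, and independence of the Jost solutions kills the vector. *)
  have Y0 := hK0 ks cs (ltac:(rewrite kr; exact: rK0)) _ solY decY bcY.
  move/negP: v0; apply; apply/eqP/rowP => l; rewrite [RHS]mxE -cE.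
  apply: (jost_independent m0 ksn0 su f1 f2 (c := c)); last exact: ltmD.
  by move=> j x hj x0; apply: etrans (sumD c (fun l => J l j x) c0) _; exact: Y0.
have finW := @approximable_finite_zeros Om r MW W ks r0 (fun x hx => proj1 hx) hW hks Wks.
(* At k = 0 each denominator equals (-1)^m n^(2m) up to the even sign, so q does not vanish
   identically and has finitely many zeros. *)
have q00 : q (RtoC 0) <> RtoC 0.
  apply: hq0 => [|l n _ n0]; first by rewrite Cmod_0; lra.
  have D0 : (D == 0%N) = false by rewrite muln_eq0 /= eqn0Ngt m0.
  rewrite /indicial -C_0E mulr0 sub0r expr0n D0 subr0.
  apply/eqP; rewrite mulf_neq0 ?sign_neq0 // expf_neq0 // oppr_eq0.
  exact: C_natr_neq0.
have disc0 : Cmod (RtoC 0) <= r by rewrite Cmod_0; lra.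
have finq := @approximable_finite_zeros (fun k => Cmod k <= r) r Mq q (RtoC 0) r0
  (fun x hx => hx) hq disc0 q00.
have fin0 : finite_set [set RtoC 0]%classic by exact: finite_set1.
apply: (sub_finite_set _ (_ : finite_set ([set RtoC 0] `|`
  ([set k : C | Cmod k <= r /\ q k = RtoC 0] `|` [set k : C | Om k /\ W k = RtoC 0]))%classic));
  last by rewrite !finite_setU.
move=> k [sk ek].
have [->|kn0] := pselect (k = RtoC 0); first by left.
right; case: (Rle_lt_dec (Cmod k) r) => kr'; last first.
  have [Y [solY smallY [x x0 Yx] bcY]] := eigenvalue_solution m0 ek.
  have decY := often_small_decays m0 hp solY smallY.
  exfalso; apply: Yx; apply: (hK0 k sk _ Y solY decY bcY) => //; last exact: D_gt0.
  by apply: Rle_trans rK0 _; exact: Rlt_le.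
have [qk|qk] := pselect (q k = RtoC 0); first by left.
by right; split; [split | apply: eig0].
Qed.

End Main.

Unset Implicit Arguments.

Theorem theorem4 (m : nat) (hm : (1 <= m)%N)
    (p : nat -> nat -> nat -> C) (hp : summable_coef m p)
    (nu : nat) (hnu : (m <= nu <= 2 * m - 1)%N) :
  finite_set [set k : C | closed_sector m nu k /\ is_eigenvalue m p k]%classic.
Proof. exact: eigenvalues_finite hm hp. Qed.
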